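(* There exist an absolute constant $C$ and a deterministic algorithm with running time polynomial (indeed $O(|V|^3)$) in the number of vertices $|V| = m_\ell m_s$, which, given any instance $(G, X_I, X_G)$ on an $m_\ell\times m_s$ grid $G$ ($m_\ell \ge m_s$, $m_\ell\ge 3$, $m_s\ge 2$) with all vertices occupied, outputs a valid solution, such that for all sufficiently large $m_\ell$, the average over all instances on $G$ with $X_I \neq X_G$ of the ratio (makespan of the output solution)/(minimum makespan of the instance) is at most $C$.
   Context: The $m_\ell \times m_s$ grid graph has vertex set $\{1,\dots,m_\ell\}\times\{1,\dots,m_s\}$ with edges between vertices at $\ell_1$-distance 1. A configuration is a bijection from robot labels $\{1,\dots,m_\ell m_s\}$ to the vertex set. A solution of $(G,X_I,X_G)$ is a sequence of synchronous steps from $X_I$ to $X_G$ in which each robot stays put or moves to an adjacent vertex, with no two robots at the same vertex afterwards and no two robots traversing the same edge in opposite directions; its makespan is the number of steps, and the minimum makespan is the least makespan over all solutions. *)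

(* Defs.v *)
From mathcomp Require Import all_boot all_order all_algebra.
Set Implicit Arguments. Unset Strict Implicit. Unset Printing Implicit Defensive.

Definition vtx (ml ms : nat) := ('I_ml * 'I_ms)%type.

(* A configuration: map from robot labels 'I_(ml*ms) to vertices.
   It is a configuration (bijection) iff it is injective (equal cardinalities). *)
Definition config (ml ms : nat) := {ffun 'I_(ml * ms) -> vtx ml ms}.

Definition is_config ml ms (X : config ml ms) : bool := injectiveb X.

Definition grid_adj ml ms (u v : vtx ml ms) : bool :=
  ((u.1 == v.1 :> nat) && ((u.2.+1 == v.2 :> nat) || (v.2.+1 == u.2 :> nat)))
  || ((u.2 == v.2 :> nat) && ((u.1.+1 == v.1 :> nat) || (v.1.+1 == u.1 :> nat))).

Definition valid_step ml ms (X Y : config ml ms) : bool :=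
  [&& injectiveb Y,
      [forall r, (Y r == X r) || grid_adj (X r) (Y r)] &
      ~~ [exists r1, exists r2, [&& r1 != r2, Y r1 == X r2 & Y r2 == X r1]]].

(* A solution from XI to XG is the sequence s = [X_1; ...; X_T] of the
   configurations after each step; its makespan is T = size s. *)
Definition is_solution ml ms (XI XG : config ml ms) (s : seq (config ml ms)) : Prop :=
  path (@valid_step ml ms) XI s /\ last XI s = XG.

Definition is_min_makespan ml ms (XI XG : config ml ms) (T : nat) : Prop :=
  (exists s, is_solution XI XG s /\ size s = T) /\
  (forall s, is_solution XI XG s -> T <= size s).

Definition instances ml ms : {set config ml ms * config ml ms} :=
  [set p | [&& is_config p.1, is_config p.2 & p.1 != p.2]].

Inductive instr : Type :=
| ICONST (d k : nat)
| IADD (d a b : nat)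
| ISUB (d a b : nat)      (* M[d] := M[a] - M[b] (truncated) *)
| ILOAD (d a : nat)
| ISTORE (d a : nat)
| IJZ (a l : nat)
| IHALT.

Definition program := seq instr.
Definition state := (nat * (nat -> nat))%type.   (* program counter, memory *)

Definition upd (m : nat -> nat) (a v : nat) : nat -> nat :=
  fun x => if x == a then v else m x.

(* One step; None when halted (IHALT, or pc outside the program). *)
Definition step (P : program) (s : state) : option state :=
  let: (pc, m) := s in
  match nth IHALT P pc with
  | ICONST d k => Some (pc.+1, upd m d k)
  | IADD d a b => Some (pc.+1, upd m d (m a + m b))
  | ISUB d a b => Some (pc.+1, upd m d (m a - m b))
  | ILOAD d a => Some (pc.+1, upd m d (m (m a)))
  | ISTORE d a => Some (pc.+1, upd m (m d) (m a))
  | IJZ a l => Some (if m a == 0 then l else pc.+1, m)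
  | IHALT => None
  end.

Definition halted (P : program) (s : state) : bool :=
  if step P s is None then true else false.

Fixpoint run (P : program) (t : nat) (s : state) : state :=
  match t with
  | 0 => s
  | t'.+1 => if step P s is Some s' then run P t' s' else s
  end.

Definition enc_vtx ml ms (v : vtx ml ms) : nat := v.1 * ms + v.2.

(* Input memory: M[0] = ml, M[1] = ms, M[2+r] = XI(r), M[2+n+r] = XG(r). *)
Definition init_mem ml ms (XI XG : config ml ms) : nat -> nat :=
  fun a =>
    if a == 0 then ml else if a == 1 then ms else
    match (insub (a - 2) : option 'I_(ml * ms)) with
    | Some r => enc_vtx (XI r)
    | None =>
      match (insub (a - 2 - ml * ms) : option 'I_(ml * ms)) with
      | Some r => enc_vtx (XG r)
      | None => 0
      end
    end.

Definition encodes_solution ml ms (m : nat -> nat) (XI : config ml ms)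
    (s : seq (config ml ms)) : Prop :=
  m 0 = size s /\
  forall (k : nat) (r : 'I_(ml * ms)), k <= size s ->
    m (1 + k * (ml * ms) + r) = enc_vtx (nth XI (XI :: s) k r).

Definition final_state (P : program) (c : nat) ml ms (XI XG : config ml ms) : state :=
  run P (c * (ml * ms) ^ 3) (0, init_mem XI XG).

Definition out_makespan (P : program) (c : nat) ml ms (XI XG : config ml ms) : nat :=
  (final_state P c XI XG).2 0.

(* Main.v *)
(** Every instance is routed in [222 * ml] steps. A transposition of two adjacent
    robots in a 3 x 2 block is a product of at most five rotations of cycles of
    the block, each of which is a legal step; disjoint blocks work in parallel.
    Hence a round of comparators on all edges of all rows, or all columns, takes
    constantly many steps, and [ml] rounds sort every line. Three sorting phases
    suffice: colour the robots, seen as edges between their start column and their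
    goal column, with [ml] colours (Koenig, by Kempe exchanges), move each robot
    within its column to the row given by its colour, then within that row to its
    goal column, then within that column to its goal row.

    Conversely the minimum makespan is at least the row displacement of each
    robot. For two fixed robots the larger displacement [d] of a random instance
    satisfies [E (1 / (d + 1)) = O (1 / ml)], so the average ratio is bounded.

    The machine program is compiled from a small language with bounded loops. All
    directly addressable cells hold input at the beginning and output at the end,
    so the program first moves to addresses beyond [1024 * 8 ^ ml]. *)

Require Import Defs.
From mathcomp Require Import all_boot all_order all_algebra.
From mathcomp Require Import all_fingroup.
From mathcomp Require Import zify.
Set Implicit Arguments. Unset Strict Implicit. Unset Printing Implicit Defensive.

(** * Structured code for the random access machine *)

Definition reaches (P : program) (k : nat) (s s' : state) := exists2 t, t <= k & run P t s = s'.

Lemma run_add P t u s : run P (t + u) s = run P u (run P t s).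
Proof.
elim: t s => [|t IH] s //=.
case E: (step P s) => [s'|]; first exact: IH.
by case: u {IH} => //= u; rewrite E.
Qed.

Lemma reaches_trans P k l s1 s2 s3 :
  reaches P k s1 s2 -> reaches P l s2 s3 -> reaches P (k + l) s1 s3.
Proof.
move=> [t le_tk run_t] [u le_ul run_u]; exists (t + u); first exact: leq_add.
by rewrite run_add run_t.
Qed.

Lemma reaches_step P k s1 s2 s3 :
  step P s1 = Some s2 -> reaches P k s2 s3 -> reaches P k.+1 s1 s3.
Proof. by move=> step12 [t le_tk run_t]; exists t.+1 => //=; rewrite step12. Qed.

Lemma reaches_halted P k K s s' :
  reaches P k s s' -> k <= K -> step P s' = None -> run P K s = s'.
Proof.
move=> [t le_tk run_t] le_kK halt; rewrite -(subnKC (leq_trans le_tk le_kK)) run_add run_t.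
by case: (K - t) => //= d; rewrite halt.
Qed.

Definition code_at (P : program) (off : nat) (p : program) :=
  forall i, i < size p -> nth IHALT P (off + i) = nth IHALT p i.

Lemma code_at_cat P off p q :
  code_at P off (p ++ q) -> code_at P off p /\ code_at P (off + size p) q.
Proof.
move=> at_pq; split=> i lt_i.
  by rewrite at_pq ?size_cat ?ltn_addr // nth_cat lt_i.
by rewrite -addnA at_pq ?size_cat ?ltn_add2l // nth_cat ltnNge leq_addr addKn.
Qed.

Lemma code_at_cons P off i p :
  code_at P off (i :: p) -> nth IHALT P off = i /\ code_at P off.+1 p.
Proof.
rewrite -cat1s => /code_at_cat[at_i]; rewrite addn1; split=> //.
by rewrite -[off]addn0 at_i.
Qed.

Definition jump_free (i : instr) := match i with IJZ _ _ | IHALT => false | _ => true end.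

Definition exec_instr (m : nat -> nat) (i : instr) : nat -> nat :=
  match i with
  | ICONST d k => upd m d k
  | IADD d a b => upd m d (m a + m b)
  | ISUB d a b => upd m d (m a - m b)
  | ILOAD d a => upd m d (m (m a))
  | ISTORE d a => upd m (m d) (m a)
  | IJZ _ _ | IHALT => m
  end.

Definition exec (p : program) (m : nat -> nat) := foldl exec_instr m p.

Lemma exec_cat p q m : exec (p ++ q) m = exec q (exec p m).
Proof. exact: foldl_cat. Qed.

Lemma reaches_exec P off p m : code_at P off p -> all jump_free p ->
  reaches P (size p) (off, m) (off + size p, exec p m).
Proof.
elim: p off m => [|i p IH] off m /=; first by rewrite addn0; exists 0.
move=> /code_at_cons[at_i at_p] /andP[free_i free_p]; rewrite -addSnnS.
apply: (reaches_step (s2 := (off.+1, exec_instr m i))); last exact: IH.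
by rewrite /step at_i; case: i free_i {at_i}.
Qed.

Lemma reaches_jz P off a l m : nth IHALT P off = IJZ a l ->
  reaches P 1 (off, m) (if m a == 0 then l else off.+1, m).
Proof. by move=> at_off; exists 1; rewrite //= at_off. Qed.

Lemma upd_at m a v : upd m a v a = v.
Proof. by rewrite /upd eqxx. Qed.

(* The machine only jumps on a zero cell, so [Branch] and [Loop], which test the
   cell [a], clear the cell [z] to jump unconditionally. *)
Inductive code :=
| Straight of program
| Then of code & code
| Branch (a z : nat) of code & code
| Loop (a z : nat) of code.

Fixpoint code_size c := match c with
  | Straight p => size p
  | Then c d => code_size c + code_size d
  | Branch _ _ c d => code_size c + code_size d + 3
  | Loop _ _ c => code_size c + 3
  end.

Fixpoint asm (off : nat) c : program := match c with
  | Straight p => p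
  | Then c d => asm off c ++ asm (off + code_size c) d
  | Branch a z c d =>
      let off_d := off + code_size c + 3 in
      IJZ a off_d :: asm off.+1 c ++
      [:: ICONST z 0, IJZ z (off_d + code_size d) & asm off_d d]
  | Loop a z c => IJZ a (off + code_size c + 3) :: asm off.+1 c ++ [:: ICONST z 0; IJZ z off]
  end.

Lemma size_asm off c : size (asm off c) = code_size c.
Proof.
elim: c off => [p|c IHc d IHd|a z c IHc d IHd|a z c IHc] off //=;
  by rewrite size_cat /= ?IHc ?IHd; lia.
Qed.

Definition runs c k (m m' : nat -> nat) :=
  forall P off, code_at P off (asm off c) -> reaches P k (off, m) (off + code_size c, m').

Definition computes c k (m : nat -> nat) (Q : (nat -> nat) -> Prop) :=
  exists2 m', runs c k m m' & Q m'.

Lemma computes_weaken c k k' m (Q Q' : (nat -> nat) -> Prop) :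
  computes c k m Q -> k <= k' -> (forall m', Q m' -> Q' m') -> computes c k' m Q'.
Proof.
move=> [m' run_c Qm'] le_k QQ'; exists m'; last exact: QQ'.
by move=> P off /run_c[t le_t run_t]; exists t => //; apply: leq_trans le_k.
Qed.

Lemma computes_le c k k' m Q : k <= k' -> computes c k m Q -> computes c k' m Q.
Proof. by move=> le_k comp; apply: computes_weaken comp le_k _. Qed.

Lemma computes_reaches c k m (Q : (nat -> nat) -> Prop) : computes c k m Q ->
  exists2 m', reaches (asm 0 c) k (0, m) (size (asm 0 c), m') & Q m'.
Proof. by move=> [m' run_c Qm']; exists m'; rewrite // size_asm; apply: (run_c _ 0). Qed.

Lemma computes_straight p m (Q : (nat -> nat) -> Prop) :
  all jump_free p -> Q (exec p m) -> computes (Straight p) (size p) m Q.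
Proof. by move=> free_p Qp; exists (exec p m) => // P off at_p; apply: reaches_exec. Qed.

Lemma computes_then c d k l m (Q R : (nat -> nat) -> Prop) :
  computes c k m Q -> (forall m', Q m' -> computes d l m' R) ->
  computes (Then c d) (k + l) m R.
Proof.
move=> [m1 run_c /[swap]/[apply] -[m2 run_d Rm2]]; exists m2 => // P off /= /code_at_cat[at_c at_d].
rewrite addnA; apply: reaches_trans (run_c P off at_c) (run_d P _ _).
by rewrite size_asm in at_d.
Qed.

Lemma computes_straight_then p d k m (Q : (nat -> nat) -> Prop) : all jump_free p ->
  computes d k (exec p m) Q -> computes (Then (Straight p) d) (size p + k) m Q.
Proof.
move=> free_p comp_d; apply: (computes_then (Q := eq (exec p m))); last by move=> _ <-.
exact: computes_straight.
Qed.

Lemma computes_branch a z c d k m (Q : (nat -> nat) -> Prop) :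
  (m a != 0 -> computes c k m (fun m' => Q (upd m' z 0))) ->
  (m a = 0 -> computes d k m Q) -> computes (Branch a z c d) (k + 3) m Q.
Proof.
case: eqP => [a0 _ [] // m' run_d Qm' | /eqP a0 [] // m' run_c Qm' _].
  exists m' => // P off /= /code_at_cons[/(reaches_jz m) jump]; rewrite a0 /= in jump.
  move=> /code_at_cat[_ /code_at_cons[_ /code_at_cons[_ at_d]]].
  have [|t le_t run_t] := reaches_trans jump (run_d P (off + code_size c + 3) _).
    by move: at_d; rewrite size_asm addSn !addnS addn0.
  by exists t; [lia | rewrite run_t; congr (_, _); lia].
exists (upd m' z 0) => // P off /= /code_at_cons[/(reaches_jz m) jump]; rewrite (negbTE a0) in jump.
move=> /code_at_cat[/run_c reach_c]; rewrite size_asm -cat1s.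
move=> /code_at_cat[at_z /code_at_cons[at_jz _]].
have [t le_t run_t] := reaches_trans jump (reaches_trans reach_c
  (reaches_trans (reaches_exec m' at_z isT) (reaches_jz _ at_jz))).
by exists t; [rewrite /= in le_t; lia | rewrite run_t /exec /= upd_at; congr (_, _); lia].
Qed.

Lemma runs_loop_stop a z c m : m a = 0 -> runs (Loop a z c) 1 m m.
Proof.
move=> a0 P off /= /code_at_cons[/(reaches_jz m)]; rewrite a0 /= => jump _.
by rewrite addnA.
Qed.

Lemma runs_loop_step a z c k l m m1 m2 : m a != 0 -> runs c k m m1 ->
  runs (Loop a z c) l (upd m1 z 0) m2 -> runs (Loop a z c) (k + 3 + l) m m2.
Proof.
move=> a0 run_c run_loop P off at_loop; have /= := at_loop.
move=> /code_at_cons[/(reaches_jz m) jump]; rewrite (negbTE a0) in jump.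
move=> /code_at_cat[/run_c reach_c]; rewrite size_asm -cat1s.
move=> /code_at_cat[at_z /code_at_cons[at_jz _]].
have back := reaches_jz (upd m1 z 0) at_jz; rewrite upd_at /= in back.
have [t le_t run_t] := reaches_trans jump (reaches_trans reach_c
  (reaches_trans (reaches_exec m1 at_z isT) (reaches_trans back (run_loop P off at_loop)))).
by exists t; [rewrite /= in le_t; lia | exact: run_t].
Qed.

Lemma computes_loop (I : nat -> (nat -> nat) -> Prop) a z c k N m : I N m ->
  (forall i m', I i m' -> (m' a == 0) = (i == 0)) ->
  (forall i m', I i.+1 m' -> computes c k m' (fun m'' => I i (upd m'' z 0))) ->
  computes (Loop a z c) (N * (k + 3) + 1) m (I 0).
Proof.
move=> IN I0 IS; elim: N m IN => [|N IH] m Im; have := I0 _ _ Im.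
  by move=> /eqP a0; exists m => //; apply: runs_loop_stop.
move=> /negbT a0; have [m1 run_c /IH[m2 run_loop Im2]] := IS _ _ Im.
by exists m2 => //; rewrite mulSn -addnA; apply: runs_loop_step run_c run_loop.
Qed.

(** * A language with bounded loops *)

Inductive binop := Add | Sub.

Inductive expr :=
| EConst of nat
| EPar of nat
| EVar of nat
| EGet (k : nat) of expr
| EOp of binop & expr & expr.

(* [CFor x p c] runs [c] for each value of [x] below the read-only parameter [p],
   so that the running time does not depend on the store. *)
Inductive cmd :=
| CSkip
| CSet (x : nat) of expr
| CPut (k : nat) of expr & expr
| CSeq of cmd & cmd
| CIf of expr & cmd & cmd
| CFor (x p : nat) of cmd.

Declare Scope lang_scope.
Delimit Scope lang_scope with lang.
Bind Scope lang_scope with expr.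
Bind Scope lang_scope with cmd.
Notation "e + f" := (EOp Add e f) : lang_scope.
Notation "e - f" := (EOp Sub e f) : lang_scope.
Notation "c ;; d" := (CSeq c d) (at level 90, right associativity) : lang_scope.

Record store := Store { vars : nat -> nat; arrays : nat -> nat -> nat }.

Definition set_var (x v : nat) st := Store (upd (vars st) x v) (arrays st).
Definition set_array (k j v : nat) st :=
  Store (vars st) (fun k' : nat => if k' == k then upd (arrays st k) j v else arrays st k').

Definition op_fun o : nat -> nat -> nat := match o with Add => addn | Sub => subn end.

Section Semantics.
Variable par : nat -> nat.

Fixpoint eval st e := match e with
  | EConst k => k
  | EPar p => par p
  | EVar x => vars st x
  | EGet k e => arrays st k (eval st e)
  | EOp o e f => op_fun o (eval st e) (eval st f)
  end.

Fixpoint interp c st := match c with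
  | CSkip => st
  | CSet x e => set_var x (eval st e) st
  | CPut k e f => set_array k (eval st e) (eval st f) st
  | CSeq c d => interp d (interp c st)
  | CIf e c d => if eval st e == 0 then interp d st else interp c st
  | CFor x p c =>
      set_var x (par p) (iteri (par p) (fun i s => interp c (set_var x i s)) st)
  end.

Fixpoint assigns (x : nat) c := match c with
  | CSet y _ => x == y
  | CSeq c d | CIf _ c d => assigns x c || assigns x d
  | CFor y _ c => (x == y) || assigns x c
  | CSkip | CPut _ _ _ => false
  end.

Fixpoint writes (k : nat) c := match c with
  | CPut k' _ _ => k == k'
  | CSeq c d | CIf _ c d => writes k c || writes k d
  | CFor _ _ c => writes k c
  | CSkip | CSet _ _ => false
  end.

(* [st'] may differ from [st] only where [c] can change the store. *)
Definition framed c st st' :=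
  (forall x, ~~ assigns x c -> vars st' x = vars st x) /\
  (forall k, ~~ writes k c -> arrays st' k = arrays st k).

Lemma interp_framed c st : framed c st (interp c st).
Proof.
elim: c st => [|x e|k e f|c IHc d IHd|e c IHc d IHd|x p c IH] st; split=> //=.
- by move=> y /negbTE; rewrite /upd => ->.
- by move=> l /negbTE ->.
- by move=> x /norP[xc xd]; rewrite (IHd _).1 // (IHc _).1.
- by move=> k /norP[kc kd]; rewrite (IHd _).2 // (IHc _).2.
- by move=> x /norP[xc xd]; case: ifP => _; [apply: (IHd _).1 | apply: (IHc _).1].
- by move=> k /norP[kc kd]; case: ifP => _; [apply: (IHd _).2 | apply: (IHc _).2].
- move=> y /norP[/negbTE yx yc]; rewrite /upd yx.
  by elim: (par p) => //= i IHi; rewrite (IH _).1 //= /upd yx.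
- by move=> k kc; elim: (par p) => //= i IHi; rewrite (IH _).2.
Qed.

Lemma interp_seq c d st : interp (CSeq c d) st = interp d (interp c st).
Proof. by []. Qed.

Lemma interp_if e c d st :
  interp (CIf e c d) st = if eval st e == 0 then interp d st else interp c st.
Proof. by []. Qed.

Lemma interp_var c st x : ~~ assigns x c -> vars (interp c st) x = vars st x.
Proof. exact: (interp_framed c st).1. Qed.

Lemma interp_array c st k : ~~ writes k c -> arrays (interp c st) k = arrays st k.
Proof. exact: (interp_framed c st).2. Qed.

Lemma interp_for (Q : nat -> store -> Prop) x p c st :
  (forall i v s, Q i s -> Q i (set_var x v s)) -> Q 0 st ->
  (forall i s, i < par p -> framed (CFor x p c) st s -> vars s x = i -> Q i s ->
     Q i.+1 (interp c s)) ->
  Q (par p) (interp (CFor x p c) st).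
Proof.
move=> Qx Q0 QS; apply: (Qx).
pose body i s := interp c (set_var x i s).
suff /(_ _ (leqnn _))[] : forall i, i <= par p ->
  Q i (iteri i body st) /\ framed (CFor x p c) st (iteri i body st) by [].
elim=> [|i IH] lt_i; first by split.
have [Qi [frame_v frame_a]] := IH (ltnW lt_i).
have framed_i : framed (CFor x p c) st (set_var x i (iteri i body st)).
  by split=> // y /[dup] /norP[/negbTE yx _] /frame_v <-; rewrite /= /upd yx.
split=> /=; first by apply: QS => //; [exact: upd_at | exact: Qx].
split=> [y|k] /= Hc; last by rewrite interp_array // framed_i.2.
by rewrite interp_var; [exact: framed_i.1 | case/norP: Hc].
Qed.

Lemma interp_scatter (P : pred nat) (h g : nat -> nat) (x p k : nat) c st :
  {in [pred i | i < par p & P i] &, injective h} ->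
  (forall i s, i < par p ->
     (forall l, l != k -> arrays s l = arrays st l) ->
     (forall y, y != x -> vars s y = vars st y) -> vars s x = i ->
     (P i -> arrays s k (h i) = arrays st k (h i)) ->
     interp c s = if P i then set_array k (h i) (g i) s else s) ->
  let st' := interp (CFor x p c) st in
  [/\ forall i, i < par p -> P i -> arrays st' k (h i) = g i,
      forall j, (forall i, i < par p -> P i -> j != h i) -> arrays st' k j = arrays st k j,
      forall l, l != k -> arrays st' l = arrays st l
    & forall y, y != x -> vars st' y = vars st y].
Proof.
move=> h_inj body.
have h_neq i j : j < i -> i < par p -> P i -> P j -> h i != h j.
  move=> lt_ji lt_i Pi Pj; apply: contraTneq (lt_ji) => /h_inj ->; rewrite ?ltnn //.
    by rewrite inE lt_i.
  by rewrite inE Pj andbT; lia.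
apply: (interp_for (Q := fun i0 s =>
  [/\ forall i, i < i0 -> P i -> arrays s k (h i) = g i,
      forall j, (forall i, i < i0 -> P i -> j != h i) -> arrays s k j = arrays st k j,
      forall l, l != k -> arrays s l = arrays st l
    & forall y, y != x -> vars s y = vars st y])).
- move=> i v s [done todo arr var]; split=> // y yx.
  by rewrite -var //= /upd (negbTE yx).
- by split.
move=> i s lt_i _ si [done todo arr var]; rewrite (body i) //; last first.
  by move=> Pi; apply: todo => j lt_j Pj; apply: h_neq.
case: ifPn => [Pi | nPi]; split=> //=.
- move=> j; rewrite eqxx ltnS leq_eqVlt => /predU1P[->|lt_j] Pj; first by rewrite upd_at.
  by rewrite /upd ifN ?done // eq_sym h_neq.
- move=> j not_done; rewrite eqxx /upd ifN ?todo //; last exact: not_done.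
  by move=> a lt_a; apply: not_done; apply: ltnW.
- by move=> l lk; rewrite (negbTE lk) arr.
- move=> j; rewrite ltnS leq_eqVlt => /predU1P[->|lt_j] Pj; last exact: done.
  by rewrite Pj in nPi.
- by move=> j not_done; apply: todo => a lt_a; apply: not_done; apply: ltnW.
Qed.

Lemma interp_put_loop (h g : nat -> nat) (x p k : nat) a e st :
  (forall i j, i < par p -> j < par p -> h i = h j -> i = j) ->
  (forall i s, i < par p ->
     (forall l, l != k -> arrays s l = arrays st l) ->
     (forall y, y != x -> vars s y = vars st y) -> vars s x = i ->
     arrays s k (h i) = arrays st k (h i) -> eval s a = h i /\ eval s e = g i) ->
  let st' := interp (CFor x p (CPut k a e)) st in
  (forall i, i < par p -> arrays st' k (h i) = g i) /\
  (forall j, (forall i, i < par p -> j != h i) -> arrays st' k j = arrays st k j).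
Proof.
move=> h_inj evalE st'.
have [||done todo _ _] := interp_scatter (P := predT) (h := h) (g := g) (x := x) (p := p)
    (k := k) (c := CPut k a e) (st := st).
- by move=> i j; rewrite !inE !andbT; apply: h_inj.
- by move=> i s lt_i arr var xi same; have [<- <-] := evalE i s lt_i arr var xi (same isT).
- by split=> [i lt_i|j out_j]; [apply: done | apply: todo => i lt_i _; apply: out_j].
Qed.

Lemma interp_mark (P : pred nat) (h : nat -> nat) (x p k : nat) c st v :
  (forall i s, i < par p -> framed (CFor x p c) st s -> vars s x = i ->
     interp c s = if P i then set_array k (h i) 1 s else s) ->
  arrays (interp (CFor x p c) st) k v = 0 <->
  arrays st k v = 0 /\ forall i, i < par p -> P i -> h i <> v.
Proof.
move=> body.
apply: (interp_for (Q := fun i0 s => arrays s k v = 0 <->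
  arrays st k v = 0 /\ forall i, i < i0 -> P i -> h i <> v)) => // [|i s lt_i fr si IH].
  by split=> [//|[]].
rewrite (body i) //; case: ifPn => [Pi | nPi]; rewrite /= ?eqxx /upd.
  case: (v =P h i) => [->|ne_v]; first by split=> // -[_ /(_ i (ltnSn i) Pi)].
  rewrite IH; split=> -[unmarked others]; split=> // j lt_j; last exact/others/ltnW.
  by move: lt_j; rewrite ltnS leq_eqVlt => /predU1P[-> _ /esym|]; [| apply: others].
rewrite IH; split=> -[unmarked others]; split=> // j lt_j; last exact/others/ltnW.
move: lt_j; rewrite ltnS leq_eqVlt => /predU1P[->|]; last exact: others.
by rewrite (negbTE nPi).
Qed.

End Semantics.

(** * Compilation *)

(* Cell 0 holds the base address [S], cells 1-4 the parameters, cell 7 is cleared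
   by unconditional jumps, cells [8 + x] hold the variables and the cells from
   [temp_base] up to [low_size] temporaries. *)
Local Notation jump_cell := 7 (only parsing).
Local Notation nb_vars := 32 (only parsing).
Local Notation nb_arrays := 16 (only parsing).
Local Notation temp_base := 40 (only parsing).
Local Notation low_size := 64 (only parsing).

(* The arrays are interleaved from [S] on, so none of them needs a bound. Array 0
   is the memory image of the input and of the output: it is kept in place below
   [S], apart from the cells below [low_size]. *)
Definition address S k j :=
  if (k == 0) && (low_size <= j < S) then j else S + nb_arrays * j + k.

Lemma address_ge S k j : low_size <= S -> low_size <= address S k j.
Proof. by rewrite /address; case: ifP; lia. Qed.

Lemma address_inj S k l i j : k < nb_arrays -> l < nb_arrays ->
  address S k i = address S l j -> k = l /\ i = j.
Proof.
by rewrite /address => lt_k lt_l; case: ifPn => ?; case: ifPn => ? ?; split; lia.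
Qed.

Definition simulates S (par : nat -> nat) st (m : nat -> nat) :=
  [/\ m 0 = S, forall p, p < 4 -> m p.+1 = par p,
      forall x, x < nb_vars -> m (8 + x) = vars st x
    & forall k j, k < nb_arrays -> m (address S k j) = arrays st k j].

(* Temporaries of level [t] live in the cells [t <= a < low_size]. *)
Definition agree t (m m' : nat -> nat) :=
  forall a, (a < t) && (a != jump_cell) || (low_size <= a) -> m' a = m a.

Lemma simulates_agree S par st m m' :
  low_size <= S -> agree temp_base m m' -> simulates S par st m -> simulates S par st m'.
Proof.
move=> le_S agr [m0 m_par m_var m_arr]; split; first by rewrite agr.
- by move=> p lt_p; rewrite agr ?m_par //; lia.
- by move=> x lt_x; rewrite agr ?m_var //; lia.
- by move=> k j lt_k; rewrite agr ?m_arr // address_ge ?orbT.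
Qed.

Lemma simulates_set_var S par st m x v : low_size <= S -> x < nb_vars ->
  simulates S par st m -> simulates S par (set_var x v st) (upd m (8 + x) v).
Proof.
move=> le_S lt_x [m0 m_par m_var m_arr]; split=> [|p lt_p|y lt_y|k j lt_k] /=.
- by [].
- by rewrite /upd ifN ?m_par //; lia.
- by rewrite /upd eqn_add2l; case: eqP => // _; apply: m_var.
- by rewrite /upd ifN ?m_arr //; have := address_ge k j le_S; lia.
Qed.

Lemma simulates_set_array S par st m k j v : low_size <= S -> k < nb_arrays ->
  simulates S par st m -> simulates S par (set_array k j v st) (upd m (address S k j) v).
Proof.
move=> le_S lt_k [m0 m_par m_var m_arr]; have := address_ge k j le_S.
split=> [|p lt_p|y lt_y|l i lt_l] /=; rewrite /upd.
- by rewrite ifN //; lia.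
- by rewrite ifN ?m_par //; lia.
- by rewrite ifN ?m_var //; lia.
- case: eqP => [/(address_inj lt_l lt_k)[-> ->]|ne_addr]; first by rewrite !eqxx.
  rewrite m_arr //; case: (l =P k) => // lk; case: eqP => [ij|_]; last by rewrite lk.
  by rewrite lk ij in ne_addr.
Qed.

Definition scale_code k t : program :=
  [:: IADD t t t; IADD t t t; IADD t t t; IADD t t t;
      ICONST t.+1 k; IADD t t t.+1; IADD t t 0].

Definition address_code k t := if k is 0 then
    Then (Straight [:: ICONST t.+1 low_size; ISUB t.+1 t.+1 t])
      (Branch t.+1 jump_cell (Straight (scale_code 0 t))
        (Then (Straight [:: ISUB t.+1 0 t])
          (Branch t.+1 jump_cell (Straight [::]) (Straight (scale_code 0 t)))))
  else Straight (scale_code k t).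

Definition op_instr o d a b := match o with Add => IADD d a b | Sub => ISUB d a b end.

Fixpoint compile_expr t e := match e with
  | EConst k => Straight [:: ICONST t k]
  | EPar p => Straight [:: ICONST t 0; IADD t t p.+1]
  | EVar x => Straight [:: ICONST t 0; IADD t t (8 + x)]
  | EGet k e => Then (compile_expr t e) (Then (address_code k t) (Straight [:: ILOAD t t]))
  | EOp o e f =>
      Then (compile_expr t e)
        (Then (compile_expr t.+1 f) (Straight [:: op_instr o t t t.+1]))
  end.

Definition countdown x p : program :=
  [:: ICONST temp_base 0; IADD temp_base temp_base p.+1;
      ISUB temp_base temp_base (8 + x)].

Fixpoint compile c := match c with
  | CSkip => Straight [::]
  | CSet x e => Then (compile_expr temp_base e)
      (Straight [:: ICONST (8 + x) 0; IADD (8 + x) (8 + x) temp_base])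
  | CPut k e f => Then (compile_expr temp_base e)
      (Then (address_code k temp_base)
        (Then (compile_expr temp_base.+1 f) (Straight [:: ISTORE temp_base temp_base.+1])))
  | CSeq c d => Then (compile c) (compile d)
  | CIf e c d =>
      Then (compile_expr temp_base e) (Branch temp_base jump_cell (compile c) (compile d))
  | CFor x p c => Then (Straight (ICONST (8 + x) 0 :: countdown x p))
      (Loop temp_base jump_cell (Then (compile c)
        (Straight ([:: ICONST temp_base 1; IADD (8 + x) (8 + x) temp_base] ++ countdown x p))))
  end.

Fixpoint expr_cost e := match e with
  | EConst _ => 1
  | EPar _ | EVar _ => 2
  | EGet _ e => expr_cost e + 17
  | EOp _ e f => expr_cost e + expr_cost f + 1
  end.

Fixpoint cost (par : nat -> nat) c := match c with
  | CSkip => 0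
  | CSet _ e => expr_cost e + 2
  | CPut _ e f => expr_cost e + expr_cost f + 17
  | CSeq c d => cost par c + cost par d
  | CIf e c d => expr_cost e + cost par c + cost par d + 3
  | CFor _ p c => par p * (cost par c + 8) + 5
  end.

Fixpoint depth e := match e with
  | EConst _ | EPar _ | EVar _ => 1
  | EGet _ e => (depth e).+1
  | EOp _ e f => maxn (depth e) (depth f).+1
  end.

Fixpoint wf_expr e := match e with
  | EConst _ => true
  | EPar p => p < 4
  | EVar x => x < nb_vars
  | EGet k e => (k < nb_arrays) && wf_expr e
  | EOp _ e f => wf_expr e && wf_expr f
  end.

Definition compilable e := wf_expr e && (depth e <= 20).

Fixpoint wf_cmd c := match c with
  | CSkip => true
  | CSet x e => (x < nb_vars) && compilable e
  | CPut k e f => [&& k < nb_arrays, compilable e & compilable f]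
  | CSeq c d => wf_cmd c && wf_cmd d
  | CIf e c d => [&& compilable e, wf_cmd c & wf_cmd d]
  | CFor x p c => [&& x < nb_vars, p < 4, ~~ assigns x c & wf_cmd c]
  end.

Lemma exec_scale_code k t S m a : m 0 = S -> 0 < t ->
  exec (scale_code k t) m a =
  if a == t then S + nb_arrays * m t + k else if a == t.+1 then k else m a.
Proof.
move=> <- t_gt0; rewrite /exec /= /upd !eqxx (ltn_eqF t_gt0) /=.
by rewrite (ltn_eqF (ltnSn t)); case: eqP => // _; lia.
Qed.

Definition addressed k t S m m' :=
  m' t = address S k (m t) /\ forall a, a \notin [:: t; t.+1; jump_cell] -> m' a = m a.

Lemma computes_scale k t S m m1 : S = m 0 -> jump_cell < t ->
  ~~ ((k == 0) && (low_size <= m t < S)) -> m1 t = m t ->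
  (forall a, a \notin [:: t; t.+1; jump_cell] -> m1 a = m a) ->
  computes (Straight (scale_code k t)) 7 m1 (addressed k t S m).
Proof.
move=> S_m lt_t far m1t m1_m; apply: computes_straight => //.
have m10 : m1 0 = S by rewrite m1_m // !inE; lia.
have t0 : 0 < t by lia.
split=> [|a out_a]; rewrite (exec_scale_code _ _ m10 t0).
  by rewrite eqxx m1t /address (negbTE far).
by move: (out_a); rewrite !inE !negb_or => /and3P[/negbTE -> /negbTE -> _]; exact: m1_m.
Qed.

Lemma computes_address k t S m : S = m 0 -> jump_cell < t -> low_size <= S ->
  computes (address_code k t) 16 m (addressed k t S m).
Proof.
move=> S_m lt_t le_S; case: k => [|k]; last first.
  by apply: computes_weaken (computes_scale (m1 := m) S_m lt_t _ _ _) _ _.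
have jump_agree m' : addressed 0 t S m m' -> addressed 0 t S m (upd m' jump_cell 0).
  move=> [m't m'_m]; rewrite /upd; split=> [|a /[dup] /m'_m]; first by rewrite ifN //; lia.
  by rewrite !inE !negb_or => -> /and3P[_ _ /negbTE ->].
have t_t1 : (t == t.+1) = false by lia.
pose m1 := exec [:: ICONST t.+1 low_size; ISUB t.+1 t.+1 t] m.
have m1E a : m1 a = if a == t.+1 then low_size - m t else m a.
  by rewrite /m1 /exec /= /upd eqxx t_t1; case: (a == t.+1).
pose m2 := exec [:: ISUB t.+1 0 t] m1.
have m2E a : m2 a = if a == t.+1 then S - m t else m a.
  by rewrite /m2 /exec /= /upd !m1E t_t1 S_m; case: (a == t.+1).
have unchanged v m' a : (forall a, m' a = if a == t.+1 then v else m a) ->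
    a \notin [:: t; t.+1; jump_cell] -> m' a = m a.
  by move=> ->; rewrite !inE !negb_or => /and3P[_ /negbTE ->].
apply: (@computes_le _ (2 + (1 + (7 + 3) + 3))) => //.
apply: (computes_straight_then (p := [:: _; _])) => //; rewrite -/m1.
apply: computes_branch; rewrite m1E eqxx => low.
  apply: computes_weaken (computes_scale (m1 := m1) S_m lt_t _ _ _) _ jump_agree => //.
  - by lia.
  - by rewrite m1E t_t1.
  - by move=> a; apply: unchanged m1E.
apply: (computes_straight_then (p := [:: _])) => //; rewrite -/m2.
apply: computes_branch; rewrite m2E eqxx => high.
  apply: computes_weaken (computes_straight (p := [::]) (m := m2) _ _) _ jump_agree => //.
  split=> [|a]; last exact: unchanged m2E.
  by rewrite /exec /= m2E t_t1 /address ifT //; lia.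
apply: computes_weaken (computes_scale (m1 := m2) S_m lt_t _ _ _) _ _ => //.
- by lia.
- by rewrite m2E t_t1.
- by move=> a; apply: unchanged m2E.
Qed.

Lemma computes_expr S par st e t m : low_size <= S -> simulates S par st m ->
  wf_expr e -> temp_base <= t -> t + depth e < low_size ->
  computes (compile_expr t e) (expr_cost e) m
    (fun m' => m' t = eval par st e /\ agree t m m').
Proof.
move=> le_S; elim: e t m => [k|p|x|k e IH|o e IHe f IHf] t m sim /= wf le_t lt_t.
- apply: (computes_straight (p := [:: _])) => //.
  by split=> [|a ?]; rewrite /exec /= /upd ?eqxx // ifN //; lia.
- apply: (computes_straight (p := [:: _; _])) => //; case: sim => _ m_par _ _.
  split=> [|a ?]; rewrite /exec /= /upd ?eqxx; last by rewrite !ifN //; lia.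
  by rewrite ifN ?m_par //; lia.
- apply: (computes_straight (p := [:: _; _])) => //; case: sim => _ _ m_var _.
  split=> [|a ?]; rewrite /exec /= /upd ?eqxx; last by rewrite !ifN //; lia.
  by rewrite ifN ?m_var //; lia.
- case/andP: wf => lt_k wf; apply: (@computes_le _ (_ + (16 + 1))) => //.
  apply: computes_then (IH _ _ sim wf le_t _) _ => [|m1 [m1t agr1]]; first lia.
  have {}sim : simulates S par st m1 by apply: simulates_agree sim => // a ?; apply: agr1; lia.
  have [m10 _ _ m1_arr] := sim.
  apply: computes_then (computes_address k (esym m10) _ le_S) _ => [|m2 [m2t m2_m1]]; first lia.
  apply: (computes_straight (p := [:: _])) => //; rewrite /exec /= /upd.
  split=> [|a ?]; last by rewrite ifN ?m2_m1 ?agr1 ?inE //; lia.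
  rewrite eqxx m2t m2_m1 ?m1_arr ?m1t //.
  by have := address_ge k (eval par st e) le_S; rewrite !inE; lia.
- case/andP: wf => wfe wff; rewrite -addnA.
  apply: computes_then (IHe _ _ sim wfe le_t _) _ => [|m1 [m1t agr1]]; first lia.
  have {}sim : simulates S par st m1 by apply: simulates_agree sim => // a ?; apply: agr1; lia.
  apply: computes_then (IHf _ _ sim wff _ _) _ => [||m2 [m2t agr2]]; [lia|lia|].
  apply: (computes_straight (p := [:: _])) => //; first by case: (o).
  have -> : exec [:: op_instr o t t t.+1] m2 = upd m2 t (op_fun o (m2 t) (m2 t.+1)) by case: (o).
  rewrite m2t agr2 ?m1t /upd; last lia; split=> [|a ?]; first by rewrite eqxx.
  by rewrite ifN ?agr2 ?agr1 //; lia.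
Qed.

Lemma computes_compilable S par st e t m : low_size <= S -> simulates S par st m ->
  compilable e -> temp_base <= t <= temp_base.+1 ->
  computes (compile_expr t e) (expr_cost e) m
    (fun m' => [/\ m' t = eval par st e, agree t m m' & simulates S par st m']).
Proof.
move=> le_S sim /andP[wf le_depth] le_t.
have [||m' run_e [m't agr]] := computes_expr (t := t) le_S sim wf; [lia..|].
exists m' => //; split=> //; apply: simulates_agree sim => // a ?; apply: agr; lia.
Qed.

Section Correctness.
Variables (S : nat) (par : nat -> nat).
Hypothesis le_S : low_size <= S.
Local Notation simulates := (simulates S par).

Lemma computes_set st x e m : simulates st m -> wf_cmd (CSet x e) ->
  computes (compile (CSet x e)) (cost par (CSet x e)) m (simulates (interp par (CSet x e) st)).
Proof.
move=> sim /andP[lt_x okay_e].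
apply: computes_then (computes_compilable le_S sim okay_e _) _ => // m1 [m1t _ sim1].
apply: (computes_straight (p := [:: _; _])) => //; rewrite /= -m1t.
have : simulates (set_var x (m1 temp_base) st) (upd m1 (8 + x) (m1 temp_base)).
  exact: simulates_set_var.
apply: simulates_agree => // a _; rewrite /exec /= /upd; case: eqP => // _.
by rewrite eqxx ifN //; lia.
Qed.

Lemma computes_put st k e f m : simulates st m -> wf_cmd (CPut k e f) ->
  computes (compile (CPut k e f)) (cost par (CPut k e f)) m
    (simulates (interp par (CPut k e f) st)).
Proof.
move=> sim /and3P[lt_k okay_e okay_f].
apply: (@computes_le _ (expr_cost e + (16 + (expr_cost f + 1)))); first by rewrite /=; lia.
apply: computes_then (computes_compilable le_S sim okay_e _) _ => // m1 [m1t _ sim1].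
have [m10 _ _ _] := sim1.
apply: computes_then (computes_address k (esym m10) _ le_S) _ => // m2 [m2t m2_m1].
have sim2 : simulates st m2.
  by apply: simulates_agree sim1 => // a ?; rewrite m2_m1 // !inE; lia.
apply: computes_then (computes_compilable le_S sim2 okay_f _) _ => // m3 [m3t agr3 sim3].
apply: (computes_straight (p := [:: _])) => //.
have := simulates_set_array (eval par st e) (eval par st f) le_S lt_k sim3.
by rewrite /exec /= agr3 // m2t m1t m3t.
Qed.

Lemma computes_for st x p c m :
  (forall st m, simulates st m -> wf_cmd c ->
     computes (compile c) (cost par c) m (simulates (interp par c st))) ->
  simulates st m -> wf_cmd (CFor x p c) ->
  computes (compile (CFor x p c)) (cost par (CFor x p c)) m
    (simulates (interp par (CFor x p c) st)).
Proof.
move=> comp_c sim /and4P[lt_x lt_p unassigned wf_c].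
pose iterate i := iteri i (fun i s => interp par c (set_var x i s)) st.
pose invariant left m' := exists2 i, i + left = par p &
  simulates (set_var x i (iterate i)) m' /\ m' temp_base = left.
have counted i m1 : i <= par p -> simulates (set_var x i (iterate i)) m1 ->
    invariant (par p - i) (exec (countdown x p) m1).
  move=> le_i sim1; have [_ m1_par m1_var _] := sim1.
  exists i; first exact: subnKC.
  split; last first.
    have [par_temp x_temp] : p.+1 != temp_base /\ 8 + x != temp_base by lia.
    by rewrite /exec /= /upd /= !ifN // m1_par // m1_var //= upd_at.
  by apply: simulates_agree sim1 => // a ?; rewrite /exec /= /upd !ifN //; lia.
have entry : invariant (par p) (exec (countdown x p) (exec [:: ICONST (8 + x) 0] m)).
  by rewrite -[par p]subn0; apply: counted => //; apply: simulates_set_var.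
have iteration left m1 : invariant left.+1 m1 ->
    computes (Then (compile c) (Straight (ICONST temp_base 1 ::
        IADD (8 + x) (8 + x) temp_base :: countdown x p))) (cost par c + 5) m1
      (fun m2 => invariant left (upd m2 jump_cell 0)).
  move=> [i i_left [sim1 _]]; apply: computes_then (comp_c _ _ sim1 wf_c) _ => m2 sim2.
  have [_ _ m2_var _] := sim2.
  apply: (computes_straight (p := [:: _, _ & _])) => //.
  have -> : left = par p - i.+1 by lia.
  have m2x : m2 (8 + x) = i by rewrite m2_var // interp_var //= upd_at.
  have sim3 : simulates (set_var x i.+1 (iterate i.+1))
      (exec [:: ICONST temp_base 1; IADD (8 + x) (8 + x) temp_base] m2).
    apply: simulates_agree (simulates_set_var i.+1 le_S lt_x sim2) => // a ?.
    by rewrite /exec /= /upd; case: eqP => [_|]; rewrite !ifN ?m2x ?addn1 //; lia.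
  have [|j j_left [sim4 cell4]] := counted i.+1 _ _ sim3; first lia.
  exists j => //; split; last by rewrite /upd.
  by apply: simulates_agree sim4 => // a ?; rewrite /upd ifN //; lia.
apply: (@computes_le _ (4 + (par p * (cost par c + 5 + 3) + 1))); first by rewrite /=; lia.
apply: (computes_straight_then (p := [:: _; _; _; _])) => //.
apply: computes_weaken (computes_loop entry _ iteration) (leqnn _) _.
  by move=> left m1 [_ _ [_ ->]].
by move=> m1 [i]; rewrite addn0 => -> [].
Qed.

Lemma compile_correct st c m : simulates st m -> wf_cmd c ->
  computes (compile c) (cost par c) m (simulates (interp par c st)).
Proof.
elim: c st m => [|x e|k e f|c IHc d IHd|e c IHc d IHd|x p c IH] st m sim wf.
- exact: (computes_straight (p := [::])).
- exact: computes_set.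
- exact: computes_put.
- case/andP: wf => wf_c wf_d.
  by apply: computes_then (IHc _ _ sim wf_c) _ => m1 sim1; apply: IHd.
- case/and3P: wf => okay_e wf_c wf_d; rewrite /= -!addnA.
  apply: computes_then (computes_compilable le_S sim okay_e _) _ => // m1 [m1t _ sim1].
  rewrite addnA; apply: computes_branch; rewrite m1t.
    move=> /negbTE ->; apply: computes_weaken (IHc _ _ sim1 wf_c) (leq_addr _ _) _ => m2.
    by apply: simulates_agree => // a ?; rewrite /upd ifN //; lia.
  by move=> ->; apply: computes_le (leq_addl _ _) (IHd _ _ sim1 wf_d).
- exact: computes_for.
Qed.

End Correctness.

(** * Running time *)

Fixpoint degree c := match c with
  | CSeq c d | CIf _ c d => maxn (degree c) (degree d)
  | CFor _ _ c => (degree c).+1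
  | CSkip | CSet _ _ | CPut _ _ _ => 0
  end.

Fixpoint coef c := match c with
  | CSkip => 0
  | CSet _ e => expr_cost e + 2
  | CPut _ e f => expr_cost e + expr_cost f + 17
  | CSeq c d => coef c + coef d
  | CIf e c d => expr_cost e + coef c + coef d + 3
  | CFor _ _ c => coef c + 13
  end.

Fixpoint loops_over (b : nat) c := match c with
  | CSeq c d | CIf _ c d => loops_over b c && loops_over b d
  | CFor _ p c => (p < b) && loops_over b c
  | CSkip | CSet _ _ | CPut _ _ _ => true
  end.

Lemma cost_le par b N c : 0 < N -> (forall p, p < b -> par p <= N) -> loops_over b c ->
  cost par c <= coef c * N ^ degree c.
Proof.
move=> N_gt0 le_par; have pow_gt0 d : 0 < N ^ d by rewrite expn_gt0 N_gt0.
have le_pow k d e : d <= e -> k * N ^ d <= k * N ^ e.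
  by move=> le_de; rewrite leq_mul2l leq_pexp2l ?orbT.
elim: c => [|x e|k e f|c IHc d IHd|e c IHc d IHd|x p c IH] //=; rewrite ?muln1 //.
- move=> /andP[/IHc le_c /IHd le_d]; rewrite mulnDl; apply: leq_add.
    exact: leq_trans le_c (le_pow _ _ _ (leq_maxl _ _)).
  exact: leq_trans le_d (le_pow _ _ _ (leq_maxr _ _)).
- move=> /andP[/IHc le_c /IHd le_d].
  have := leq_trans le_c (le_pow _ _ _ (leq_maxl _ (degree d))).
  have := leq_trans le_d (le_pow _ _ _ (leq_maxr (degree c) _)).
  by have := pow_gt0 (maxn (degree c) (degree d)); nia.
- move=> /andP[/le_par le_p /IH le_c]; rewrite expnS.
  apply: (@leq_trans (N * (coef c * N ^ degree c + 8) + 5)).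
    by rewrite leq_add2r leq_mul // leq_add2r.
  by have := pow_gt0 (degree c); nia.
Qed.

(** * Start-up and shut-down code *)

Definition base_address ml := 1024 * 8 ^ ml.

Lemma base_address_ge ml : low_size <= base_address ml.
Proof. by rewrite (@leq_trans (1024 * 1)) // leq_mul2l expn_gt0. Qed.

Definition grow bit := Then (Straight [:: ICONST 2 1024])
  (Then (Loop 0 3 (Straight [:: IADD 2 2 2; IADD 2 2 2; IADD 2 2 2; ICONST 3 1; ISUB 0 0 3]))
    (Straight [:: ICONST 3 bit])).

Definition save_cell i : program := [:: ICONST 0 (nb_arrays * i); IADD 0 0 2; ISTORE 0 i].

Definition fetch_cell i : program :=
  [:: ICONST i (nb_arrays * i); IADD i i 0; ILOAD i i].

Definition measure := Then
  (Straight [:: ICONST 0 0; IADD 0 0 2; ICONST 4 0; IADD 4 4 3; ICONST 2 0; IADD 2 2 1;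
      ICONST 1 0; ICONST 3 0; ICONST 5 1024; ICONST 6 1; ISUB 8 0 5])
  (Loop 8 jump_cell
    (Straight [:: IADD 5 5 5; IADD 5 5 5; IADD 5 5 5; IADD 1 1 6; IADD 3 3 2; ISUB 8 0 5])).

(* Every cell with a constant address may hold input. The cells 2 and 3 are erased
   to compute the base address; which of the two was smaller is remembered by
   running one of two copies of [grow]. The number of rows, which [grow] destroys,
   is recovered from the base address. *)
Definition boot := Then (Straight [:: ISUB 2 2 3]) (Then (Branch 2 0 (grow 2) (grow 1))
  (Then (Straight (flatten [seq save_cell i | i <- iota 4 60])) measure)).

(* The cell 0, which is the pointer to the other ones, is fetched last. *)
Definition shutdown :=
  Straight (flatten [seq fetch_cell i | i <- iota 1 63] ++ [:: ILOAD 0 0]).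

Lemma computes_grow bit m : computes (grow bit) (m 0 * 8 + 3) m (fun m' =>
  forall a, m' a = if a == 0 then 0 else if a == 2 then base_address (m 0)
                   else if a == 3 then bit else m a).
Proof.
rewrite /grow /base_address; move: 1024 => unit.
pose invariant left m' := exists2 i, i + left = m 0 &
  [/\ m' 0 = left, m' 2 = unit * 8 ^ i & forall a, a \notin [:: 0; 2; 3] -> m' a = m a].
apply: (@computes_le _ (1 + (m 0 * (5 + 3) + 1 + 1))); first lia.
apply: (computes_straight_then (p := [:: _])) => //.
apply: (computes_then (Q := invariant 0)).
  apply: (computes_loop (I := invariant)) => [|i m1 [_ _ [-> _ _]]|i m1] //.
    exists 0 => //; split=> // [|a]; rewrite /exec /= /upd ?muln1 //.
    by rewrite !inE !negb_or => /and3P[_ /negbTE ->].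
  move=> [j j_i [m10 m12 m1a]]; apply: (computes_straight (p := [:: _; _; _; _; _])) => //.
  exists j.+1; first lia; split=> [||a out_a]; rewrite /exec /= /upd /=.
  - by rewrite m10 subn1.
  - by rewrite m12 expnS; lia.
  - rewrite -m1a //; move: out_a; rewrite !inE !negb_or.
    by move=> /and3P[/negbTE -> /negbTE -> /negbTE ->].
move=> m1 [i]; rewrite addn0 => -> [m10 m12 m1a].
apply: (computes_straight (p := [:: _])) => // a; rewrite /exec /= /upd.
case: (a =P 3) => [->|/eqP a3] //; case: (a =P 0) => [->|/eqP a0] //.
case: (a =P 2) => [->|/eqP a2] //.
by rewrite m1a // !inE !negb_or a0 a2.
Qed.

Lemma exec_save_cells l m (m' := exec (flatten [seq save_cell i | i <- l]) m) :
  low_size <= m 2 -> all (fun i => 0 < i < low_size) l ->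
  (forall i, i \in l -> m' (m 2 + nb_arrays * i) = m i) /\
  (forall a, a != 0 -> (forall i, i \in l -> a != m 2 + nb_arrays * i) -> m' a = m a).
Proof.
rewrite {}/m'; elim: l m => [|i l IH] m le_m2 // /andP[lt_i lt_l].
rewrite -[flatten _]/(save_cell i ++ flatten [seq save_cell i | i <- l]) exec_cat.
set m1 := exec (save_cell i) m.
have m1E a : a != 0 -> m1 a = if a == m 2 + nb_arrays * i then m i else m a.
  have i0 : (i == 0) = false by lia.
  by move=> /negbTE a0; rewrite /m1 /exec /= /upd /= a0 i0 [_ + m 2]addnC.
have m12 : m1 2 = m 2 by rewrite m1E // ifN //; lia.
have [|saved kept] := IH m1 _ lt_l; first by rewrite m12.
rewrite m12 in saved kept; split=> [j|a a0 not_saved].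
  case: (boolP (j \in l)) => [jl _|jl].
    by rewrite saved // m1E ?ifN //; have := allP lt_l j jl; lia.
  rewrite inE (negbTE jl) orbF => /eqP ji; rewrite {j}ji in jl *.
  rewrite kept ?m1E ?eqxx //; first lia.
    by lia.
  by move=> j' j'l; apply: contraNneq jl => ?; have <- : j' = i by lia.
by rewrite kept // => [|j jl]; rewrite ?m1E ?ifN // not_saved // inE ?eqxx ?jl ?orbT.
Qed.

Lemma exec_fetch_cells l m a : low_size <= m 0 -> all (fun i => 0 < i < low_size) l ->
  exec (flatten [seq fetch_cell i | i <- l]) m a =
  if a \in l then m (m 0 + nb_arrays * a) else m a.
Proof.
elim: l m => [|i l IH] m le_m0 // /andP[lt_i lt_l].
rewrite -[flatten _]/(fetch_cell i ++ flatten [seq fetch_cell i | i <- l]) exec_cat.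
set m1 := exec (fetch_cell i) m.
have m1E b : m1 b = if b == i then m (m 0 + nb_arrays * i) else m b.
  have i0 : (0 == i) = false by lia.
  rewrite /m1 /exec /= /upd /= !eqxx i0; case: eqP => // _.
  by rewrite [_ + m 0]addnC !ifN //; lia.
have m10 : m1 0 = m 0 by rewrite m1E ifN //; lia.
rewrite IH ?m10 // !m1E inE; case: (a =P i) => [->|_] /=.
  by case: ifP => // _; rewrite ifN //; lia.
by case: ifP => // al; rewrite ifN //; have := allP lt_l a al; lia.
Qed.

Lemma computes_measure ml m (S := base_address ml) : m 2 = S ->
  computes measure (ml * 9 + 12) m (fun m' =>
    [/\ m' 0 = S, [/\ m' 1 = ml, m' 2 = m 1, m' 3 = ml * m 1 & m' 4 = m 3]
      & forall a, 8 < a -> m' a = m a]).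
Proof.
rewrite {}/S /measure /base_address; move: 1024 (isT : 0 < 1024) => unit unit_gt0 m2.
pose invariant left m' := exists2 i, i + left = ml &
  [/\ m' 8 = unit * 8 ^ ml - unit * 8 ^ i, m' 5 = unit * 8 ^ i, m' 6 = 1
    & [/\ m' 0 = m 2, [/\ m' 1 = i, m' 2 = m 1, m' 3 = i * m 1 & m' 4 = m 3]
      & forall a, 8 < a -> m' a = m a]].
apply: (@computes_le _ (11 + (ml * (6 + 3) + 1))); first lia.
apply: (computes_straight_then (p := [:: _, _, _, _, _, _ & _])) => //.
apply: (@computes_weaken _ (ml * (6 + 3) + 1) _ _ (invariant 0)) => //; last first.
  by move=> m1 [i]; rewrite addn0 => -> [_ _ _ []]; rewrite m2.
apply: (computes_loop (I := invariant)) => [|left m1 [i i_left [-> _ _ _]]|left m1].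
- exists 0 => //; split; rewrite /exec /= /upd ?m2 ?muln1 //=.
  by split=> // a lt_a; rewrite !ifN //; lia.
- rewrite subn_eq0 leq_pmul2l // leq_exp2l //; lia.
move=> [i i_left [m18 m15 m16 [m10 [m11 m12 m13 m14] m1a]]].
apply: (computes_straight (p := [:: _; _; _; _; _; _])) => //.
exists i.+1; first lia; rewrite /exec /= /upd /= m10 m11 m12 m13 m14 m15 m16 m2 expnS.
split=> //; try lia; split=> //; first by split=> //; [rewrite addn1 | rewrite mulSnr].
by move=> a lt_a; rewrite -(m1a _ lt_a) !ifN //; lia.
Qed.

Lemma computes_boot ml ms m (S := base_address ml) : m 0 = ml -> m 1 = ms ->
  computes boot (ml * 17 + 209) m (fun m' =>
    [/\ m' 0 = S, [/\ m' 1 = ml, m' 2 = ms, m' 3 = ml * ms & m' 4 = (m 3 < m 2).+1],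
        forall i, 4 <= i < low_size -> m' (S + nb_arrays * i) = m i
      & forall a, low_size <= a -> (forall i, 4 <= i < low_size -> a != S + nb_arrays * i) ->
          m' a = m a]).
Proof.
move=> m0 m1; have le_S : low_size <= S by apply: base_address_ge.
apply: (@computes_le _ (1 + (ml * 8 + 3 + 3 + (180 + (ml * 9 + 12))))); first lia.
apply: (computes_straight_then (p := [:: _])) => //.
apply: (computes_then (Q := fun m' => forall a, m' a = if a == 0 then 0 else
    if a == 2 then S else if a == 3 then (m 3 < m 2).+1 else m a)).
  have forget bit m' : (m 3 < m 2).+1 = bit ->
      (forall a, m' a = if a == 0 then 0 else if a == 2 then S else if a == 3 then bit
                        else exec [:: ISUB 2 2 3] m a) ->
      forall a, m' a = if a == 0 then 0 else if a == 2 then S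
                       else if a == 3 then (m 3 < m 2).+1 else m a.
    by move=> -> m'E a; rewrite m'E /exec /= /upd; case: (a =P 2).
  rewrite /S -m0 in forget *; apply: computes_branch => order; rewrite /exec /= /upd /= in order.
    apply: computes_weaken (computes_grow 2 _) _ _ => // m' m'E.
    apply: (forget 2) => [|a]; first by lia.
    by rewrite /upd m'E; case: eqP.
  apply: computes_weaken (computes_grow 1 _) _ _ => // m'.
  by apply: forget; lia.
move=> m2 m2E.
have m22 : m2 2 = S by rewrite m2E.
have [|saved kept] := @exec_save_cells (iota 4 60) m2 _ isT; first by rewrite m22.
rewrite m22 in saved kept.
have small a : 0 < a < low_size -> exec (flatten [seq save_cell i | i <- iota 4 60]) m2 a = m2 a.
  by move=> a_small; apply: kept => [|i _]; lia.
apply: computes_straight_then => //.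
move: (exec _ m2) saved kept small => m3 saved kept small.
have [|m' run_m [m'0 [m'1 m'2 m'3 m'4] m'a]] := @computes_measure ml m3.
  by rewrite small ?m2E.
rewrite !small // !m2E /= m1 in m'2 m'3 m'4.
exists m' => //; split=> // [i i_low|a le_a unsaved].
  rewrite m'a; last lia.
  rewrite saved; last by rewrite mem_iota; lia.
  by rewrite m2E !ifN //; lia.
rewrite m'a; last lia.
rewrite kept; [by rewrite m2E !ifN //; lia | by lia |].
by move=> i; rewrite mem_iota => i_low; apply: unsaved; lia.
Qed.

Lemma computes_shutdown m : low_size <= m 0 -> computes shutdown 190 m (fun m' =>
  forall a, m' a = if a < low_size then m (m 0 + nb_arrays * a) else m a).
Proof.
move=> le_m0; apply: computes_straight => // a; rewrite exec_cat.
set m1 := exec _ m; have m1E b : m1 b = if 0 < b < low_size then m (m 0 + nb_arrays * b) else m b.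
  by rewrite /m1 exec_fetch_cells // mem_iota.
rewrite /exec /= /upd; case: (a =P 0) => [->|a0]; last by rewrite m1E lt0n; case: eqP.
by rewrite !m1E /= ifN ?muln0 ?addn0 //; lia.
Qed.

Definition assemble c : program := asm 0 (Then boot (Then (compile c) shutdown)).

Definition params ml ms order p := nth 0 [:: ml; ms; ml * ms; order] p.

Lemma assemble_correct c ml ms m (S := base_address ml) (par := params ml ms (m 3 < m 2).+1) :
  wf_cmd c -> m 0 = ml -> m 1 = ms -> (forall a, S <= a -> m a = 0) ->
  exists2 st,
    (forall i, 4 <= i -> arrays st 0 i = m i) /\
    (forall k i, 0 < k < nb_arrays -> arrays st k i = 0)
  & exists2 m', reaches (assemble c) (ml * 17 + 209 + (cost par c + 190))
                  (0, m) (size (assemble c), m')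
              & forall a, a < S -> m' a = arrays (interp par c st) 0 a.
Proof.
move=> wf_c m0 m1 m_far; have le_S : low_size <= S by apply: base_address_ge.
suff: computes (Then boot (Then (compile c) shutdown)) (ml * 17 + 209 + (cost par c + 190)) m
    (fun m' => exists2 st,
      (forall i, 4 <= i -> arrays st 0 i = m i) /\
      (forall k i, 0 < k < nb_arrays -> arrays st k i = 0)
    & forall a, a < S -> m' a = arrays (interp par c st) 0 a).
  by case/computes_reaches => m' reach [st init final]; exists st => //; exists m'.
apply: computes_then (computes_boot m0 m1) _ => m2 [m20 [m21 m22 m23 m24] saved kept].
pose st := Store (fun x => m2 (8 + x)) (fun k i => m2 (address S k i)).
have sim : simulates S par st m2 by split=> // -[|[|[|[|p]]]].
apply: computes_then (compile_correct le_S sim wf_c) _ => m3 [m30 _ _ m3_arr].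
apply: computes_weaken (computes_shutdown _) (leqnn _) _ => [|m4 m4E]; first by rewrite m30.
exists st; first split=> [i le_i|k i lt_k] /=; rewrite /address.
- case: ifPn => [i_mid|i_far]; first by rewrite kept; lia.
  rewrite addn0; case: (ltnP i low_size) i_far => [lt_i _|le_i' i_far];
    first by rewrite saved ?le_i.
  by rewrite kept => [||j j_low]; rewrite ?m_far; lia.
- rewrite ifN; last lia.
  by rewrite kept => [||j j_low]; rewrite ?m_far; lia.
- by move=> a lt_a; rewrite m4E -m3_arr // m30 /address /= lt_a andbT ltnNge addn0; case: leqP.
Qed.

(** * Sorting a line with adjacent comparators *)

Definition permutes n (f : nat -> nat) :=
  (forall x y, x < n -> y < n -> f x = f y -> x = y) /\ forall x, x < n -> f x < n.

Lemma permutes_bij n f :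
  permutes n f -> exists g : 'I_n -> 'I_n, bijective g /\ forall i, g i = f i :> nat.
Proof.
move=> [f_inj f_lt]; have fE (i : 'I_n) : insubd i (f i) = f i :> nat.
  by rewrite val_insubd f_lt.
exists (fun i : 'I_n => insubd i (f i)); split=> //; apply: injF_bij => i j /(congr1 val) /=.
by rewrite !fE => /f_inj eq_ij; apply: ord_inj; apply: eq_ij.
Qed.

Lemma permutes_surj n f y : permutes n f -> y < n -> exists2 x, x < n & f x = y.
Proof.
move=> /permutes_bij[g [[h _ hK] gE]] lt_y.
by exists (h (Ordinal lt_y)); rewrite // -gE hK.
Qed.

Lemma permutes_inv n f : permutes n f -> exists g, forall x, x < n -> g (f x) = x.
Proof.
move=> [f_inj f_lt]; exists (fun y => index y [seq f x | x <- iota 0 n]) => x lt_x.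
have f_uniq : uniq [seq f x | x <- iota 0 n].
  rewrite map_inj_in_uniq ?iota_uniq // => y z; rewrite !mem_iota; exact: f_inj.
have fE : f x = nth 0 [seq f x | x <- iota 0 n] x by rewrite (nth_map 0) ?size_iota // nth_iota.
by rewrite fE index_uniq // size_map size_iota.
Qed.

Lemma permutes_comp n f g : permutes n f -> permutes n g -> permutes n (g \o f).
Proof.
move=> [f_inj f_lt] [g_inj g_lt]; split=> [x y lt_x lt_y /= /g_inj eq_f|x lt_x].
  by apply: f_inj => //; apply: eq_f; apply: f_lt.
by apply/g_lt/f_lt.
Qed.

Lemma eq_permutes n f g : (forall x, x < n -> f x = g x) -> permutes n f -> permutes n g.
Proof.
move=> eq_fg [f_inj f_lt]; split=> [x y lt_x lt_y|x lt_x]; rewrite -!eq_fg //.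
  exact: f_inj.
exact: f_lt.
Qed.

Definition count_ge th (k : nat -> nat) x := \sum_(i < x) (th <= k i).

Lemma count_ge0 th k : count_ge th k 0 = 0.
Proof. exact: big_ord0. Qed.

Lemma count_geS th k x : count_ge th k x.+1 = count_ge th k x + (th <= k x).
Proof. exact: big_ord_recr. Qed.

Lemma count_ge_le th k x : count_ge th k x <= x.
Proof. by elim: x => [|x IH]; rewrite ?count_ge0 // count_geS; case: (th <= _); lia. Qed.

Lemma count_ge_lipschitz th k x y :
  x <= y -> count_ge th k x <= count_ge th k y <= count_ge th k x + (y - x).
Proof.
move=> /subnKC <-; elim: (y - x) => [|d IH]; first by rewrite addn0; lia.
by rewrite addnS count_geS; case: (th <= _) => /=; lia.
Qed.

Lemma count_ge_permutes L k th : permutes L k -> count_ge th k L = L - th.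
Proof.
move=> /permutes_bij[g [/(onW_bij predT) g_bij gE]].
transitivity (count_ge th id L).
  by rewrite /count_ge [RHS](reindex g) //; apply: eq_bigr => i _; rewrite gE.
elim: L {g g_bij gE} => [|L IH]; first by rewrite count_ge0.
by rewrite count_geS IH; case: leqP; lia.
Qed.

(* The comparators at the positions [i] of [act] send the smaller of the keys at
   [i] and [i.+1] to [i]. *)
Definition comparators L (act : nat -> bool) (k k' : nat -> nat) :=
  [/\ forall i, act i -> i.+1 < L, forall i, act i -> ~~ act i.+1
    & forall i, i < L -> k' i = if act i then minn (k i) (k i.+1)
        else if (0 < i) && act i.-1 then maxn (k i.-1) (k i) else k i].

Lemma count_ge_comparators L act k k' th x : comparators L act k k' -> x <= L ->
  count_ge th k' x = if (0 < x) && act x.-1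
    then count_ge th k x.-1 + (th <= minn (k x.-1) (k x)) else count_ge th k x.
Proof.
case=> _ act_sparse k'E; elim: x => [|x IH] lt_x; first by rewrite !count_ge0.
rewrite count_geS IH; last exact: ltnW.
rewrite k'E //= count_geS.
case act_x: (act x).
  by case: ifP => // /andP[x_gt0 /act_sparse]; rewrite prednK // act_x.
case: ifP => // /andP[x_gt0 _].
have -> : count_ge th k x = count_ge th k x.-1 + (th <= k x.-1).
  by rewrite -count_geS prednK.
by case: (leqP th (k x.-1)); case: (leqP th (k x)); case: leqP; case: leqP; lia.
Qed.

(* [N] counts the keys [>= th] among the first [x] cells after [t] rounds on a
   line of length [L]. A comparator replaces [N x] by
   [max (N x.-1) (N x.+1 - 1)], hence the bound improves with each round,
   whatever the order of the comparators in it. *)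
Definition count_bound L t th x N := [|| N == 0, N + th <= x | 2 * N + t + th <= x + L].

(* [t] rounds are complete, and in the next one the comparators in [done] have acted. *)
Definition sorting L t (done : nat -> Prop) k :=
  forall th, count_ge th k L = L - th /\ forall x, x <= L ->
    count_bound L t th x (count_ge th k x) /\
    (0 < x -> done x.-1 -> count_bound L t.+1 th x (count_ge th k x)).

Lemma sub_sorting L t (done done' : nat -> Prop) k :
  (forall i, done' i -> done i) -> sorting L t done k -> sorting L t done' k.
Proof.
move=> sub sorting_k th; have [total bounds] := sorting_k th; split=> // x le_x.
by have [bound_x bound_done] := bounds _ le_x; split=> // x_gt0 /sub; apply: bound_done.
Qed.

Lemma sorting_start L k : permutes L k -> sorting L 0 (fun _ => False) k.
Proof.
move=> perm_k th; have total := count_ge_permutes th perm_k; split=> // x le_x; split=> //.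
have := count_ge_lipschitz th k le_x; have := count_ge_le th k x.
by rewrite total /count_bound; move: (count_ge th k x) => N; lia.
Qed.

Lemma sorting_step L t done act k k' : comparators L act k k' -> sorting L t done k ->
  sorting L t (fun i => done i \/ act i) k'.
Proof.
move=> step sorting_k th; have [total bounds] := sorting_k th; have [act_lt _ _] := step.
split; first by rewrite (count_ge_comparators th step) //; case: ifP => // /andP[? /act_lt]; lia.
move=> x le_x; rewrite (count_ge_comparators th step) //;
  have [bound_x bound_done] := bounds _ le_x.
case act_x: ((0 < x) && act x.-1); last first.
  by split=> // x_gt0 [|act_pred]; [apply: bound_done | rewrite x_gt0 act_pred in act_x].
case/andP: act_x => x_gt0 /act_lt lt_x; rewrite prednK // in lt_x.
have [] := bounds x.-1; first lia; have [] := bounds x.+1 => // bound_succ _ bound_pred _.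
set N := _ + _.
have succE : count_ge th k x.+1 = count_ge th k x.-1 + (th <= k x.-1) + (th <= k x).
  by rewrite count_geS -{1}(prednK x_gt0) count_geS.
suff better : count_bound L t.+1 th x N.
  by split=> //; move: better; rewrite /count_bound; lia.
rewrite /N; move: succE bound_succ bound_pred; rewrite /count_bound.
move: (count_ge th k x.+1) (count_ge th k x.-1) => N_succ N_pred.
by case: (leqP th (k x.-1)); case: (leqP th (k x)); case: leqP => /=; lia.
Qed.

Lemma sorting_round L t done k :
  (forall i, i.+1 < L -> done i) -> sorting L t done k -> sorting L t.+1 (fun _ => False) k.
Proof.
move=> all_done sorting_k th; have [total bounds] := sorting_k th; split=> // x le_x; split=> //.
have [_ bound_done] := bounds _ le_x.
case: (posnP x) => [->|x_gt0]; first by rewrite count_ge0.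
case: (ltngtP x L) le_x => // [lt_x _|-> _]; first by apply: bound_done => //; apply: all_done; lia.
by rewrite total /count_bound; lia.
Qed.

Lemma sorting_done L t done k : L <= t -> sorting L t done k -> forall i, i < L -> k i = i.
Proof.
move=> le_Lt sorting_k; have k_le i : i < L -> k i <= i.
  move=> lt_i; rewrite leqNgt; apply/negP => lt_k.
  have [_ /(_ i.+1 lt_i) []] := sorting_k (k i).
  by rewrite count_geS leqnn /count_bound; lia.
move=> i lt_i; apply/eqP; rewrite eqn_leq k_le //=.
have [total _] := sorting_k i.
have none_before : count_ge i k i = 0.
  by apply: big1 => j _; have := k_le j; have := ltn_ord j; case: leqP => //; lia.
have := @count_ge_lipschitz i k i.+1 L lt_i; rewrite count_geS none_before total.
by case: leqP => //; lia.
Qed.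

(** * Rotations of 3 x 2 blocks *)

(* Adjacency of vertices coded as [row * w + column]. *)
Definition adjacent w u v :=
  (u %/ w == v %/ w) && (((u %% w).+1 == v %% w) || ((v %% w).+1 == u %% w))
  || (u %% w == v %% w) && (((u %/ w).+1 == v %/ w) || ((v %/ w).+1 == u %/ w)).

(* The cells of a block are coded as [2 * row + column]. A table lists their images. *)
Definition table_comp (s t : seq nat) := [seq nth 0 t c | c <- s].

Definition transposition p q := [seq if c == p then q else if c == q then p else c | c <- iota 0 6].

Definition legal_table (t : seq nat) :=
  [&& perm_eq t (iota 0 6),
      all (fun c => (nth 0 t c == c) || adjacent 2 c (nth 0 t c)) (iota 0 6)
    & all (fun c => (nth 0 t (nth 0 t c) == c) ==> (nth 0 t c == c)) (iota 0 6)].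

Lemma nth_transposition p q c : c < 6 ->
  nth 0 (transposition p q) c = if c == p then q else if c == q then p else c.
Proof. by move=> lt_c; rewrite (nth_map 0) ?size_iota // nth_iota. Qed.

Lemma size_perm_iota t : perm_eq t (iota 0 6) -> size t = 6.
Proof. by move/perm_size. Qed.

Lemma nth_perm_iota_lt t c : perm_eq t (iota 0 6) -> c < 6 -> nth 0 t c < 6.
Proof.
move=> perm_t lt_c; have: nth 0 t c \in iota 0 6.
  by rewrite -(perm_mem perm_t) mem_nth // (size_perm_iota perm_t).
by rewrite mem_iota.
Qed.

Lemma perm_table_comp t u :
  perm_eq t (iota 0 6) -> perm_eq u (iota 0 6) -> perm_eq (table_comp t u) (iota 0 6).
Proof.
move=> perm_t perm_u; have size_u := size_perm_iota perm_u.
apply: perm_trans perm_u; apply: perm_trans (perm_map _ perm_t) _.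
by rewrite map_nth_iota0 ?size_u // -size_u take_size.
Qed.

Section Grid.
Variables ml ms : nat.
Hypotheses (ml_ge3 : 3 <= ml) (ms_ge2 : 2 <= ms).
Local Notation n := (ml * ms).

Lemma divn_vertex i j : j < ms -> (i * ms + j) %/ ms = i.
Proof. by move=> lt_j; rewrite divnMDl ?divn_small ?addn0 //; lia. Qed.

Lemma modn_vertex i j : j < ms -> (i * ms + j) %% ms = j.
Proof. by move=> lt_j; rewrite modnMDl modn_small. Qed.

Lemma vertex_lt i j : i < ml -> j < ms -> i * ms + j < n.
Proof. by nia. Qed.

Lemma row_lt v : v < n -> v %/ ms < ml.
Proof. by move=> lt_v; rewrite ltn_divLR //; lia. Qed.

Lemma column_lt v : v %% ms < ms.
Proof. by rewrite ltn_mod; lia. Qed.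

Lemma vertex_eq u v : u %/ ms = v %/ ms -> u %% ms = v %% ms -> u = v.
Proof. by move=> eq_row eq_col; rewrite (divn_eq u ms) eq_row eq_col -divn_eq. Qed.

Definition legal f :=
  [/\ permutes n f, forall v, v < n -> (f v == v) || adjacent ms v (f v)
    & forall v, v < n -> f (f v) = v -> f v = v].

Definition offset c := c %/ 2 * ms + c %% 2.

(* The blocks of the class [(r, s)] have their first cell in a row [= r mod 3] and a
   column [= s mod 2], so they are disjoint. *)
Definition anchor r s A :=
  [&& (A %/ ms) %% 3 == r, (A %% ms) %% 2 == s, A %/ ms + 2 < ml & A %% ms + 1 < ms].

Lemma cellE r s A c : anchor r s A -> c < 6 ->
  [/\ A + offset c < n, (A + offset c) %/ ms = A %/ ms + c %/ 2
    & (A + offset c) %% ms = A %% ms + c %% 2].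
Proof.
case/and4P=> _ _ row_A col_A lt_c; have lt_col : A %% ms + c %% 2 < ms by lia.
have -> : A + offset c = (A %/ ms + c %/ 2) * ms + (A %% ms + c %% 2).
  by rewrite /offset {1}(divn_eq A ms); lia.
by rewrite divn_vertex // modn_vertex // vertex_lt //; lia.
Qed.

Lemma cell_inj r s A B c d : anchor r s A -> anchor r s B -> c < 6 -> d < 6 ->
  A + offset c = B + offset d -> A = B /\ c = d.
Proof.
move=> anc_A anc_B lt_c lt_d eq_cell.
have [_ row_A col_A] := cellE anc_A lt_c; have [_ row_B col_B] := cellE anc_B lt_d.
rewrite eq_cell in row_A col_A; case/and4P: anc_A => rA sA _ _; case/and4P: anc_B => rB sB _ _.
by split; [apply: vertex_eq|]; lia.
Qed.

Section Rotation.
Variables (r s : nat) (F : pred nat).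
Hypothesis F_anchor : forall A, F A -> anchor r s A.

Definition off_blocks v := forall A c, F A -> c < 6 -> v != A + offset c.

Definition rotates t f :=
  (forall A c, F A -> c < 6 -> f (A + offset c) = A + offset (nth 0 t c)) /\
  (forall v, v < n -> off_blocks v -> f v = v).

Lemma cellP v : (exists A c, [/\ F A, c < 6 & v = A + offset c]) \/ off_blocks v.
Proof.
case: (boolP [exists A : 'I_v.+1, exists c : 'I_6, F A && (v == A + offset c)]).
  by case/existsP=> A /existsP[c /andP[FA /eqP vE]]; left; exists A, c.
move=> no_cell; right=> A c FA lt_c; apply: contraNneq no_cell => vE.
have lt_A : A < v.+1 by lia.
apply/existsP; exists (Ordinal lt_A); apply/existsP; exists (Ordinal lt_c).
by rewrite FA; apply/eqP.
Qed.

Lemma rotates_id : rotates (iota 0 6) id.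
Proof. by split=> // A c _ lt_c; rewrite nth_iota. Qed.

Lemma rotates_comp t u f g : perm_eq t (iota 0 6) ->
  rotates t f -> rotates u g -> rotates (table_comp t u) (g \o f).
Proof.
move=> perm_t [f_cell f_off] [g_cell g_off]; split=> [A c FA lt_c|v lt_v off_v] /=.
  rewrite f_cell // g_cell ?nth_perm_iota_lt // /table_comp (nth_map 0) //.
  by rewrite (size_perm_iota perm_t).
by rewrite f_off ?g_off.
Qed.

Lemma rotates_permutes t f : perm_eq t (iota 0 6) -> rotates t f -> permutes n f.
Proof.
move=> perm_t [f_cell f_off]; have t_lt c := nth_perm_iota_lt (c := c) perm_t.
split=> [u v lt_u lt_v|v lt_v]; last first.
  case: (cellP v) => [[A [c [FA lt_c ->]]]|off_v]; last by rewrite f_off.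
  by rewrite f_cell //; have [] := cellE (F_anchor FA) (t_lt c lt_c).
case: (cellP u) => [[A [c [FA lt_c uE]]]|off_u]; case: (cellP v) => [[B [d [FB lt_d vE]]]|off_v].
- rewrite uE vE !f_cell // => /(cell_inj (F_anchor FA) (F_anchor FB) (t_lt c lt_c) (t_lt d lt_d)).
  case=> -> /eqP; rewrite nth_uniq ?(size_perm_iota perm_t) // ?(perm_uniq perm_t) ?iota_uniq //.
  by move/eqP->.
- rewrite uE f_cell // [f v]f_off // => cell_v.
  by case/eqP: (off_v _ _ FA (t_lt c lt_c)).
- rewrite vE f_cell // f_off // => cell_u.
  by case/eqP: (off_u _ _ FB (t_lt d lt_d)).
- by rewrite !f_off.
Qed.

Lemma rotates_legal t f : legal_table t -> rotates t f -> legal f.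
Proof.
case/and3P=> perm_t /allP adj_t /allP no_swap rot; have [f_cell f_off] := rot.
have t_lt c := nth_perm_iota_lt (c := c) perm_t.
split=> [|v lt_v|v lt_v]; first exact: rotates_permutes rot.
  case: (cellP v) => [[A [c [FA lt_c ->]]]|/f_off ->]; rewrite ?eqxx // f_cell //.
  have := adj_t c; rewrite mem_iota => /(_ lt_c)/orP[/eqP->|adj_c]; first by rewrite eqxx.
  apply/orP; right; rewrite /adjacent; have [_ -> ->] := cellE (F_anchor FA) lt_c.
  have [_ -> ->] := cellE (F_anchor FA) (t_lt c lt_c).
  by move: adj_c; rewrite /adjacent; lia.
case: (cellP v) => [[A [c [FA lt_c ->]]]|/f_off ->] //; rewrite !f_cell ?t_lt //.
case/(cell_inj (F_anchor FA) (F_anchor FA)); rewrite ?t_lt // => _ fixed.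
by have := no_swap c; rewrite mem_iota fixed eqxx => /(_ lt_c)/eqP->.
Qed.

End Rotation.

(** * Lines of comparators *)

(* Columns are the lines of direction [true], rows those of direction [false]. *)
Definition point (d : bool) l i := if d then i * ms + l else l * ms + i.
Definition line (d : bool) v := if d then v %% ms else v %/ ms.
Definition position (d : bool) v := if d then v %/ ms else v %% ms.
Definition line_length (d : bool) := if d then ml else ms.
Definition line_count (d : bool) := if d then ms else ml.

Lemma point_lt d l i : l < line_count d -> i < line_length d -> point d l i < n.
Proof. by case: d => lt_l lt_i; apply: vertex_lt. Qed.

Lemma point_line d v : point d (line d v) (position d v) = v.
Proof. by case: d; rewrite /= -divn_eq. Qed.

Lemma line_point d l i : l < line_count d -> i < line_length d -> line d (point d l i) = l.
Proof. by case: d => lt_l lt_i; rewrite /= ?divn_vertex ?modn_vertex. Qed.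

Lemma position_point d l i :
  l < line_count d -> i < line_length d -> position d (point d l i) = i.
Proof. by case: d => lt_l lt_i; rewrite /= ?divn_vertex ?modn_vertex. Qed.

Lemma point_inj d l i k j : l < line_count d -> i < line_length d ->
  k < line_count d -> j < line_length d -> point d l i = point d k j -> l = k /\ i = j.
Proof.
move=> lt_l lt_i lt_k lt_j eq_pt.
by rewrite -(line_point lt_l lt_i) -{2}(position_point lt_l lt_i) eq_pt line_point ?position_point.
Qed.

Lemma line_lt d v : v < n -> line d v < line_count d.
Proof. by case: d => lt_v; [apply: column_lt | apply: row_lt]. Qed.

Lemma position_lt d v : v < n -> position d v < line_length d.
Proof. by case: d => lt_v; [apply: row_lt | apply: column_lt]. Qed.

(* The cell [q] of a block follows the cell [p] on a line of direction [d]. *)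
Definition consecutive (d : bool) p q :=
  [&& q < 6, q == p + (if d then 2 else 1) & d || ~~ odd p].

Definition is_cell r s p v := (offset p <= v) && anchor r s (v - offset p).

Lemma is_cellP r s p v : reflect (exists2 A, anchor r s A & v = A + offset p) (is_cell r s p v).
Proof.
apply: (iffP andP) => [[le_v anc]|[A anc ->]]; last by rewrite leq_addl addnK.
by exists (v - offset p); rewrite ?subnK.
Qed.

Lemma consecutive_point d p q r s A : consecutive d p q -> anchor r s A ->
  exists l i, [/\ l < line_count d, i.+1 < line_length d,
                 A + offset p = point d l i & A + offset q = point d l i.+1].
Proof.
case/and3P=> lt_q /eqP qE dir anc_A; have lt_p : p < 6 by lia.
have [lt_v row_p col_p] := cellE anc_A lt_p.
exists (line d (A + offset p)), (position d (A + offset p)).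
rewrite point_line line_lt //; case/and4P: anc_A => _ _ row_A col_A.
case: d qE dir => /= qE dir; split=> //; rewrite ?row_p ?col_p /offset ?qE.
- by lia.
- have [-> ->] : (p + 2) %/ 2 = p %/ 2 + 1 /\ (p + 2) %% 2 = p %% 2 by lia.
  by rewrite {1}(divn_eq A ms); lia.
- by lia.
- have [-> -> ->] : [/\ (p + 1) %/ 2 = p %/ 2, (p + 1) %% 2 = 1 & p %% 2 = 0] by split; lia.
  by rewrite {1}(divn_eq A ms); lia.
Qed.

Section Exchange.
Variables (d : bool) (r s p q : nat) (keys : nat -> nat).
Hypothesis consec : consecutive d p q.

Definition inverted A := anchor r s A && (keys (A + offset q) < keys (A + offset p)).

Variable f : nat -> nat.
Hypothesis swap_f : rotates inverted (transposition p q) f.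

Let inverted_anchor A : inverted A -> anchor r s A. Proof. by case/andP. Qed.
Let p_lt6 : p < 6. Proof. by case/and3P: consec => ? /eqP; lia. Qed.
Let q_lt6 : q < 6. Proof. by case/and3P: consec. Qed.
Let p_neq_q : p != q. Proof. by case/and3P: consec => _ /eqP; case: (d); lia. Qed.

Lemma exchange_fixed v : v < n -> ~~ is_cell r s p v -> ~~ is_cell r s q v -> f v = v.
Proof.
move=> lt_v not_p not_q; case: (cellP inverted v) => [[A [c [inv_A lt_c vE]]]|off_v].
  rewrite vE swap_f.1 // nth_transposition //.
  have cell_c : is_cell r s c v by apply/is_cellP; exists A; rewrite ?inverted_anchor.
  case: eqP => [cp|_]; first by rewrite -cp cell_c in not_p.
  by case: eqP => [cq|_] //; rewrite -cq cell_c in not_q.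
exact: swap_f.2.
Qed.

Lemma exchange_uninverted A c : anchor r s A -> ~~ inverted A -> c < 6 ->
  f (A + offset c) = A + offset c.
Proof.
move=> anc_A not_inv lt_c; have [lt_v _ _] := cellE anc_A lt_c.
apply: swap_f.2 => // B e inv_B lt_e; apply: contraNneq not_inv.
by case/(cell_inj anc_A (inverted_anchor inv_B) lt_c lt_e) => ->.
Qed.

Lemma exchange_min A : anchor r s A ->
  keys (f (A + offset p)) = minn (keys (A + offset p)) (keys (A + offset q)).
Proof.
move=> anc_A; case: (boolP (inverted A)) => inv_A.
  rewrite swap_f.1 // nth_transposition // eqxx.
  by case/andP: inv_A => _ lt_keys; lia.
by rewrite exchange_uninverted //; move: inv_A; rewrite /inverted anc_A; lia.
Qed.

Lemma exchange_max A : anchor r s A ->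
  keys (f (A + offset q)) = maxn (keys (A + offset p)) (keys (A + offset q)).
Proof.
move=> anc_A; case: (boolP (inverted A)) => inv_A.
  rewrite swap_f.1 // nth_transposition // eq_sym (negbTE p_neq_q) eqxx.
  by case/andP: inv_A => _ lt_keys; lia.
by rewrite exchange_uninverted //; move: inv_A; rewrite /inverted anc_A; lia.
Qed.

Lemma exchangeK v : v < n -> f (f v) = v.
Proof.
move=> lt_v; case: (cellP inverted v) => [[A [c [inv_A lt_c ->]]]|off_v]; last by rewrite !swap_f.2.
have f_cell e := swap_f.1 A e inv_A.
rewrite f_cell // nth_transposition //; case: (c =P p) => [->|cp].
  by rewrite f_cell // nth_transposition // eq_sym (negbTE p_neq_q) eqxx.
case: (c =P q) => [->|cq]; rewrite f_cell // nth_transposition // ?eqxx //.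
by rewrite (introF eqP cp) (introF eqP cq).
Qed.

Lemma exchange_line v : v < n -> line d (f v) = line d v.
Proof.
move=> lt_v; case: (cellP inverted v) => [[A [c [inv_A lt_c ->]]]|off_v]; last by rewrite swap_f.2.
have [l [i [lt_l lt_i pE qE]]] := consecutive_point consec (inverted_anchor inv_A).
rewrite swap_f.1 // nth_transposition //.
case: eqP => [->|_]; first by rewrite pE qE !line_point // ltnW.
by case: eqP => [->|//]; rewrite pE qE !line_point // ltnW.
Qed.

Definition compares l i := (i.+1 < line_length d) && is_cell r s p (point d l i).

Lemma comparesP l i : l < line_count d -> compares l i ->
  exists2 A, anchor r s A & A + offset p = point d l i /\ A + offset q = point d l i.+1.
Proof.
move=> lt_l /andP[lt_i /is_cellP[A anc_A pointE]]; exists A => //.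
have [k [j [lt_k lt_j pE ->]]] := consecutive_point consec anc_A; rewrite pE in pointE *.
by have [-> ->] := point_inj lt_l (ltnW lt_i) lt_k (ltnW lt_j) pointE.
Qed.

Lemma exchange_comparators l : l < line_count d ->
  comparators (line_length d) (compares l) (fun i => keys (point d l i))
    (fun i => keys (f (point d l i))).
Proof.
move=> lt_l; split=> [i /andP[]|i cmp_i|i lt_i] //.
  apply/negP => cmp_succ; have [A anc_A [_ qE]] := comparesP lt_l cmp_i.
  have [B anc_B [pE _]] := comparesP lt_l cmp_succ.
  have [] := cell_inj anc_A anc_B q_lt6 p_lt6; first by rewrite qE pE.
  by move=> _ /eqP; rewrite eq_sym (negbTE p_neq_q).
case: ifPn => [/(comparesP lt_l)[A anc_A [<- <-]]|no_cmp]; first exact: exchange_min.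
case: ifPn => [/andP[i_gt0 /(comparesP lt_l)[A anc_A []]]|no_cmp_pred].
  by rewrite prednK // => <- <-; apply: exchange_max.
have lt_v := point_lt lt_l lt_i; congr keys; apply: exchange_fixed => //.
  apply: contra no_cmp => /[dup] cell_i /is_cellP[A anc_A pE]; rewrite /compares cell_i andbT.
  have [k [j [lt_k lt_j]]] := consecutive_point consec anc_A; rewrite -pE => pointE.
  by have [_ ->] := point_inj lt_l lt_i lt_k (ltnW lt_j) pointE.
apply: contra no_cmp_pred => /is_cellP[A anc_A qE].
have [k [j [lt_k lt_j pE]]] := consecutive_point consec anc_A; rewrite -qE => pointE.
have [-> ->] := point_inj lt_l lt_i lt_k lt_j pointE.
by rewrite /= /compares lt_j; apply/is_cellP; exists A.
Qed.

End Exchange.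

Definition first_cells (d : bool) := if d then [:: 0; 1; 2; 3] else [:: 0; 2; 4].

Lemma compares_cover d l i : l < line_count d -> i.+1 < line_length d ->
  exists r s p, [/\ r < 3, s < 2, p \in first_cells d & compares d r s p l i].
Proof.
move=> lt_l lt_i; rewrite /compares lt_i /=.
have cover row col a b p : p = 2 * a + b -> a <= row -> b <= col -> b < 2 ->
    row - a + 2 < ml -> col - b + 1 < ms -> p \in first_cells d ->
    exists r s p, [/\ r < 3, s < 2, p \in first_cells d & is_cell r s p (row * ms + col)].
  move=> pE le_a le_b lt_b lt_row lt_col in_p.
  exists ((row - a) %% 3), ((col - b) %% 2), p; split=> //; try lia.
  apply/is_cellP; exists ((row - a) * ms + (col - b)).
    by rewrite /anchor divn_vertex ?modn_vertex ?eqxx //; lia.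
  rewrite /offset pE; have [-> ->] : (2 * a + b) %/ 2 = a /\ (2 * a + b) %% 2 = b by lia.
  by rewrite -{1}(subnK le_a); lia.
case: d cover lt_l lt_i => /= cover lt_l lt_i.
  by apply: (cover _ _ (ml <= i + 2 : nat) (ms <= l + 1 : nat)) => //; rewrite ?inE; lia.
by apply: (cover _ _ (l - (ml - 3)) 0) => //; rewrite ?inE; lia.
Qed.

End Grid.

(** * Edge colouring by Kempe exchanges *)

(* [Z e] is the end of the edge [e] on one side of a bipartite multigraph. The
   colours are positive, and the edges of colour 0 are not coloured yet. *)
Definition proper m (Z clr : nat -> nat) :=
  forall e f, e < m -> f < m -> 0 < clr e -> Z e = Z f -> clr e = clr f -> e = f.

Definition free m (Z clr : nat -> nat) z c := forall e, e < m -> Z e = z -> clr e <> c.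

Lemma eq_proper m Z clr clr' :
  (forall e, e < m -> clr e = clr' e) -> proper m Z clr -> proper m Z clr'.
Proof. by move=> eq_clr prop e f lt_e lt_f; rewrite -!eq_clr //; apply: prop. Qed.

Lemma free_colour m Z clr i k : i < m -> clr i = 0 ->
  count (fun e => Z e == Z i) (iota 0 m) <= k ->
  exists2 c, 0 < c <= k & free m Z clr (Z i) c.
Proof.
move=> lt_i clr_i degree.
pose used := [seq clr e | e <- iota 0 m & Z e == Z i].
have [c lt_c unused] : exists2 c, c \in iota 0 k.+1 & c \notin used.
  apply/allPn/negP => /allP all_used; have := uniq_leq_size (iota_uniq 0 k.+1) all_used.
  by rewrite size_iota size_map size_filter ltnNge degree.
have free_c : free m Z clr (Z i) c.
  move=> e lt_e Ze; apply: contraNnot unused => <-; apply: map_f.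
  by rewrite mem_filter Ze eqxx mem_iota.
have c_neq0 : c <> 0 by move=> c0; apply: (free_c i lt_i); rewrite ?clr_i.
by exists c => //; move: lt_c; rewrite mem_iota; lia.
Qed.

Lemma column_degree ml ms X z :
  permutes (ml * ms) X -> count (fun x => X x %% ms == z) (iota 0 (ml * ms)) <= ml.
Proof.
move=> [X_inj X_lt]; rewrite -size_filter; set column := filter _ _.
have in_column x : x \in column -> X x %% ms = z /\ x < ml * ms.
  by rewrite mem_filter mem_iota => /andP[/eqP].
rewrite -(size_map (fun x => X x %/ ms)) -[leqRHS](size_iota 0); apply: uniq_leq_size.
  rewrite map_inj_in_uniq ?filter_uniq ?iota_uniq // => x y.
  move=> /in_column[colx ltx] /in_column[coly lty].
  by move=> eq_row; apply: X_inj => //; rewrite (divn_eq (X x) ms) eq_row colx -coly -divn_eq.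
move=> _ /mapP[x /in_column[_ lt_x] ->]; rewrite mem_iota ltn_divLR ?X_lt //.
by case: (ms) lt_x => //; rewrite muln0.
Qed.

Definition swap_colours (a b c : nat) : nat := if c == a then b else if c == b then a else c.

Lemma swap_coloursK a b : involutive (swap_colours a b).
Proof.
rewrite /swap_colours => c; case: (c =P a) => [->|/eqP/negbTE ca].
  by rewrite eqxx; case: eqP.
by case: (c =P b) => [->|/eqP/negbTE cb]; rewrite ?eqxx // ca cb.
Qed.

Lemma proper_swap m Z clr a b (R : pred nat) : 0 < a -> 0 < b -> proper m Z clr ->
  proper m Z (fun e => if R (Z e) then swap_colours a b (clr e) else clr e).
Proof.
move=> a_gt0 b_gt0 prop e f lt_e lt_f + eq_Z; rewrite -eq_Z.
case: ifP => _; last by move=> col_e; apply: prop.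
move=> col_e /(inv_inj (@swap_coloursK a b)); apply: prop => //.
by move: col_e; rewrite /swap_colours; case: eqP => [-> //|_]; case: eqP => [->|].
Qed.

Lemma proper_add m Z clr i a :
  proper m Z clr -> free m Z clr (Z i) a -> proper m Z (upd clr i a).
Proof.
move=> prop free_a e f lt_e lt_f; rewrite /upd.
case: (e =P i) => [->|_]; case: (f =P i) => [->|_] //; last exact: prop.
  by move=> _ /esym Zf /esym clr_f; case: (free_a f lt_f Zf).
by move=> _ Ze clr_e; case: (free_a e lt_e Ze).
Qed.

Section Kempe.
Variables (m : nat) (U W clr : nat -> nat) (i a b : nat) (RU RW : pred nat).

(* Vertices are reached from [W i] through edges of colour [a] to the side of [U]
   and edges of colour [b] back to the side of [W]. *)
Definition reached :=
  [/\ forall y, RU y -> exists e, [/\ e < m, U e = y, clr e = a & RW (W e)],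
      forall z, RW z -> z = W i \/ exists e, [/\ e < m, W e = z, clr e = b & RU (U e)]
    & RW (W i)].

Definition closed :=
  (forall e, e < m -> clr e = a -> RW (W e) -> RU (U e)) /\
  (forall e, e < m -> clr e = b -> RU (U e) -> RW (W e)).

Hypotheses (a_gt0 : 0 < a) (b_gt0 : 0 < b).
Hypotheses (proper_U : proper m U clr) (proper_W : proper m W clr).
Hypotheses (free_a : free m U clr (U i) a) (free_b : free m W clr (W i) b).
Hypotheses (reached_R : reached) (closed_R : closed).

Definition recolour (R : pred nat) (Z : nat -> nat) e :=
  if R (Z e) then swap_colours a b (clr e) else clr e.

(* At a reached vertex both colours are exchanged, and the reached vertices are the
   same seen from both sides. *)
Lemma recolour_sides e : e < m -> recolour RU U e = recolour RW W e.
Proof.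
have [U_reached W_reached _] := reached_R; have [closed_a closed_b] := closed_R.
move=> lt_e; rewrite /recolour /swap_colours.
case: (clr e =P a) => [ea|_].
  suff -> : RU (U e) = RW (W e) by [].
  apply/idP/idP => [/U_reached[f [lt_f Uf fa RWf]]|]; last exact: closed_a.
  by rewrite (proper_U lt_e lt_f _ (esym Uf)) ?ea ?fa.
case: (clr e =P b) => [eb|_]; last by rewrite !if_same.
suff -> : RU (U e) = RW (W e) by [].
apply/idP/idP => [|/W_reached[We|[f [lt_f Wf fb RUf]]]]; first exact: closed_b.
  by case: (free_b lt_e We eb).
by rewrite (proper_W lt_e lt_f _ (esym Wf)) ?eb ?fb.
Qed.

Lemma kempe_exchange :
  proper m U (upd (recolour RU U) i a) /\ proper m W (upd (recolour RU U) i a).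
Proof.
have [U_reached _ RWi] := reached_R.
have not_RUi : ~~ RU (U i).
  by apply/negP => /U_reached[e [lt_e Ue ea _]]; case: (free_a lt_e Ue ea).
split; first apply: proper_add.
- exact: proper_swap.
- by move=> e lt_e Ue; rewrite /recolour Ue (negbTE not_RUi); apply: free_a.
apply: (eq_proper (clr := upd (recolour RW W) i a)).
  by move=> e lt_e; rewrite /upd recolour_sides.
apply: proper_add; first exact: proper_swap.
move=> e lt_e We; rewrite /recolour We RWi /swap_colours.
have not_b := free_b lt_e We; rewrite (introF eqP not_b).
by case: eqP => [ea ba|//]; rewrite ea ba in not_b.
Qed.

End Kempe.

(** * The routing program *)

Local Notation IO := 0 (only parsing).
Local Notation POS := 1 (only parsing).
Local Notation KEY := 2 (only parsing).
Local Notation KEY_AT := 3 (only parsing).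
Local Notation FLAG := 4 (only parsing).
Local Notation DEST := 5 (only parsing).
Local Notation ROW := 6 (only parsing).
Local Notation COL := 7 (only parsing).
Local Notation MOD3 := 8 (only parsing).
Local Notation MOD2 := 9 (only parsing).
Local Notation START := 10 (only parsing).
Local Notation GOAL := 11 (only parsing).
Local Notation COLOUR := 12 (only parsing).
Local Notation USED := 13 (only parsing).
Local Notation START_MARK := 14 (only parsing).
Local Notation GOAL_MARK := 15 (only parsing).

Local Notation var_x := 0 (only parsing).
Local Notation var_y := 1 (only parsing).
Local Notation var_round := 2 (only parsing).
Local Notation var_next := 3 (only parsing).
Local Notation var_steps := 4 (only parsing).
Local Notation var_a := 5 (only parsing).
Local Notation var_b := 6 (only parsing).

Local Notation par_rows := 0 (only parsing).
Local Notation par_columns := 1 (only parsing).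
Local Notation par_size := 2 (only parsing).
Local Notation par_order := 3 (only parsing).

Local Notation xE := (EVar var_x) (only parsing).
Local Notation yE := (EVar var_y) (only parsing).
Local Notation aE := (EVar var_a) (only parsing).
Local Notation bE := (EVar var_b) (only parsing).

Definition readC : cmd :=
  (CFor var_x par_size (CPut START xE (EGet IO (xE + EConst 2))) ;;
   CFor var_x par_size (CPut GOAL xE (EGet IO (xE + EConst 2 + EPar par_size))))%lang.

(* Sets [v] to the last unused number of the form [k + i] with [i] below the bound. *)
Definition find_unusedC p k v : cmd :=
  CFor var_y p (CIf (EGet USED (EConst k + yE)) CSkip (CSet v (EConst k + yE))).

Definition mark_startsC : cmd :=
  CFor var_x par_size (CIf (xE - EConst 1) (CPut USED (EGet START xE) (EConst 1)) CSkip).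

Definition find_erasedC : cmd :=
  (find_unusedC par_size 0 var_a ;; CPut USED aE (EConst 1) ;;
   find_unusedC par_size 0 var_b)%lang.

Definition restoreC : cmd :=
  (CIf (EPar par_order - EConst 1)
    (CPut START (EConst 0) aE ;; CPut START (EConst 1) bE)
    (CPut START (EConst 0) bE ;; CPut START (EConst 1) aE))%lang.

(* The start vertices of the robots 0 and 1, which the start-up code has erased, are
   the two vertices where no other robot starts. *)
Definition recoverC : cmd := (mark_startsC ;; find_erasedC ;; restoreC)%lang.

Definition recurrenceC k m d : cmd :=
  CFor var_x par_size (CPut k (xE + m) (EGet k xE + EConst d)).

Definition tablesC : cmd :=
  (CPut MOD3 (EConst 1) (EConst 1) ;; CPut MOD3 (EConst 2) (EConst 2) ;;
   CPut MOD2 (EConst 1) (EConst 1) ;;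
   recurrenceC MOD3 (EConst 3) 0 ;; recurrenceC MOD2 (EConst 2) 0 ;;
   recurrenceC ROW (EPar par_columns) 1 ;;
   CFor var_x par_columns (CPut COL xE xE) ;; recurrenceC COL (EPar par_columns) 0)%lang.

Definition dist_expr (e f : expr) : expr := ((e - f) + (f - e))%lang.

(* The column where the robot [e] starts ([A = START]) or ends ([A = GOAL]). *)
Definition column_expr A e := EGet COL (EGet A e).

Definition clearC k := CFor var_y par_size (CPut k yE (EConst 0)).

Definition free_colourC A v : cmd :=
  (clearC USED ;;
   CFor var_y par_size (CIf (dist_expr (column_expr A yE) (column_expr A xE)) CSkip
     (CPut USED (EGet COLOUR yE) (EConst 1))) ;;
   find_unusedC par_rows 1 v)%lang.

(* Marks the end of the edge [y] on the side [B] if its end on the side [A] is marked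
   and its colour is the value of [v]. *)
Definition followC v A markA B markB : cmd :=
  CIf (dist_expr (EGet COLOUR yE) (EVar v) + (EConst 1 - EGet markA (column_expr A yE)))
    CSkip (CPut markB (column_expr B yE) (EConst 1)).

Definition spreadC : cmd :=
  (followC var_a GOAL GOAL_MARK START START_MARK ;;
   followC var_b START START_MARK GOAL GOAL_MARK)%lang.

Definition reachC : cmd :=
  (clearC START_MARK ;; clearC GOAL_MARK ;;
   CPut GOAL_MARK (column_expr GOAL xE) (EConst 1) ;;
   CFor var_round par_size (CFor var_y par_size spreadC))%lang.

Definition exchangeC : cmd :=
  CFor var_y par_size (CIf (EGet START_MARK (column_expr START yE))
    (CIf (dist_expr (EGet COLOUR yE) aE)
      (CIf (dist_expr (EGet COLOUR yE) bE) CSkip (CPut COLOUR yE aE))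
      (CPut COLOUR yE bE))
    CSkip).

Definition insertC : cmd :=
  (free_colourC START var_a ;; free_colourC GOAL var_b ;;
   reachC ;; exchangeC ;; CPut COLOUR xE aE)%lang.

Definition colourC := CFor var_x par_size insertC.

Definition emitC : cmd :=
  (CFor var_x par_size (CPut IO (EVar var_next + xE) (EGet POS xE)) ;;
   CSet var_next (EVar var_next + EPar par_size))%lang.

Definition startC : cmd :=
  (CSet var_next (EConst 1) ;; CSet var_steps (EConst 0) ;;
   CFor var_x par_size (CPut POS xE (EGet START xE)) ;; emitC)%lang.

Definition offset_expr c : expr := iter (c %/ 2) (EOp Add (EPar par_columns)) (EConst (c %% 2)).

(* Zero when [x] anchors a block of the class [(r, s)] whose cells [p] and [q] hold
   keys in the wrong order. *)
Definition inversion_expr r s p q : expr :=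
  (dist_expr (EGet MOD3 (EGet ROW xE)) (EConst r) + dist_expr (EGet MOD2 (EGet COL xE)) (EConst s) +
   (EGet ROW xE + EConst 3 - EPar par_rows) + (EGet COL xE + EConst 2 - EPar par_columns) +
   (EGet KEY_AT (xE + offset_expr q) + EConst 1 - EGet KEY_AT (xE + offset_expr p)))%lang.

Definition flagC r s p q : cmd :=
  (CFor var_x par_size (CPut KEY_AT (EGet POS xE) (EGet KEY xE)) ;;
   CFor var_x par_size (CPut FLAG xE (inversion_expr r s p q)))%lang.

Definition sequenceC T (f : T -> cmd) (l : seq T) := foldr (fun x c => CSeq (f x) c) CSkip l.

(* Each flagged block sends its cell [c] to its cell [nth 0 t c]. *)
Definition scatterC t c : cmd :=
  CFor var_x par_size (CIf (EGet FLAG xE) CSkip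
    (CPut DEST (xE + offset_expr c) (xE + offset_expr (nth 0 t c)))).

Definition destinationC t : cmd :=
  (CFor var_x par_size (CPut DEST xE xE) ;; sequenceC (scatterC t) (iota 0 6))%lang.

Definition moveC t : cmd :=
  (destinationC t ;;
   CFor var_x par_size (CPut POS xE (EGet DEST (EGet POS xE))) ;;
   CSet var_steps (EVar var_steps + EConst 1) ;; emitC)%lang.

(* A comparator: two consecutive cells of a block and a word of moves whose product
   is their transposition. *)
Definition comparator := (nat * nat * seq (seq nat))%type.

(* One-step rotations of the upper square, the lower square and the whole ring of a
   block, in both directions. *)
Definition upper_cw := [:: 1; 3; 0; 2; 4; 5].
Definition upper_ccw := [:: 2; 0; 3; 1; 4; 5].
Definition lower_cw := [:: 0; 1; 3; 5; 2; 4].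
Definition lower_ccw := [:: 0; 1; 4; 2; 5; 3].
Definition ring_cw := [:: 1; 3; 0; 5; 2; 4].
Definition ring_ccw := [:: 2; 0; 4; 1; 5; 3].

(* The words are the shortest ones. *)
Definition block_comparators (d : bool) : seq comparator := if d then
  [:: (0, 2, [:: upper_ccw; lower_ccw; ring_cw]); (1, 3, [:: upper_cw; lower_cw; ring_ccw]);
      (2, 4, [:: lower_cw; upper_cw; ring_ccw]); (3, 5, [:: lower_ccw; upper_ccw; ring_cw])]
  else
  [:: (0, 1, [:: upper_cw; upper_cw; lower_cw; ring_ccw; upper_ccw]);
      (2, 3, [:: upper_cw; ring_ccw; lower_cw]);
      (4, 5, [:: lower_cw; upper_cw; ring_ccw; upper_ccw; ring_cw])].

Definition compareC (k : comparator) r s : cmd :=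
  (flagC r s k.1.1 k.1.2 ;; sequenceC moveC k.2)%lang.

Definition classes d : seq (comparator * nat * nat) :=
  [seq (kr, s) | kr <- [seq (k, r) | k <- block_comparators d, r <- iota 0 3], s <- iota 0 2].

Definition roundC d := sequenceC (fun c => compareC c.1.1 c.1.2 c.2) (classes d).

Definition phaseC d := CFor var_round par_rows (roundC d).

Definition keyC e := CFor var_x par_size (CPut KEY xE e).

Definition routeC : cmd :=
  (startC ;;
   keyC (EGet COLOUR xE - EConst 1) ;; phaseC true ;;
   keyC (column_expr GOAL xE) ;; phaseC false ;;
   keyC (EGet ROW (EGet GOAL xE)) ;; phaseC true)%lang.

Definition mainC : cmd :=
  (readC ;; recoverC ;; tablesC ;; colourC ;; routeC ;; CPut IO (EConst 0) (EVar var_steps))%lang.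

Definition round_length d := sumn [seq size c.1.1.2 | c <- classes d].

(* The number of moves per row of the grid. *)
Definition rate := 2 * round_length true + round_length false.

Lemma rateE : rate = 222.
Proof. by vm_compute. Qed.

Lemma wf_mainC : wf_cmd mainC.
Proof. by vm_compute. Qed.

Lemma degree_mainC : degree mainC = 3.
Proof. by vm_compute. Qed.

Lemma loops_mainC : loops_over 3 mainC.
Proof. by vm_compute. Qed.

Definition comparator_ok d (k : comparator) :=
  [&& consecutive d k.1.1 k.1.2, all legal_table k.2
    & foldr table_comp (iota 0 6) k.2 == transposition k.1.1 k.1.2].

Lemma block_comparators_ok d : all (comparator_ok d) (block_comparators d).
Proof. by case: d; vm_compute. Qed.

(** * Reading the input *)

Lemma dist_expr_eq0 par st e f : (eval par st (dist_expr e f) == 0) =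
  (eval par st e == eval par st f).
Proof. by rewrite /dist_expr /=; lia. Qed.

Lemma interp_sequence par T (f : T -> cmd) x l st :
  interp par (sequenceC f (x :: l)) st = interp par (sequenceC f l) (interp par (f x) st).
Proof. by []. Qed.

Lemma sequence_keeps T (f : T -> cmd) k l :
  (forall x, ~~ writes k (f x)) -> ~~ writes k (sequenceC f l).
Proof. by move=> keeps; elim: l => //= x l /negbTE->; rewrite orbF keeps. Qed.

Lemma find_unusedC_correct par p k v st (w := vars (interp par (find_unusedC p k v) st) v) :
  v != var_y ->
  (exists2 i, i < par p & arrays st USED (k + i) = 0) ->
  exists2 i, i < par p & [/\ w = k + i, arrays st USED (k + i) = 0 &
                            forall j, i < j < par p -> arrays st USED (k + j) <> 0].
Proof.
move=> v_y [i0 lt_i0 unused_i0].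
pose found i1 s := forall i, i < i1 -> arrays st USED (k + i) = 0 ->
  exists2 i, i < i1 & [/\ vars s v = k + i, arrays st USED (k + i) = 0 &
                         forall j, i < j < i1 -> arrays st USED (k + j) <> 0].
suff: found (par p) (interp par (find_unusedC p k v) st) by move=> /(_ i0 lt_i0 unused_i0).
apply: interp_for => [i1 z s found_s i lt_i unused|//|i1 s _ [_ arr] yi found_s i lt_i unused].
- have [j lt_j [vE unused_j last_j]] := found_s i lt_i unused; exists j => //.
  by split=> //; rewrite -vE /= /upd (negbTE v_y).
rewrite /= yi arr //; case: eqP => [unused_i1|used_i1] /=.
  by exists i1 => //; split=> [|//|j]; [rewrite upd_at | lia].
have [|j lt_j [vE unused_j last_j]] := found_s i _ unused.
  by rewrite ltn_neqAle -ltnS lt_i andbT; apply: contra_not_neq used_i1 => <-.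
exists j; [exact: leqW | split=> // l lt_l].
by case: (ltngtP l i1) => [lt_l1|lt_l1|-> //]; [apply: last_j; lia | lia].
Qed.

Section Execution.
Variables ml ms order : nat.
Hypotheses (ml_ge3 : 3 <= ml) (ms_ge2 : 2 <= ms).
Local Notation n := (ml * ms).
Local Notation par := (params ml ms order).
Local Notation interp := (interp par).
Local Notation eval := (eval par).

Variables XI XG : nat -> nat.
Hypotheses (perm_XI : permutes n XI) (perm_XG : permutes n XG).

Lemma readC_correct st (st' := interp readC st) :
  (forall x, 1 < x < n -> arrays st IO (2 + x) = XI x) ->
  (forall x, x < n -> arrays st IO (2 + n + x) = XG x) ->
  (forall x, 1 < x < n -> arrays st' START x = XI x) /\
  (forall x, x < n -> arrays st' GOAL x = XG x).
Proof.
move=> io_start io_goal.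
pose load A e := CFor var_x par_size (CPut A xE (EGet IO e)).
have loaded A e g s : A != IO ->
    (forall i s', vars s' var_x = i -> eval s' e = g i) ->
    forall x, x < n -> arrays (interp (load A e) s) A x = arrays s IO (g x).
  move=> A_io eE.
  have [//|i s' _ arr _ xi _|//] := @interp_put_loop par id (fun i => arrays s IO (g i))
    var_x par_size A xE (EGet IO e) s.
  by rewrite /= xi (eE i) // arr // eq_sym.
pose st1 := interp (load START (xE + EConst 2)%lang) st.
have st'E : st' = interp (load GOAL (xE + EConst 2 + EPar par_size)%lang) st1 by [].
split=> x lt_x; rewrite st'E.
  rewrite interp_array // (loaded START _ (fun i => i + 2)) //; last lia.
    by rewrite addnC io_start.
  by move=> i s' /= ->.
rewrite (loaded GOAL _ (fun i => i + 2 + n)) // => [|i s' /= -> //].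
by rewrite interp_array // [x + 2]addnC addnAC io_goal.
Qed.

Definition erased st := forall v, v < n -> arrays st USED v = 0 <-> v = XI 0 \/ v = XI 1.

Lemma mark_startsC_correct st : (forall x, 1 < x < n -> arrays st START x = XI x) ->
  (forall v, arrays st USED v = 0) -> erased (interp mark_startsC st).
Proof.
move=> startE unused v lt_v; have [XI_inj _] := perm_XI.
rewrite (interp_mark (P := fun i => 1 < i) (h := XI) v); last first.
  move=> i s lt_i [_ arr] xi; rewrite /= xi subn_eq0 ltnNge; case: leqP => //= lt1i.
  by rewrite arr // startE ?lt1i.
split=> [[_ others]|v_cases]; last first.
  have n_gt1 : 1 < n by nia.
  split=> // i lt_i lt1i; case: v_cases => -> eq_v.
    by have := XI_inj i 0 lt_i (ltnW n_gt1) eq_v; lia.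
  by have := XI_inj i 1 lt_i n_gt1 eq_v; lia.
have [x lt_x xE] := permutes_surj perm_XI lt_v; rewrite -xE.
by case: x lt_x xE => [|[|x]] lt_x xE; [left | right | case: (others x.+2)].
Qed.

Lemma find_erasedC_correct st (st' := interp find_erasedC st) : erased st ->
  vars st' var_a = maxn (XI 0) (XI 1) /\ vars st' var_b = minn (XI 0) (XI 1).
Proof.
move=> erased_st; have [XI_inj XI_lt] := perm_XI; have n_gt1 : 1 < n by nia.
have neq01 : XI 0 <> XI 1 by move=> /XI_inj eq01; have : 0 = 1 by apply: eq01; lia.
have [XI0_lt XI1_lt] : XI 0 < n /\ XI 1 < n by split; apply: XI_lt; lia.
pose st1 := interp (find_unusedC par_size 0 var_a) st.
have [|a lt_a []] := @find_unusedC_correct par par_size 0 var_a st isT _.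
  by exists (XI 0) => //; apply/erased_st => //; left.
rewrite -/st1 !add0n => a_val /(erased_st _ lt_a) a_cases a_last.
pose st2 := set_array USED (vars st1 var_a) 1 st1.
have used2 v : arrays st2 USED v = 0 <-> v <> a /\ arrays st USED v = 0.
  rewrite -[arrays st2 USED v]/(upd (arrays st1 USED) (vars st1 var_a) 1 v) a_val /upd.
  rewrite interp_array //; case: eqP => [->|ne_va]; first by split=> // -[].
  by split=> [|[]].
have [|b lt_b []] := @find_unusedC_correct par par_size 0 var_b st2 isT _.
  have [c lt_c [c_cases ne_ca]] : exists2 c, c < n & (c = XI 0 \/ c = XI 1) /\ c <> a.
    case: a_cases => ->; [exists (XI 1) | exists (XI 0)] => //; last by split; [left|].
    by split; [right | apply: nesym].
  by exists c => //; apply/used2; split=> //; apply/erased_st.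
rewrite !add0n => b_val /used2[ne_ba /(erased_st _ lt_b) b_cases] _.
have not_lt_ab : ~~ (a < b).
  by apply/negP => lt_ab; apply: (a_last b); rewrite ?lt_ab //; apply/erased_st.
have [-> ->] : vars st' var_a = a /\ vars st' var_b = b.
  by split=> //; rewrite -a_val; apply: (@interp_var _ (find_unusedC par_size 0 var_b) st2).
by lia.
Qed.

Lemma recoverC_correct st (st' := interp recoverC st) : order = (XI 1 < XI 0).+1 ->
  (forall x, 1 < x < n -> arrays st START x = XI x) -> (forall v, arrays st USED v = 0) ->
  forall x, x < n -> arrays st' START x = XI x.
Proof.
move=> orderE startE unused x lt_x.
have [] := find_erasedC_correct (mark_startsC_correct startE unused).
rewrite /st' -[interp recoverC st]/(interp restoreC (interp find_erasedC (interp mark_startsC st))).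
have := @interp_array par find_erasedC (interp mark_startsC st) START isT.
rewrite [in RHS]interp_array //; move: (interp find_erasedC _) => s start_s a_val b_val.
rewrite /= subn1 -[par par_order]/order orderE /=.
by case: x lt_x => [|[|x]] lt_x; case: ltnP => /= order01;
  rewrite ?a_val ?b_val start_s /upd /= ?startE //; lia.
Qed.

End Execution.

(** * Executing the edge colouring *)

Section ColourExecution.
Variables ml ms order : nat.
Hypotheses (ml_ge3 : 3 <= ml) (ms_ge2 : 2 <= ms) (le_ms_ml : ms <= ml).
Local Notation n := (ml * ms).
Local Notation par := (params ml ms order).
Local Notation interp := (interp par).
Local Notation eval := (eval par).

Definition tables st := forall v, v <= n ->
  [/\ arrays st ROW v = v %/ ms, arrays st COL v = v %% ms,
      arrays st MOD3 v = v %% 3 & arrays st MOD2 v = v %% 2].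

Lemma recurrenceC_correct (T0 : nat -> nat) k e m d st :
  0 < m -> (forall s, eval s e = m) -> (forall j, j < m -> arrays st k j = T0 j) ->
  forall v, v < n + m ->
    arrays (interp (recurrenceC k e d) st) k v = T0 (v %% m) + v %/ m * d.
Proof.
move=> m_gt0 evalE initial; rewrite -[n]/(par par_size).
apply: (interp_for (Q := fun i s => forall v, v < i + m ->
  arrays s k v = T0 (v %% m) + v %/ m * d)) => // [v lt_v|i s _ _ xi IH v lt_v].
  by rewrite initial // modn_small // divn_small // mul0n addn0.
rewrite /= eqxx xi evalE /upd; case: eqP => [->|ne_v]; last by apply: IH; lia.
by rewrite IH; [rewrite modnDr divnDr ?divnn ?m_gt0 //; lia | lia].
Qed.

Lemma tablesC_correct st :
  (forall k j, k \in [:: ROW; MOD3; MOD2] -> arrays st k j = 0) -> tables (interp tablesC st).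
Proof.
move=> zero; have [lt_ml lt_ms] : ml < n /\ ms <= n by split; nia.
have ms_gt0 : 0 < ms by lia.
have mod3E v : v <= n -> arrays (interp tablesC st) MOD3 v = v %% 3.
  move=> le_v; rewrite /tablesC 4!interp_seq interp_array //.
  rewrite (@recurrenceC_correct id MOD3 _ 3) ?muln0 ?addn0 //; last lia.
  by move=> [|[|[|j]]] //= _; apply: zero.
have mod2E v : v <= n -> arrays (interp tablesC st) MOD2 v = v %% 2.
  move=> le_v; rewrite /tablesC 5!interp_seq interp_array //.
  rewrite (@recurrenceC_correct id MOD2 _ 2) ?muln0 ?addn0 //; last lia.
  by move=> j lt_j; rewrite interp_array //; case: j lt_j => [|[|j]] //= _; apply: zero.
have rowE v : v <= n -> arrays (interp tablesC st) ROW v = v %/ ms.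
  move=> le_v; rewrite /tablesC 6!interp_seq interp_array //.
  rewrite (@recurrenceC_correct (fun=> 0) ROW _ ms) ?muln1 //; last lia.
  by move=> j _; rewrite !interp_array // zero.
have colE v : v <= n -> arrays (interp tablesC st) COL v = v %% ms.
  move=> le_v; rewrite /tablesC 7!interp_seq.
  rewrite (@recurrenceC_correct id COL _ ms) ?muln0 ?addn0 //; last lia.
  by apply: (@interp_put_loop par id id var_x par_columns COL xE xE _ _ _).1.
by move=> v le_v; rewrite rowE ?colE ?mod3E ?mod2E.
Qed.

Lemma clearC_correct k st j : j < n -> arrays (interp (clearC k) st) k j = 0.
Proof. by apply: (@interp_put_loop par id (fun=> 0) var_y par_size k yE (EConst 0) _ _ _).1. Qed.

Variables XI XG : nat -> nat.
Hypotheses (perm_XI : permutes n XI) (perm_XG : permutes n XG).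

Definition vertex A := if A == START then XI else XG.

Definition side A e := vertex A e %% ms.

Definition ready st :=
  tables st /\ forall A x, A \in [:: START; GOAL] -> x < n -> arrays st A x = vertex A x.

Definition ready_arrays := [:: ROW; COL; MOD3; MOD2; START; GOAL].

Lemma ready_framed c st st' :
  all (fun k => ~~ writes k c) ready_arrays -> framed c st st' -> ready st -> ready st'.
Proof.
move=> /allP kept [_ arr] [tab verts]; split=> [v le_v|A x A_vert lt_x].
  by rewrite !arr; [exact: tab | apply: kept ..].
rewrite arr; first exact: verts.
by apply: kept; move: A_vert; rewrite !inE => /orP[] ->; rewrite ?orbT.
Qed.

Lemma ready_interp c st :
  all (fun k => ~~ writes k c) ready_arrays -> ready st -> ready (interp c st).
Proof. by move=> kept; apply: ready_framed kept (interp_framed _ _ _). Qed.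

Lemma vertex_permutes A : permutes n (vertex A).
Proof. by rewrite /vertex; case: ifP. Qed.

Lemma side_lt A e : side A e < ms.
Proof. exact: column_lt. Qed.

Lemma eval_column_expr A e st : A \in [:: START; GOAL] -> ready st -> eval st e < n ->
  eval st (column_expr A e) = side A (eval st e).
Proof.
move=> A_vert [tab verts] lt_e; rewrite /= (verts A) //.
by have [_ -> _ _] := tab _ (ltnW ((vertex_permutes A).2 _ lt_e)).
Qed.

Lemma free_colourC_correct A v st (w := vars (interp (free_colourC A v) st) v)
    (i := vars st var_x) :
  A \in [:: START; GOAL] -> v \notin [:: var_x; var_y] -> ready st -> i < n ->
  arrays st COLOUR i = 0 ->
  0 < w <= ml /\ free n (side A) (arrays st COLOUR) (side A i) w.
Proof.
move=> A_vert; rewrite !inE negb_or => /andP[v_x v_y] ready_st lt_i uncoloured.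
pose s1 := interp (clearC USED) st.
pose test : cmd := CIf (dist_expr (column_expr A yE) (column_expr A xE)) CSkip
  (CPut USED (EGet COLOUR yE) (EConst 1)).
pose s2 := interp (CFor var_y par_size test) s1.
have used c : c < n -> arrays s2 USED c = 0 <-> free n (side A) (arrays st COLOUR) (side A i) c.
  move=> lt_c; rewrite (interp_mark (P := fun e => side A e == side A i) (h := arrays st COLOUR)).
    rewrite clearC_correct //; split=> [[_ free_c] e lt_e /eqP|free_c]; first exact: free_c.
    by split=> // e lt_e /eqP; apply: free_c.
  move=> e s lt_e framed_s ye; have [var arr] := framed_s.
  have ready_s : ready s by apply: ready_framed framed_s (ready_interp _ ready_st).
  have xi : vars s var_x = i by rewrite var // interp_var.
  rewrite interp_if dist_expr_eq0 !eval_column_expr //= ?ye ?xi //.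
  by rewrite arr // interp_array.
have le_mln : ml < n by nia.
have [c c_bounds free_c] :=
  free_colour lt_i uncoloured (column_degree (side A i) (vertex_permutes A)).
have [|c' lt_c'] := @find_unusedC_correct par par_rows 1 v s2 v_y.
  exists c.-1; first by rewrite -[par par_rows]/ml; lia.
  by rewrite add1n prednK; [apply/used => //; lia | lia].
rewrite -[vars _ v]/w add1n => -[-> unused _]; rewrite -[par par_rows]/ml in lt_c'.
by split; [lia | apply/used => //; lia].
Qed.

Definition marked A st z := (z < ms) && (arrays st A z != 0).

Local Notation start_marked := (marked START_MARK).
Local Notation goal_marked := (marked GOAL_MARK).

Definition marks st : {set 'I_ms + 'I_ms} :=
  [set v : 'I_ms + 'I_ms | match v with inl z => start_marked st z | inr z => goal_marked st z end].

Lemma sub_marks st st' :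
  (forall z, start_marked st z -> start_marked st' z) ->
  (forall z, goal_marked st z -> goal_marked st' z) -> marks st \subset marks st'.
Proof.
move=> sub_s sub_g; apply/subsetP => -[] z; rewrite !inE; first exact: sub_s.
exact: sub_g.
Qed.

Lemma marks_inj st st' : marks st = marks st' ->
  start_marked st =1 start_marked st' /\ goal_marked st =1 goal_marked st'.
Proof.
move=> /setP eq_marks; split=> z; case: (ltnP z ms) => lt_z.
- by have := eq_marks (inl (Ordinal lt_z)); rewrite !inE.
- by rewrite /marked ltnNge lt_z.
- by have := eq_marks (inr (Ordinal lt_z)); rewrite !inE.
- by rewrite /marked ltnNge lt_z.
Qed.

Lemma followC_correct v A markA B markB st (e := vars st var_y) z :
  A \in [:: START; GOAL] -> B \in [:: START; GOAL] -> ready st -> e < n ->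
  marked markB (interp (followC v A markA B markB) st) z =
  marked markB st z ||
  [&& z == side B e, arrays st COLOUR e == vars st v & marked markA st (side A e)].
Proof.
move=> A_vert B_vert ready_st lt_e; rewrite interp_if.
rewrite -[eval st _]/(eval st (dist_expr (EGet COLOUR yE) (EVar v)) +
  (1 - arrays st markA (eval st (column_expr A yE)))).
rewrite addn_eq0 dist_expr_eq0 subn_eq0 lt0n !eval_column_expr //.
have colB : eval st (column_expr B yE) = side B e by apply: eval_column_expr.
rewrite /= in colB; rewrite /= colB -/e /marked side_lt /=.
case: ifP => _; last by rewrite andbF orbF.
by rewrite /= eqxx /upd andbT; case: (z =P _) => [->|_]; rewrite ?side_lt ?orbT ?orbF.
Qed.

Section Kempe.
Variables (clr : nat -> nat) (i a b : nat).
Local Notation U := (side START).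
Local Notation W := (side GOAL).

Definition kempe_state st :=
  [/\ ready st, arrays st COLOUR = clr, vars st var_a = a & vars st var_b = b].

Lemma spreadC_correct st (st' := interp spreadC st) (e := vars st var_y) :
  kempe_state st -> e < n ->
  (forall z, start_marked st' z =
     start_marked st z || [&& z == U e, clr e == a & goal_marked st (W e)]) /\
  (forall z, goal_marked st' z =
     goal_marked st z || [&& z == W e, clr e == b & start_marked st' (U e)]).
Proof.
move=> [ready_st clrE a_val b_val] lt_e.
rewrite /st' interp_seq; set s := interp _ st.
have start_s z : start_marked s z =
    start_marked st z || [&& z == U e, clr e == a & goal_marked st (W e)].
  by rewrite followC_correct // a_val clrE.
have goal_s : goal_marked s = goal_marked st by rewrite /marked interp_array.
have kept : start_marked (interp (followC var_b START START_MARK GOAL GOAL_MARK) s) =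
  start_marked s.
  by rewrite /marked interp_array.
have ye : vars s var_y = e by rewrite interp_var.
split=> z; rewrite kept; first exact: start_s.
rewrite followC_correct ?ye ?goal_s //; last exact: ready_interp.
by rewrite interp_array // interp_var // b_val clrE.
Qed.

Definition reached_state st := reached n U W clr i a b (start_marked st) (goal_marked st).
Definition closed_state st := closed n U W clr a b (start_marked st) (goal_marked st).

(* Either nothing is marked, and then the edge is not needed to close the set of
   marked vertices, or a new vertex is. *)
Lemma spreadC_step st (st' := interp spreadC st) (e := vars st var_y) :
  kempe_state st -> e < n -> reached_state st ->
  [/\ reached_state st', marks st \subset marks st', closed_state st -> marks st' = marks st
    & marks st' = marks st ->
      (clr e = a -> goal_marked st (W e) -> start_marked st (U e)) /\
      (clr e = b -> start_marked st (U e) -> goal_marked st (W e))].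
Proof.
move=> state_st lt_e [start_reached goal_reached root].
have [start_st' goal_st'] := spreadC_correct state_st lt_e; rewrite -/st' -/e in start_st' goal_st'.
have start_sub z : start_marked st z -> start_marked st' z by rewrite start_st' => ->.
have goal_sub z : goal_marked st z -> goal_marked st' z by rewrite goal_st' => ->.
split; first split=> [y|z|].
- rewrite start_st' => /orP[/start_reached[f [lt_f Uf fa Wf]]|/and3P[/eqP-> /eqP ea We]].
    by exists f; split=> //; apply: goal_sub.
  by exists e; split=> //; apply: goal_sub.
- rewrite goal_st' => /orP[/goal_reached[->|[f [lt_f Wf fb Uf]]]|/and3P[/eqP-> /eqP eb Ue]].
  + by left.
  + by right; exists f; split=> //; apply: start_sub.
  + by right; exists e.
- exact: goal_sub.
- exact: sub_marks.
- move=> [closed_a closed_b]; have start_eq z : start_marked st' z = start_marked st z.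
    rewrite start_st'; case: (boolP [&& _, _ & _]) => [/and3P[/eqP-> /eqP ea We]|_];
      last exact: orbF.
    by rewrite closed_a ?orbT.
  apply/setP => -[] z; rewrite !inE ?start_eq // goal_st' start_eq.
  case: (boolP [&& _, _ & _]) => [/and3P[/eqP-> /eqP eb Ue]|_]; last exact: orbF.
  by rewrite closed_b ?orbT.
- case/marks_inj => start_eq goal_eq; rewrite -start_eq -goal_eq; split=> [ea We|eb Ue].
    by rewrite start_st' -goal_eq We ea !eqxx orbT.
  by rewrite goal_st' Ue eb !eqxx orbT.
Qed.

Lemma eq_closed_state st st' : marks st = marks st' -> closed_state st -> closed_state st'.
Proof.
case/marks_inj => eq_start eq_goal [closed_a closed_b].
split=> e lt_e; rewrite -eq_start -eq_goal.
  exact: closed_a.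
exact: closed_b.
Qed.

Lemma kempe_framed c st st' : all (fun k => ~~ writes k c) (COLOUR :: ready_arrays) ->
  all (fun x => ~~ assigns x c) [:: var_a; var_b] ->
  framed c st st' -> kempe_state st -> kempe_state st'.
Proof.
move=> /andP[kept_colour kept_ready] /and3P[kept_a kept_b _] framed_st [ready_st clrE a_val b_val].
have [var arr] := framed_st.
by split; rewrite ?arr ?var //; apply: ready_framed framed_st ready_st.
Qed.

Lemma sweep_correct st (st' := interp (CFor var_y par_size spreadC) st) :
  kempe_state st -> reached_state st ->
  [/\ kempe_state st', reached_state st', closed_state st -> closed_state st'
    & closed_state st' \/ #|marks st| < #|marks st'|].
Proof.
move=> state_st reached_st.
pose closed_at e := (clr e = a -> goal_marked st (W e) -> start_marked st (U e)) /\
                    (clr e = b -> start_marked st (U e) -> goal_marked st (W e)).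
have [state_st' reached_st' sub_st' fixed_st' closed_st'] :
    [/\ kempe_state st', reached_state st', marks st \subset marks st',
        closed_state st -> marks st' = marks st
      & marks st' = marks st -> forall e, e < n -> closed_at e].
  apply: (interp_for (Q := fun j t => [/\ kempe_state t, reached_state t,
    marks st \subset marks t, closed_state st -> marks t = marks st
    & marks t = marks st -> forall e, e < j -> closed_at e])) => //.
  move=> j t lt_j framed_t yj [state_t reached_t sub_t fixed_t closed_t].
  have lt_yn : vars t var_y < n by rewrite yj.
  have [reached_t' sub_t' fixed_t' closed_t'] := spreadC_step state_t lt_yn reached_t.
  split=> //.
  - exact: kempe_framed (interp_framed _ _ _) state_t.
  - exact: subset_trans sub_t sub_t'.
  - move=> closed_st; have eq_t := fixed_t closed_st.
    by rewrite fixed_t' //; apply: eq_closed_state (esym eq_t) closed_st.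
  - move=> eq_t' e; have eq_t : marks t = marks st.
      by apply/eqP; rewrite eqEsubset sub_t andbT -eq_t' sub_t'.
    rewrite ltnS leq_eqVlt => /predU1P[->|]; last exact: closed_t.
    have [eq_s eq_g] := marks_inj eq_t; rewrite /closed_at -!eq_s -!eq_g -yj.
    by apply: closed_t'; rewrite eq_t' eq_t.
split=> // [closed_st|]; first exact: eq_closed_state (esym (fixed_st' closed_st)) closed_st.
case: (eqVneq (marks st) (marks st')) => [eq_st'|ne_st']; [left | right].
  apply: eq_closed_state (eq_st') _; split=> e lt_e;
    by have [closed_a closed_b] := closed_st' (esym eq_st') e lt_e.
by apply: proper_card; rewrite properEneq ne_st'.
Qed.

Lemma reachC_correct st (st' := interp reachC st) : vars st var_x = i -> i < n ->
  kempe_state st -> [/\ kempe_state st', reached_state st' & closed_state st'].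
Proof.
move=> xi lt_i state_st; have [ready_st _ _ _] := state_st.
pose s := interp (clearC GOAL_MARK) (interp (clearC START_MARK) st).
pose s' := interp (CPut GOAL_MARK (column_expr GOAL xE) (EConst 1)) s.
have lt_ms z : z < ms -> z < n by move=> lt_z; nia.
have ready_s : ready s by do 2!apply: ready_interp => //.
have state_s' : kempe_state s'.
  by rewrite /s' /s; do 3!apply: kempe_framed (interp_framed _ _ _) _ => //.
have col_x : eval s (column_expr GOAL xE) = W i.
  have xi_s : eval s xE = i by rewrite -[LHS]/(vars s var_x) !interp_var.
  by rewrite eval_column_expr ?xi_s.
have start_s' z : start_marked s' z = false.
  rewrite /marked; case: (ltnP z ms) => // lt_z.
  by rewrite interp_array // interp_array // clearC_correct // lt_ms.
have goal_s' z : goal_marked s' z = (z == W i).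
  rewrite /marked /s'.
  rewrite -[arrays _ GOAL_MARK]/(upd (arrays s GOAL_MARK) (eval s (column_expr GOAL xE)) 1).
  rewrite col_x /upd; case: (z =P W i) => [->|_]; first by rewrite side_lt.
  by case: (ltnP z ms) => // lt_z; rewrite clearC_correct ?lt_ms.
have reached_s' : reached_state s'.
  by split=> [y|z|]; rewrite ?start_s' ?goal_s' // => /eqP; left.
have [state_st' reached_st' closed_or_many] : [/\ kempe_state st', reached_state st'
    & closed_state st' \/ n < #|marks st'|].
  rewrite -[st']/(interp (CFor var_round par_size (CFor var_y par_size spreadC)) s').
  apply: (interp_for (Q := fun k t => [/\ kempe_state t, reached_state t
    & closed_state t \/ k < #|marks t|])) => // [|k t _ _ _ [state_t reached_t closed_t]].
    split=> //; right; apply/card_gt0P; exists (inr (Ordinal (side_lt GOAL i))).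
    by rewrite inE goal_s'.
  have [state_t' reached_t' keeps_closed grows] := sweep_correct state_t reached_t.
  split=> //; case: closed_t => [|lt_k]; first by left; apply: keeps_closed.
  by case: grows => [|grows]; [left | right; apply: leq_ltn_trans lt_k grows].
split=> //; case: closed_or_many => // many.
by have := leq_trans many (max_card _); rewrite card_sum !card_ord; nia.
Qed.

Lemma exchangeC_correct st : kempe_state st -> forall e, e < n ->
  arrays (interp exchangeC st) COLOUR e = recolour clr a b (start_marked st) U e.
Proof.
move=> state_st; have [ready_st clrE a_val b_val] := state_st.
suff done : forall e, e < n -> arrays (interp exchangeC st) COLOUR e =
    if e < n then recolour clr a b (start_marked st) U e else clr e.
  by move=> e lt_e; rewrite done // lt_e.
rewrite -{2}[n]/(par par_size).
apply: (interp_for (Q := fun j s => forall e, e < n -> arrays s COLOUR e =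
  if e < j then recolour clr a b (start_marked st) U e else clr e)) => //.
  by move=> e _; rewrite clrE.
move=> j s lt_j framed_s yj IH e lt_e; have [var arr] := framed_s.
have ready_s : ready s by apply: ready_framed framed_s ready_st.
have colour_j : eval s (EGet COLOUR yE) = clr j by rewrite /= yj IH // ltnn.
have mark_j : (eval s (EGet START_MARK (column_expr START yE)) == 0) = ~~ start_marked st (U j).
  rewrite -[eval s _]/(arrays s START_MARK (eval s (column_expr START yE))) arr //.
  have eval_j : eval s yE = j by [].
  by rewrite eval_column_expr ?eval_j // /marked side_lt negbK.
rewrite !interp_if !dist_expr_eq0 colour_j mark_j.
rewrite -[eval s aE]/(vars s var_a) -[eval s bE]/(vars s var_b).
rewrite !var // a_val b_val ltnS leq_eqVlt.
case: (e =P j) => [->|/eqP ne_ej] /=; last first.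
  rewrite -IH //; case: ifP => // _; case: ifP => _; last case: ifP => // _;
    by rewrite /= /upd yj (negbTE ne_ej).
rewrite /recolour /swap_colours; case: (start_marked st (U j)) => /=; last by rewrite IH // ltnn.
case: (clr j =P a) => _ /=; first by rewrite yj upd_at var.
by case: (clr j =P b) => _ /=; rewrite ?yj ?upd_at ?var // IH // ltnn.
Qed.

End Kempe.

Definition coloured i st :=
  [/\ forall A, proper n (side A) (arrays st COLOUR),
      forall e, e < n -> arrays st COLOUR e <= ml
    & forall e, e < n -> (0 < arrays st COLOUR e) = (e < i)].

Lemma insertC_correct st (i := vars st var_x) : i < n -> ready st -> coloured i st ->
  coloured i.+1 (interp insertC st).
Proof.
move=> lt_i ready_st [proper_st le_st pos_st].
pose s1 := interp (free_colourC START var_a) st.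
pose s2 := interp (free_colourC GOAL var_b) s1.
pose s3 := interp reachC s2; pose s4 := interp exchangeC s3.
have uncoloured : arrays st COLOUR i = 0 by have := pos_st i lt_i; rewrite ltnn; lia.
have ready_s1 : ready s1 by apply: ready_interp.
have x1 : vars s1 var_x = i by rewrite interp_var.
have clr1 : arrays s1 COLOUR = arrays st COLOUR by rewrite interp_array.
have [a_bounds free_a] := @free_colourC_correct START var_a st isT isT ready_st lt_i uncoloured.
have [||b_bounds free_b] := @free_colourC_correct GOAL var_b s1 isT isT ready_s1;
  rewrite ?x1 ?clr1 //.
rewrite -/s1 -/s2 x1 clr1 in a_bounds free_a b_bounds free_b.
set a := vars s1 var_a in a_bounds free_a; set b := vars s2 var_b in b_bounds free_b.
have state2 : kempe_state (arrays st COLOUR) a b s2.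
  split=> //; [exact: ready_interp | by rewrite interp_array | by rewrite interp_var].
have [|state3 reached3 closed3] := @reachC_correct _ i a b s2 _ lt_i state2.
  by rewrite interp_var.
pose recoloured := upd (recolour (arrays st COLOUR) a b (marked START_MARK s3) (side START)) i a.
have colourE e : e < n -> arrays (interp insertC st) COLOUR e = recoloured e.
  move=> lt_e; rewrite !interp_seq -/s1 -/s2 -/s3 -/s4.
  have x4 : vars s4 var_x = i by rewrite !interp_var.
  have a4 : vars s4 var_a = a by do 3!rewrite interp_var //.
  rewrite -[LHS]/(upd (arrays s4 COLOUR) (vars s4 var_x) (vars s4 var_a) e) x4 a4 /recoloured /upd.
  by case: eqP => // _; apply: exchangeC_correct state3 _ lt_e.
have [a_gt0 a_le] := andP a_bounds; have [b_gt0 b_le] := andP b_bounds.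
have [proper_start proper_goal] :=
  kempe_exchange a_gt0 b_gt0 (proper_st START) (proper_st GOAL) free_a free_b reached3 closed3.
split=> [A|e lt_e|e lt_e].
- have proper_A : proper n (side A) recoloured.
    by rewrite /side /vertex; case: ifP.
  by apply: eq_proper proper_A => e lt_e; rewrite colourE.
- rewrite colourE // /recoloured /upd /recolour /swap_colours.
  by have := le_st e lt_e; do !case: ifP.
- rewrite colourE // /recoloured /upd /recolour /swap_colours [in RHS]ltnS [in RHS]leq_eqVlt.
  case: (e =P i) => [_|_]; first by rewrite a_gt0.
  have := pos_st e lt_e; case: ifP => //= _; case: eqP => [->|_]; first by rewrite a_gt0 b_gt0.
  by case: eqP => [->|_]; rewrite ?a_gt0 ?b_gt0.
Qed.

Lemma colourC_correct st (st' := interp colourC st) : ready st ->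
  (forall e, arrays st COLOUR e = 0) ->
  (forall A, proper n (side A) (arrays st' COLOUR)) /\
  (forall e, e < n -> 0 < arrays st' COLOUR e <= ml).
Proof.
move=> ready_st uncoloured.
have [proper_st' le_st' pos_st'] : coloured n st'.
  rewrite -{1}[n]/(par par_size).
  apply: (interp_for (Q := fun i s => coloured i s)) => // [|i s lt_i framed_s xi].
    by split=> [A e f _ _|e _|e _]; rewrite uncoloured.
  rewrite -xi; apply: insertC_correct; rewrite ?xi //.
  exact: ready_framed framed_s ready_st.
by split=> // e lt_e; rewrite pos_st' // lt_e le_st'.
Qed.

End ColourExecution.

(** * Executing the routing *)

Section RouteExecution.
Variables ml ms order : nat.
Hypotheses (ml_ge3 : 3 <= ml) (ms_ge2 : 2 <= ms) (le_ms_ml : ms <= ml).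
Local Notation n := (ml * ms).
Local Notation par := (params ml ms order).
Local Notation interp := (interp par).
Local Notation eval := (eval par).
Local Notation tables := (tables ml ms).
Variable XI : nat -> nat.

Definition trace T (tr : nat -> nat -> nat) :=
  (forall x, x < n -> tr 0 x = XI x) /\
  (forall k, k < T -> exists2 f, legal ml ms f & forall x, x < n -> tr k.+1 x = f (tr k x)).

(* [T] moves from [XI] to [X] have been made and written out, after the cell for their
   number. *)
Definition routed T X st :=
  [/\ exists tr, [/\ trace T tr, forall x, x < n -> tr T x = X x &
        forall k x, k <= T -> x < n -> arrays st IO (1 + (k * n + x)) = tr k x],
      vars st var_next = 1 + T.+1 * n, vars st var_steps = T
    & forall x, x < n -> arrays st POS x = X x].

Lemma routed_framed c T X st st' :
  ~~ writes IO c -> ~~ writes POS c -> ~~ assigns var_next c -> ~~ assigns var_steps c ->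
  framed c st st' -> routed T X st -> routed T X st'.
Proof.
move=> io pos next steps [var arr] [[tr [trace_tr trT written]] nextE stepsE posE].
by split; rewrite ?var // ?arr //; exists tr; split=> // k x le_k lt_x; rewrite arr // written.
Qed.

Lemma emitC_correct X st (st' := interp emitC st) (b := vars st var_next) :
  (forall x, x < n -> arrays st POS x = X x) ->
  [/\ forall x, x < n -> arrays st' IO (b + x) = X x,
      forall j, j < b -> arrays st' IO j = arrays st IO j & vars st' var_next = b + n].
Proof.
move=> posE; rewrite /st' interp_seq; set s' := interp _ st.
have -> : vars (interp (CSet var_next (EVar var_next + EPar par_size)%lang) s') var_next = b + n.
  by rewrite -[LHS]/(vars s' var_next + n) interp_var.
have [//||done todo] := @interp_put_loop par (fun x => b + x) X var_x par_size IO
  (EVar var_next + xE)%lang (EGet POS xE) st.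
- by move=> i j _ _ /addnI.
- by move=> i s lt_i arr var xi _; rewrite /= var // xi arr // posE.
- by split=> // j lt_j; apply: todo => i _; rewrite ltn_eqF // ltn_addr.
Qed.

Lemma startC_correct st : (forall x, x < n -> arrays st START x = XI x) ->
  routed 0 XI (interp startC st).
Proof.
move=> startE; rewrite /startC 3!interp_seq.
set s1 := interp (CSet var_steps _) _; set s2 := interp (CFor _ _ _) s1.
have posE x : x < n -> arrays s2 POS x = XI x.
  apply: (@interp_put_loop par id XI var_x par_size POS xE (EGet START xE) s1 _ _).1 => //.
  by move=> i s lt_i arr _ xi _; rewrite /= xi arr // startE.
have next2 : vars s2 var_next = 1 by rewrite interp_var.
have [written _ nextE] := emitC_correct posE; rewrite next2 in written nextE.
split=> [|||x lt_x]; last by rewrite interp_array // posE.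
  exists (fun=> XI); split=> // k x; rewrite leqn0 => /eqP-> lt_x.
  by rewrite mul0n add0n written.
  by rewrite nextE mul1n.
by do 2!rewrite interp_var //.
Qed.

Definition flagged (F : pred nat) st := forall A, A < n -> (arrays st FLAG A == 0) = F A.

Lemma eval_offset_expr c st : eval st (offset_expr c) = offset ms c.
Proof. by rewrite /offset_expr /offset; elim: (c %/ 2) => //= k ->; rewrite mulSn addnA. Qed.

Section Move.
Variables (r s : nat) (F : pred nat).
Hypothesis F_anchor : forall A, F A -> anchor ml ms r s A.

Lemma anchor_lt A : F A -> A < n.
Proof.
move=> FA; have [] := cellE ml_ge3 ms_ge2 (F_anchor FA) (isT : 0 < 6).
by rewrite /offset addn0.
Qed.

Lemma scatterC_correct t l st (f := arrays st DEST)
  (f' := arrays (interp (sequenceC (scatterC t) l) st) DEST) :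
  flagged F st -> uniq l -> all (fun c => c < 6) l ->
  (forall A c, F A -> c \in l -> f' (A + offset ms c) = A + offset ms (nth 0 t c)) /\
  (forall v, (forall A c, F A -> c \in l -> v != A + offset ms c) -> f' v = f v).
Proof.
rewrite {}/f {}/f'; elim: l st => [|c l IH] st flag_st //.
rewrite cons_uniq [all _ _]/= interp_sequence => /andP[c_l uniq_l] /andP[lt_c lt_l].
pose st1 := interp (scatterC t c) st.
have [||done todo arr _] := @interp_scatter par F (fun A => A + offset ms c)
  (fun A => A + offset ms (nth 0 t c)) var_x par_size DEST (CIf (EGet FLAG xE) CSkip
    (CPut DEST (xE + offset_expr c) (xE + offset_expr (nth 0 t c)))%lang) st.
- by move=> A B _ _ /addIn.
- move=> A s' lt_A arr _ xA _; rewrite interp_if -[eval s' _]/(arrays s' FLAG (vars s' var_x)).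
  by rewrite xA arr // flag_st //= !eval_offset_expr xA.
rewrite -[interp _ _]/st1 in done todo arr; rewrite -/st1.
have flag_st1 : flagged F st1 by move=> A lt_A; rewrite arr // flag_st.
have [IH_cell IH_off] := IH st1 flag_st1 uniq_l lt_l.
split=> [A c' FA|v off_v].
  rewrite inE; case: (boolP (c' \in l)) => [c'_l _|_ /orP[/eqP->|//]]; first exact: IH_cell.
  rewrite IH_off; first by rewrite done // anchor_lt.
  move=> B e FB e_l; apply: contraNneq c_l.
  have lt_e := allP lt_l e e_l.
  by case/(cell_inj ml_ge3 ms_ge2 (F_anchor FA) (F_anchor FB) lt_c lt_e) => _ ->.
rewrite IH_off => [|A e FA e_l]; last by apply: off_v; rewrite // inE e_l orbT.
by apply: todo => A _ FA; apply: off_v; rewrite // inE eqxx.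
Qed.

Lemma destinationC_correct t st : flagged F st ->
  rotates ml ms F t (arrays (interp (destinationC t) st) DEST).
Proof.
move=> flag_st; rewrite interp_seq; set s1 := interp _ st.
have identity v : v < n -> arrays s1 DEST v = v.
  by apply: (@interp_put_loop par id id var_x par_size DEST xE xE st _ _).1 => // i s' _ _ _ /= ->.
have flag_s1 : flagged F s1 by move=> A lt_A; rewrite interp_array // flag_st.
have [] := @scatterC_correct t (iota 0 6) s1 flag_s1 isT isT => cell off.
split=> [A c FA lt_c|v lt_v off_v]; first by apply: cell; rewrite // mem_iota.
by rewrite off ?identity // => A c FA; rewrite mem_iota; apply: off_v.
Qed.

Lemma moveC_correct t T X st (st' := interp (moveC t) st) :
  legal_table t -> flagged F st -> routed T X st ->
  exists f, [/\ rotates ml ms F t f, routed T.+1 (f \o X) st' & flagged F st'].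
Proof.
move=> legal_t flag_st [[tr [[tr0 tr_legal] trT written]] nextE stepsE posE].
pose s1 := interp (destinationC t) st; pose f := arrays s1 DEST.
pose s2 := interp (CFor var_x par_size (CPut POS xE (EGet DEST (EGet POS xE)))) s1.
pose s3 := interp (CSet var_steps (EVar var_steps + EConst 1)%lang) s2.
have rot_f : rotates ml ms F t f by apply: destinationC_correct.
have pos1 : arrays s1 POS = arrays st POS by rewrite interp_array.
have pos3 x : x < n -> arrays s3 POS x = f (X x).
  apply: (@interp_put_loop par id (f \o X) var_x par_size POS xE _ s1 _ _).1 => //.
  by move=> i s' lt_i arr _ xi same; rewrite /= xi arr // same pos1 posE.
have next3 : vars s3 var_next = 1 + T.+1 * n by rewrite !interp_var.
have st'E : st' = interp emitC s3 by [].
have [] := emitC_correct pos3; rewrite next3 -st'E => new old next'.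
exists f; split=> [//||A lt_A]; last by rewrite /st' interp_array // flag_st.
split; last by move=> x lt_x; rewrite st'E interp_array // pos3.
- exists (fun k => if k <= T then tr k else f \o X).
  split=> [|x _|k x le_k lt_x]; [split=> [//|k] | by rewrite ltnn |].
    rewrite ltnS => le_k; case: (ltnP k T) => [lt_k|ge_k].
      by rewrite le_k; apply: tr_legal.
    have -> : k = T by lia.
    rewrite leqnn; exists f => [|x lt_x]; last by rewrite trT.
    exact: (rotates_legal ml_ge3 ms_ge2 F_anchor legal_t rot_f).
  case: (leqP k T) => [le_kT|lt_T]; last first.
    have -> : k = T.+1 by lia.
    by rewrite addnA new.
  rewrite old -?written //; last by nia.
  by rewrite !interp_array.
- by rewrite next'; lia.
- rewrite st'E interp_var //.
  by rewrite -[vars s3 _]/(vars s2 var_steps + 1) !interp_var // stepsE addn1.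
Qed.

Lemma movesC_correct w T X st :
  all legal_table w -> flagged F st -> routed T X st ->
  exists2 f, rotates ml ms F (foldr table_comp (iota 0 6) w) f
    & routed (T + size w) (f \o X) (interp (sequenceC moveC w) st).
Proof.
elim: w T X st => [|t w IH] T X st.
  by move=> _ _ routed_st; exists id; [apply: rotates_id | rewrite addn0].
case/andP=> legal_t legal_w flag_st routed_st.
have [f [rot_f routed_f flag_f]] := moveC_correct legal_t flag_st routed_st.
have perm_t : perm_eq t (iota 0 6) by case/and3P: legal_t.
have [g rot_g routed_g] := IH _ _ _ legal_w flag_f routed_f.
exists (g \o f); first exact: rotates_comp perm_t rot_f rot_g.
by rewrite /= addnS -addSn.
Qed.

End Move.

Definition keyed (key : nat -> nat) st := tables st /\ forall x, x < n -> arrays st KEY x = key x.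

Lemma keyed_framed c key st st' :
  all (fun k => ~~ writes k c) [:: KEY; ROW; COL; MOD3; MOD2] ->
  framed c st st' -> keyed key st -> keyed key st'.
Proof.
case/and5P=> kept_key kept_row kept_col kept_mod3 /andP[kept_mod2 _] [_ arr] [tab keyE].
by split=> [v le_v|x lt_x]; rewrite !arr //; [apply: tab | apply: keyE].
Qed.

Lemma inversion_flags r s p q keys st : p < 6 -> q < 6 -> tables st ->
  (forall v, v < n -> arrays st KEY_AT v = keys v) ->
  flagged (inverted ml ms r s p q keys)
    (interp (CFor var_x par_size (CPut FLAG xE (inversion_expr r s p q))) st).
Proof.
move=> lt_p lt_q tab key_at A lt_A; pose at_vertex B := set_var var_x B st.
rewrite (@interp_put_loop par id (fun B => eval (at_vertex B) (inversion_expr r s p q))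
  var_x par_size FLAG xE (inversion_expr r s p q) st _ _).1 // => [|i s' _ arr _ xi _]; last first.
  by rewrite /= !eval_offset_expr /= xi !arr.
have [rowE colE _ _] := tab A (ltnW lt_A).
have [le_row le_col] : A %/ ms <= n /\ A %% ms <= n.
  by rewrite !(leq_trans _ (ltnW lt_A)) ?leq_div ?leq_mod.
have [_ _ mod3E _] := tab _ le_row; have [_ _ _ mod2E] := tab _ le_col.
rewrite /= !eval_offset_expr /= upd_at rowE colE mod3E mod2E.
rewrite -[par par_rows]/ml -[par par_columns]/ms.
rewrite /inverted; case: (boolP (anchor ml ms r s A)) => [anc_A|]; last by rewrite /anchor; lia.
have [lt_vp _ _] := cellE ml_ge3 ms_ge2 anc_A lt_p.
have [lt_vq _ _] := cellE ml_ge3 ms_ge2 anc_A lt_q.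
by rewrite !key_at //; move: anc_A; rewrite /anchor; lia.
Qed.

Lemma flagC_correct r s p q X key keys st : p < 6 -> q < 6 -> permutes n X ->
  (forall x, x < n -> arrays st POS x = X x) -> keyed key st ->
  (forall x, x < n -> keys (X x) = key x) ->
  flagged (inverted ml ms r s p q keys) (interp (flagC r s p q) st).
Proof.
move=> lt_p lt_q perm_X posE [tab keyE] keysE; have [X_inj _] := perm_X.
rewrite interp_seq; apply: inversion_flags => // [v le_v|v lt_v].
  by rewrite !interp_array //; apply: tab.
have [x lt_x <-] := permutes_surj perm_X lt_v; rewrite keysE //.
apply: (@interp_put_loop par X key var_x par_size KEY_AT (EGet POS xE)
  (EGet KEY xE) st _ _).1 => //.
by move=> i s' lt_i arr _ xi _; rewrite /= xi !arr // posE ?keyE.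
Qed.

Section Phase.
Variables (d : bool) (key X0 : nat -> nat).
Local Notation len := (line_length ml ms d).
Local Notation line := (line ms d).
Local Notation point := (point ms d).

(* [t] rounds of the phase that starts at [X0] are complete; in the next one the
   comparators in [done] have acted on every line. *)
Definition phase_state t (done : nat -> nat -> Prop) T st := exists X keys,
  [/\ routed T X st, permutes n X, keyed key st,
      forall x, x < n -> line (X x) = line (X0 x) /\ keys (X x) = key x
    & forall l, l < line_count ml ms d -> sorting len t (done l) (fun i => keys (point l i))].

Lemma compareC_correct (c : comparator) r s t done T st : comparator_ok d c ->
  phase_state t done T st ->
  phase_state t (fun l i => done l i \/ compares ml ms d r s c.1.1 l i) (T + size c.2)
    (interp (compareC c r s) st).
Proof.
case: c => -[p q] w /and3P[/= consec legal_w /eqP product].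
case=> X [keys [routed_st perm_X keyed_st X_keys sorting_st]]; have [_ X_lt] := perm_X.
have [lt_p lt_q] : p < 6 /\ q < 6 by case/and3P: consec => ? /eqP; lia.
pose F := inverted ml ms r s p q keys; pose s1 := interp (flagC r s p q) st.
have F_anchor A : F A -> anchor ml ms r s A by case/andP.
have routed_s1 : routed T X s1 by apply: routed_framed (interp_framed _ _ _) routed_st.
have flag_s1 : flagged F s1.
  have [_ _ _ posE] := routed_st.
  exact: (flagC_correct _ _ lt_p lt_q perm_X posE keyed_st (fun x lt_x => (X_keys x lt_x).2)).
have [f] := movesC_correct F_anchor legal_w flag_s1 routed_s1.
rewrite product => swap_f routed_st'.
have perm_t : perm_eq (transposition p q) (iota 0 6).
  rewrite -product {product}; elim: (w) legal_w => //= u v IH /andP[/and3P[perm_u _ _] legal_v].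
  exact: perm_table_comp perm_u (IH legal_v).
exists (f \o X), (keys \o f); split=> // [||x lt_x|l lt_l].
- exact: permutes_comp perm_X (rotates_permutes ml_ge3 ms_ge2 F_anchor perm_t swap_f).
- apply: keyed_framed (interp_framed par (compareC (p, q, w) r s) st) keyed_st.
  by rewrite /= !sequence_keeps.
- have [<- <-] := X_keys x lt_x.
  rewrite /= (exchangeK ml_ge3 ms_ge2 consec swap_f) ?X_lt //.
  by rewrite (exchange_line ml_ge3 ms_ge2 consec swap_f) ?X_lt.
- apply: sorting_step (sorting_st l lt_l).
  exact: (exchange_comparators ml_ge3 ms_ge2 consec swap_f lt_l).
Qed.

Lemma comparesC_correct cs t done T st :
  all (fun c => comparator_ok d c.1.1) cs -> phase_state t done T st ->
  phase_state t
    (fun l i => done l i \/ exists2 c, c \in cs & compares ml ms d c.1.2 c.2 c.1.1.1.1 l i)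
    (T + sumn [seq size c.1.1.2 | c <- cs])
    (interp (sequenceC (fun c => compareC c.1.1 c.1.2 c.2) cs) st).
Proof.
elim: cs done T st => [|c cs IH] done T st.
  move=> _ [X [keys [routed_st perm_X keyed_st X_keys sorting_st]]].
  exists X, keys; split=> //; first by rewrite addn0.
  by move=> l lt_l; apply: sub_sorting (sorting_st l lt_l) => i [|[]].
case/andP=> ok_c ok_cs state_st.
have := IH _ _ _ ok_cs (compareC_correct c.1.2 c.2 ok_c state_st).
rewrite -addnA -interp_sequence.
case=> X [keys [routed_st perm_X keyed_st X_keys sorting_st]].
exists X, keys; split=> // l lt_l; apply: sub_sorting (sorting_st l lt_l) => i.
case=> [done_l|[c' + cmp]]; first by left; left.
rewrite inE => /predU1P[eq_c|in_cs]; last by right; exists c'.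
by left; right; rewrite -eq_c.
Qed.

Lemma roundC_correct t T st : phase_state t (fun _ _ => False) T st ->
  phase_state t.+1 (fun _ _ => False) (T + round_length d) (interp (roundC d) st).
Proof.
move=> state_st; have ok : all (fun c => comparator_ok d c.1.1) (classes d).
  apply/allP => c /allpairsP[[[k r] s] [/allpairsP[[k' r'] [in_k _ /= [-> ->]]] _ ->]] /=.
  exact: (allP (block_comparators_ok d)).
have := comparesC_correct ok state_st; rewrite -/(roundC d) -/(round_length d).
case=> X [keys [routed_st perm_X keyed_st X_keys sorting_st]].
exists X, keys; split=> // l lt_l; apply: sorting_round (sorting_st l lt_l) => i lt_i; right.
have [r [s [p [lt_r lt_s]]]] := compares_cover ml_ge3 ms_ge2 lt_l lt_i.
have -> : first_cells d = [seq k.1.1 | k <- block_comparators d] by case: (d).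
case/mapP=> k in_k -> cmp; exists (k, r, s) => //.
by rewrite !allpairs_f ?mem_iota.
Qed.

Lemma phaseC_correct T st :
  routed T X0 st -> permutes n X0 -> keyed key st ->
  (forall x, x < n -> key x < len) ->
  (forall x y, x < n -> y < n -> line (X0 x) = line (X0 y) -> key x = key y -> x = y) ->
  exists X, [/\ routed (T + ml * round_length d) X (interp (phaseC d) st), permutes n X
    & forall x, x < n -> line (X x) = line (X0 x) /\ position ms d (X x) = key x].
Proof.
move=> routed_st perm_X0 keyed_st key_lt key_inj.
have [inv_X0 inv_X0K] := permutes_inv perm_X0; pose keys := key \o inv_X0.
have initial : phase_state 0 (fun _ _ => False) T st.
  exists X0, keys; split=> // [x lt_x|l lt_l]; first by rewrite /keys /= inv_X0K.
  have robot_at i : i < len -> exists2 x, x < n & point l i = X0 x.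
    move=> lt_i; have [x] := permutes_surj perm_X0 (point_lt ml_ge3 ms_ge2 lt_l lt_i).
    by exists x.
  apply: sorting_start; split=> [i j lt_i lt_j|i lt_i]; last first.
    by have [x lt_x ->] := robot_at i lt_i; rewrite /keys /= inv_X0K // key_lt.
  have [x lt_x xE] := robot_at i lt_i; have [y lt_y yE] := robot_at j lt_j.
  rewrite xE yE /keys /= !inv_X0K // => eq_key.
  have eq_xy : x = y.
    by apply: key_inj => //; rewrite -xE -yE !(line_point ml_ge3 ms_ge2).
  by have [] := point_inj ml_ge3 ms_ge2 lt_l lt_i lt_l lt_j; rewrite // xE yE eq_xy.
have : phase_state ml (fun _ _ => False) (T + ml * round_length d) (interp (phaseC d) st).
  apply: (@interp_for par (fun t => phase_state t (fun _ _ => False) (T + t * round_length d))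
    var_round par_rows (roundC d) st).
  - move=> t v s [X [ks [routed_s perm_X keyed_s X_keys sorting_s]]]; exists X, ks; split=> //.
  - by rewrite mul0n addn0.
  - by move=> t s _ _ _ /roundC_correct; rewrite -addnA -mulSnr.
case=> X [ks [routed_st' perm_X keyed_st' X_keys sorting_st']]; exists X; split=> // x lt_x.
have [lineE keyE] := X_keys x lt_x; split=> //; have [_ X_lt] := perm_X.
have lt_l : line (X x) < line_count ml ms d by apply: line_lt => //; rewrite ?X_lt.
have le_len : len <= ml by case: (d).
have := sorting_done le_len (sorting_st' _ lt_l) (position_lt ml_ge3 ms_ge2 d (X_lt _ lt_x)).
by rewrite point_line keyE.
Qed.

End Phase.

Variables (XG clr : nat -> nat).
Hypotheses (perm_XI : permutes n XI) (perm_XG : permutes n XG).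
Local Notation ready := (ready ml ms XI XG).
Local Notation side := (side ms XI XG).

Definition prepared st := ready st /\ arrays st COLOUR = clr.

Lemma prepared_interp c st :
  all (fun k => ~~ writes k c) (COLOUR :: ready_arrays) -> prepared st -> prepared (interp c st).
Proof.
case/andP=> kept_colour kept [ready_st clrE].
by split; [apply: ready_interp | rewrite interp_array].
Qed.

Lemma sort_by_correct d e key X0 T st :
  (forall x s, x < n -> prepared s -> vars s var_x = x -> eval s e = key x) ->
  prepared st -> routed T X0 st -> permutes n X0 ->
  (forall x, x < n -> key x < line_length ml ms d) ->
  (forall x y, x < n -> y < n -> line ms d (X0 x) = line ms d (X0 y) -> key x = key y -> x = y) ->
  exists X, [/\ routed (T + ml * round_length d) X (interp (phaseC d) (interp (keyC e) st)),
      permutes n X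
    & forall x, x < n -> line ms d (X x) = line ms d (X0 x) /\ position ms d (X x) = key x].
Proof.
move=> keyE prepared_st routed_st perm_X0; apply: phaseC_correct => //.
  by apply: routed_framed (interp_framed _ _ _) routed_st.
have [[tab verts] clrE] := prepared_st.
split=> [v le_v|x lt_x]; first by rewrite !interp_array //; apply: tab.
apply: (@interp_put_loop par id key var_x par_size KEY xE e st _ _).1 => // i s lt_i arr _ xi _.
rewrite (keyE i) //; split; last by rewrite arr.
by split=> [v le_v|A y A_vert lt_y]; rewrite !arr //;
  [apply: tab | apply: verts | case/or3P: A_vert => // /eqP->].
Qed.

Hypotheses (proper_clr : forall A, proper n (side A) clr).
Hypothesis clr_bounds : forall e, e < n -> 0 < clr e <= ml.

Lemma same_side_colour A x y :
  x < n -> y < n -> side A x = side A y -> clr x - 1 = clr y - 1 -> x = y.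
Proof.
move=> lt_x lt_y eq_side eq_clr; have := clr_bounds lt_x; have := clr_bounds lt_y.
by move=> bound_y bound_x; apply: proper_clr lt_x lt_y _ eq_side _; lia.
Qed.

(* The first phase sends each robot to the row of its colour, where no two robots have
   the same goal column. The second one sends it to its goal column, and the third one
   to its goal. *)
Lemma routeC_correct st : prepared st -> exists2 X, routed (ml * rate) X (interp routeC st)
  & forall x, x < n -> X x = XG x.
Proof.
move=> prepared_st; have [[_ verts] _] := prepared_st; have [XG_inj XG_lt] := perm_XG.
have routed_s0 : routed 0 XI (interp startC st) by apply: startC_correct => x; apply: verts.
have prepared_s0 : prepared (interp startC st) by apply: prepared_interp.
rewrite /routeC interp_seq.
move: (interp startC st) prepared_s0 routed_s0 => s0 prepared_s0 routed_s0.
rewrite 2!interp_seq; set s1 := interp (phaseC true) _.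
have [||x y lt_x lt_y|X1 [routed_s1 perm_X1 X1E]] :=
  @sort_by_correct true (EGet COLOUR xE - EConst 1)%lang (fun x => clr x - 1) _ _ _ _
    prepared_s0 routed_s0 perm_XI.
- by move=> x s lt_x [_ <-] /= ->.
- by move=> x lt_x; have := clr_bounds lt_x; rewrite /=; lia.
- exact: (@same_side_colour START).
have prepared_s1 : prepared s1 by do 2!apply: prepared_interp => //.
rewrite 2!interp_seq; set s2 := interp (phaseC false) _.
have [||x y lt_x lt_y|X2 [routed_s2 perm_X2 X2E]] :=
  @sort_by_correct false (column_expr GOAL xE) (side GOAL) _ _ _ _ prepared_s1 routed_s1 perm_X1.
- by move=> x s lt_x [ready_s _] xE; rewrite (eval_column_expr perm_XI perm_XG) //= xE.
- by move=> x lt_x; apply: column_lt.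
- have [_ row_x] := X1E x lt_x; have [_ row_y] := X1E y lt_y; rewrite /= in row_x row_y.
  by rewrite /= row_x row_y => eq_clr eq_side; apply: same_side_colour eq_side eq_clr.
have prepared_s2 : prepared s2 by do 2!apply: prepared_interp => //.
rewrite interp_seq.
have [||x y lt_x lt_y|X3 [routed_s3 perm_X3 X3E]] :=
  @sort_by_correct true (EGet ROW (EGet GOAL xE)) (fun x => XG x %/ ms) _ _ _ _
    prepared_s2 routed_s2 perm_X2.
- move=> x s lt_x [[tab_s verts_s] _] xE; rewrite /= xE (verts_s GOAL) //.
  by have [] := tab_s _ (ltnW (XG_lt _ lt_x)).
- by move=> x lt_x; apply: row_lt => //; apply: XG_lt.
- have [_ col_x] := X2E x lt_x; have [_ col_y] := X2E y lt_y; rewrite /= in col_x col_y.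
  by rewrite /= col_x col_y => eq_col eq_row; apply: XG_inj => //; apply: vertex_eq eq_row eq_col.
exists X3; first by rewrite (_ : ml * rate = 0 + ml * round_length true + ml * round_length false
    + ml * round_length true) // /rate; lia.
move=> x lt_x; have [col_x row_x] := X3E x lt_x; have [_ col_goal] := X2E x lt_x.
by apply: vertex_eq row_x (etrans col_x col_goal).
Qed.

End RouteExecution.

(** * The router on the grid *)

Section MainExecution.
Variables ml ms order : nat.
Hypotheses (ml_ge3 : 3 <= ml) (ms_ge2 : 2 <= ms) (le_ms_ml : ms <= ml).
Local Notation n := (ml * ms).
Variables XI XG : nat -> nat.
Hypotheses (perm_XI : permutes n XI) (perm_XG : permutes n XG).

Lemma mainC_correct st (st' := interp (params ml ms order) mainC st) (T := ml * rate) :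
  order = (XI 1 < XI 0).+1 ->
  (forall x, 1 < x < n -> arrays st IO (2 + x) = XI x) ->
  (forall x, x < n -> arrays st IO (2 + n + x) = XG x) ->
  (forall k j, 0 < k < nb_arrays -> arrays st k j = 0) ->
  arrays st' IO 0 = T /\ exists tr, [/\ trace ml ms XI T tr, forall x, x < n -> tr T x = XG x
    & forall k x, k <= T -> x < n -> arrays st' IO (1 + (k * n + x)) = tr k x].
Proof.
move=> orderE io_start io_goal zero.
pose run_c := interp (params ml ms order).
have [start1 goal1] := readC_correct order ml_ge3 ms_ge2 io_start io_goal.
pose s1 := run_c readC st; pose s2 := run_c recoverC s1; pose s3 := run_c tablesC s2.
pose s4 := run_c colourC s3; pose s5 := run_c routeC s4.
have zero2 k j : k \in [:: ROW; MOD3; MOD2; COLOUR] -> arrays s2 k j = 0.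
  by rewrite !inE => /or4P[] /eqP->; rewrite !interp_array // zero.
have start2 x : x < n -> arrays s2 START x = XI x.
  by apply: recoverC_correct => // v; rewrite interp_array // zero.
have ready3 : ready ml ms XI XG s3.
  split=> [|A x].
    by apply: tablesC_correct => // k j; rewrite !inE => /or3P[] /eqP->; apply: zero2.
  by rewrite !inE => /orP[] /eqP-> lt_x; rewrite interp_array ?start2 // interp_array ?goal1.
have [proper4 bounds4] : (forall A, proper n (side ms XI XG A) (arrays s4 COLOUR)) /\
    (forall e, e < n -> 0 < arrays s4 COLOUR e <= ml).
  by apply: colourC_correct => // e; rewrite interp_array // zero2.
have prepared4 : prepared ml ms XI XG (arrays s4 COLOUR) s4.
  by split=> //; apply: ready_interp ready3.
have [X [[tr [trace_tr trT written]] _ stepsE _] XE] :=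
  routeC_correct order ml_ge3 ms_ge2 le_ms_ml perm_XI perm_XG proper4 bounds4 prepared4.
rewrite -[interp _ routeC s4]/s5 in written stepsE.
have ioE j : arrays st' IO j = if j == 0 then T else arrays s5 IO j.
  by rewrite -[LHS]/(upd (arrays s5 IO) 0 (vars s5 var_steps) j) stepsE.
split; first by rewrite ioE.
exists tr; split=> [//|x lt_x|k x le_k lt_x]; first by rewrite trT // XE.
by rewrite ioE -written.
Qed.

End MainExecution.

Section Configurations.
Variables ml ms : nat.
Hypotheses (ml_ge3 : 3 <= ml) (ms_ge2 : 2 <= ms) (le_ms_ml : ms <= ml).
Local Notation n := (ml * ms).
Local Notation config := (config ml ms).
Implicit Types (u v : vtx ml ms) (X Y XI XG : config).

Lemma enc_vtx_lt v : enc_vtx v < n.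
Proof. exact: vertex_lt. Qed.

Lemma enc_vtx_row v : enc_vtx v %/ ms = v.1.
Proof. exact: divn_vertex. Qed.

Lemma enc_vtx_column v : enc_vtx v %% ms = v.2.
Proof. exact: modn_vertex. Qed.

Lemma enc_vtx_inj : injective (@enc_vtx ml ms).
Proof.
move=> u v eq_uv; rewrite [u]surjective_pairing [v]surjective_pairing.
by congr pair; apply: ord_inj; rewrite -?enc_vtx_row -?enc_vtx_column eq_uv.
Qed.

Definition encode X x := if (insub x : option 'I_n) is Some r then enc_vtx (X r) else 0.

Lemma encodeE X (r : 'I_n) : encode X r = enc_vtx (X r).
Proof. by rewrite /encode valK. Qed.

Lemma encode_permutes X : is_config X -> permutes n (encode X).
Proof.
move=> /injectiveP X_inj; split=> [x y lt_x lt_y|x lt_x].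
  rewrite -[x]/(val (Ordinal lt_x)) -[y]/(val (Ordinal lt_y)) !encodeE.
  by move=> /enc_vtx_inj /X_inj /(congr1 val).
by rewrite -[x]/(val (Ordinal lt_x)) encodeE enc_vtx_lt.
Qed.

(* [v0] only witnesses that the grid is not empty. *)
Definition decode v0 (a : nat) : vtx ml ms := (insubd v0.1 (a %/ ms), insubd v0.2 (a %% ms)).

Lemma decodeK v0 a : a < n -> enc_vtx (decode v0 a) = a.
Proof.
move=> lt_a; rewrite /enc_vtx /decode /= !val_insubd.
by rewrite (column_lt ml_ge3 ms_ge2) row_lt // -divn_eq.
Qed.

Lemma legal_valid_step X Y f : legal ml ms f -> injective X ->
  (forall r, enc_vtx (Y r) = f (enc_vtx (X r))) -> valid_step X Y.
Proof.
case=> [[f_inj _] f_adj f_swap] X_inj YE; apply/and3P; split.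
- apply/injectiveP => r1 r2 /(congr1 (@enc_vtx ml ms)); rewrite !YE => /f_inj eq_X.
  by apply/X_inj/enc_vtx_inj/eq_X; apply: enc_vtx_lt.
- apply/forallP => r; case/orP: (f_adj _ (enc_vtx_lt (X r))); rewrite -YE.
    by move=> /eqP /enc_vtx_inj ->; rewrite eqxx.
  by rewrite /adjacent /grid_adj !enc_vtx_row !enc_vtx_column => ->; rewrite orbT.
- apply/existsP => -[r1 /existsP[r2 /and3P[ne_r12 /eqP Y1 /eqP Y2]]].
  have := f_swap _ (enc_vtx_lt (X r1)); rewrite -YE Y1 -YE Y2.
  move=> /(_ erefl) /enc_vtx_inj /X_inj eq_r12.
  by rewrite eq_r12 eqxx in ne_r12.
Qed.

Lemma trace_solution XI XG (tr : nat -> nat -> nat) T : is_config XI ->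
  trace ml ms (encode XI) T tr -> (forall x, x < n -> tr T x = encode XG x) ->
  exists s, [/\ is_solution XI XG s, size s = T &
    forall k (r : 'I_n), k <= T -> enc_vtx (nth XI (XI :: s) k r) = tr k r].
Proof.
move=> config_XI [tr0 tr_legal] trT.
pose conf k : config := [ffun r => decode (XI r) (tr k r)].
have tr_permutes k : k <= T -> permutes n (tr k).
  elim: k => [|k IH] lt_k.
    by apply: eq_permutes (encode_permutes config_XI) => x lt_x; rewrite tr0.
  have [f [perm_f _ _] trE] := tr_legal k lt_k.
  apply: eq_permutes (permutes_comp (IH (ltnW lt_k)) perm_f) => x lt_x.
  by rewrite trE.
have confE k (r : 'I_n) : k <= T -> enc_vtx (conf k r) = tr k r.
  by move=> le_k; rewrite ffunE decodeK //; apply: (tr_permutes k le_k).2.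
have conf0 : conf 0 = XI.
  by apply/ffunP => r; apply: enc_vtx_inj; rewrite confE // tr0 // encodeE.
have confT : conf T = XG.
  by apply/ffunP => r; apply: enc_vtx_inj; rewrite confE // trT // encodeE.
have conf_inj k : k <= T -> injective (conf k).
  move=> le_k r1 r2 /(congr1 (@enc_vtx ml ms)); rewrite !confE // => /(tr_permutes k le_k).1.
  by move=> eq_r; apply: ord_inj; apply: eq_r.
pose s := mkseq (fun k => conf k.+1) T.
have nth_s k : k <= T -> nth XI (XI :: s) k = conf k.
  by case: k => [|k] lt_k; rewrite ?conf0 //= nth_mkseq.
exists s; split; last by move=> k r le_k; rewrite nth_s // confE.
  split; last by rewrite (last_nth XI) size_mkseq nth_s.
  apply/(pathP XI) => k; rewrite size_mkseq => lt_k; rewrite nth_s ?(ltnW lt_k) // /s nth_mkseq //.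
  have [f legal_f trE] := tr_legal k lt_k.
  apply: (legal_valid_step legal_f) => [|r]; first exact/conf_inj/ltnW.
  by rewrite !confE ?trE // ltnW.
by rewrite size_mkseq.
Qed.

Lemma init_mem_start XI XG x : x < n -> init_mem XI XG (2 + x) = encode XI x.
Proof. by move=> lt_x; rewrite /init_mem addKn /encode insubT. Qed.

Lemma init_mem_goal XI XG x : x < n -> init_mem XI XG (2 + n + x) = encode XG x.
Proof.
move=> lt_x; rewrite /init_mem -addnA addKn addKn insubN //.
by rewrite -leqNgt leq_addr.
Qed.

Lemma init_mem_out XI XG a : 2 + n + n <= a -> init_mem XI XG a = 0.
Proof.
move=> le_a; rewrite /init_mem !insubN; try by rewrite -leqNgt; lia.
by case: eqP; [lia|]; case: eqP; [lia|].
Qed.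

Lemma memory_bound : 1 + (ml * rate).+1 * n <= base_address ml.
Proof.
have ml_cube : ml ^ 3 <= 8 ^ ml.
  by rewrite -[8]/(2 ^ 3) -expnM mulnC expnM leq_exp2r // ltnW // ltn_expl.
have cube_n : ml * n <= ml ^ 3 by rewrite !expnS expn0 muln1 !leq_mul2l le_ms_ml !orbT.
have n_le : n <= ml * n by rewrite leq_pmull //; lia.
rewrite rateE /base_address; have : 0 < n by nia.
by move: (8 ^ ml) (ml ^ 3) ml_cube cube_n => u w; rewrite -[(ml * 222).+1]addn1 mulnDl mulnAC; lia.
Qed.

Lemma steps_bound order :
  ml * 17 + 209 + (cost (params ml ms order) mainC + 190) <= (coef mainC + 416) * n ^ 3.
Proof.
have n_gt0 : 0 < n by nia.
have cost_n : cost (params ml ms order) mainC <= coef mainC * n ^ 3.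
  rewrite -degree_mainC; apply: cost_le n_gt0 _ loops_mainC.
  by move=> [|[|[|p]]] // _; rewrite /params /=; nia.
have le_n : n <= n ^ 3 by rewrite -{1}(expn1 n) leq_pexp2l.
have ml_n : ml <= n by nia.
by rewrite mulnDl; lia.
Qed.

Lemma assemble_halts c time XI XG (m := init_mem XI XG) (par := params ml ms (m 3 < m 2).+1) :
  wf_cmd c -> ml * 17 + 209 + (cost par c + 190) <= time * n ^ 3 ->
  halted (assemble c) (final_state (assemble c) time XI XG) /\
  exists2 st, (forall i, 4 <= i -> arrays st IO i = m i) /\
    (forall k i, 0 < k < nb_arrays -> arrays st k i = 0)
    & forall a, a < base_address ml ->
        (final_state (assemble c) time XI XG).2 a = arrays (interp par c st) IO a.
Proof.
move=> wf_c steps_c; have n_bound := memory_bound.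
have out_of_input a : base_address ml <= a -> m a = 0.
  by move=> le_a; apply: init_mem_out; move: n_bound; rewrite rateE; nia.
have [st st_init [m' reach m'E]] :=
  assemble_correct wf_c (erefl : m 0 = ml) (erefl : m 1 = ms) out_of_input.
have halts : step (assemble c) (size (assemble c), m') = None by rewrite /step nth_default.
rewrite /final_state (reaches_halted reach steps_c halts) /halted halts.
by split=> //; exists st.
Qed.

Definition router := assemble mainC.
Definition time_constant := coef mainC + 416.

Lemma router_halts XI XG : halted router (final_state router time_constant XI XG).
Proof. exact: (@assemble_halts mainC time_constant XI XG wf_mainC (steps_bound _)).1. Qed.

Lemma router_correct XI XG (m := (final_state router time_constant XI XG).2) :
  is_config XI -> is_config XG ->
  exists s, [/\ encodes_solution m XI s, is_solution XI XG s & size s = ml * rate].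
Proof.
move=> config_XI config_XG; have [_ [st [io_st zero_st] mE]] :=
  @assemble_halts mainC time_constant XI XG wf_mainC (steps_bound _).
rewrite -/router -/m in mE; have n_gt1 : 1 < n by nia.
have [start0 start1] : init_mem XI XG 2 = encode XI 0 /\ init_mem XI XG 3 = encode XI 1.
  by split; rewrite -(init_mem_start XI XG) //; lia.
have [||||count [tr [trace_tr trT written]]] := @mainC_correct ml ms
    (init_mem XI XG 3 < init_mem XI XG 2).+1 ml_ge3 ms_ge2 le_ms_ml (encode XI) (encode XG)
    (encode_permutes config_XI) (encode_permutes config_XG) st.
- by rewrite start0 start1.
- by move=> x /andP[gt1_x lt_x]; rewrite io_st ?(init_mem_start XI XG) //; lia.
- by move=> x lt_x; rewrite io_st ?init_mem_goal //; nia.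
- exact: zero_st.
have [s [sol_s size_s nth_s]] := trace_solution config_XI trace_tr trT.
exists s; split=> //; split=> [|k r]; first by rewrite mE ?count ?size_s // /base_address; lia.
rewrite size_s => le_k; rewrite nth_s // -written // -addnA mE //.
by apply: leq_trans memory_bound; have := ltn_ord r; nia.
Qed.

End Configurations.

(** * The average ratio *)

Import Order.TTheory GRing.Theory Num.Theory.
Import IntDist.

Section Average.
Variables ml ms : nat.
Hypotheses (ml_ge3 : 3 <= ml) (ms_ge2 : 2 <= ms).
Local Notation n := (ml * ms).
Local Notation vtx := (vtx ml ms).
Local Notation config := (config ml ms).
Implicit Types (X Y : config) (u v : vtx * vtx).

Lemma solution_row_distance X Y s r : is_solution X Y s -> `|(X r).1 - (Y r).1| <= size s.
Proof.
case; elim: s X => [|Z s IH] X /=; first by move=> _ ->; rewrite distnn.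
move=> /andP[/and3P[_ /forallP /(_ r) adj_r _] path_s] last_s.
have := IH _ path_s last_s; case/orP: adj_r => [/eqP ->|]; first by lia.
by rewrite /grid_adj; lia.
Qed.

Variables r0 r1 : 'I_n.
Hypothesis r_neq : r0 != r1.

Definition configs : {set config} := [set X | is_config X].
Definition configs_at v := [set X in configs | (X r0 == v.1) && (X r1 == v.2)].

Lemma configs_at_diag v : v.1 = v.2 -> #|configs_at v| = 0.
Proof.
move=> eq_v; apply: eq_card0 => X; rewrite !inE; apply/negP.
case/andP=> /injectiveP X_inj /andP[/eqP X0 /eqP X1].
by case/eqP: r_neq; apply: X_inj; rewrite X0 X1.
Qed.

(* A permutation of the vertices that takes [v] to [u] acts on the configurations. *)
Lemma card_configs_at_le v u : v.1 != v.2 -> u.1 != u.2 -> #|configs_at v| <= #|configs_at u|.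
Proof.
case: v u => [v0 v1] [u0 u1] /= ne_v ne_u.
pose w := tperm v0 u0 v1; pose g := (tperm v0 u0 * tperm w u1)%g.
have ne_wu0 : w != u0 by rewrite /w -[X in _ != X](tpermL v0 u0) (inj_eq perm_inj) eq_sym.
have g0 : g v0 = u0 by rewrite /g permM tpermL tpermD // eq_sym.
have g1 : g v1 = u1 by rewrite /g permM -/w tpermL.
pose move_by_g X : config := [ffun r => g (X r)].
have move_inj : injective move_by_g.
  by move=> X Y /ffunP eq_XY; apply/ffunP => r; have := eq_XY r; rewrite !ffunE; apply: perm_inj.
rewrite -(card_imset _ move_inj); apply/subset_leq_card/subsetP => _ /imsetP[X X_at ->].
move: X_at; rewrite !inE => /andP[/injectiveP X_inj /andP[/eqP X0 /eqP X1]] /=.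
rewrite !ffunE X0 X1 /= g0 g1 !eqxx !andbT.
by apply/injectiveP => r r'; rewrite !ffunE => /perm_inj /X_inj.
Qed.

Lemma card_configs v : v.1 != v.2 -> #|configs| = #|configs_at v| * (n * n.-1).
Proof.
move=> ne_v; have -> : #|configs| = \sum_u #|configs_at u|.
  rewrite -sum1_card (partition_big (fun X => (X r0, X r1)) xpredT) //=.
  apply: eq_bigr => u _; rewrite -sum1_card; apply: eq_bigl => X.
  by rewrite !inE.
rewrite (bigID (fun u : vtx * vtx => u.1 != u.2)) /= [X in _ + X]big1 ?addn0; last first.
  by move=> u; rewrite negbK => /eqP; apply: configs_at_diag.
rewrite (eq_bigr (fun _ => #|configs_at v|)) => [|u ne_u]; last first.
  by apply/eqP; rewrite eqn_leq !card_configs_at_le.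
rewrite sum_nat_const mulnC; congr (_ * _).
rewrite -sum1_card -(pair_big_dep xpredT (fun i j : vtx => i != j) (fun _ _ => 1)) /=.
rewrite (eq_bigr (fun _ => n.-1)) => [|u _]; first by rewrite sum_nat_const card_prod !card_ord.
rewrite sum1_card (eq_card (B := predC1 u)) ?cardC1 ?card_prod ?card_ord // => x.
by rewrite !inE eq_sym.
Qed.

Lemma card_close_rows (i x : nat) : \sum_(a < ml) (`|i - a| <= x : nat) <= 2 * x + 1.
Proof.
rewrite -(big_mkord xpredT (fun a => (`|i - a| <= x : nat))) -big_mkcond /= sum1_count.
rewrite -size_filter -(size_iota (i - x) (2 * x + 1)); apply: uniq_leq_size.
  by rewrite filter_uniq // iota_uniq.
by move=> a; rewrite mem_filter mem_iota; lia.
Qed.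

Lemma card_close_vertices (i x : nat) : \sum_(v : vtx) (`|i - v.1| <= x : nat) <= ms * (2 * x + 1).
Proof.
rewrite -(pair_bigA _ (fun (a : 'I_ml) (_ : 'I_ms) => (`|i - a| <= x : nat))) /= exchange_big /=.
apply: (@leq_trans (\sum_(j < ms) (2 * x + 1))).
  by apply: leq_sum => j _; apply: card_close_rows.
by rewrite sum_nat_const card_ord.
Qed.

Lemma card_instances : #|configs| * #|configs| <= 2 * #|instances ml ms|.
Proof.
have configs_many : #|configs| = 0 \/ 1 < #|configs|.
  pose v0 : vtx := (Ordinal (ltnW (ltnW ml_ge3)), Ordinal (ltnW ms_ge2)).
  pose v1 : vtx := (Ordinal (ltnW ml_ge3), Ordinal (ltnW ms_ge2)).
  rewrite (@card_configs (v0, v1) isT); case: #|_| => [|k]; [by left | right].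
  have [n_gt1 pred_gt0] : 1 < n /\ 0 < n.-1 by nia.
  by apply: leq_trans n_gt1 _; nia.
pose diag := [set p : config * config | p.1 == p.2].
have -> : instances ml ms = finset.setX configs configs :\: diag.
  by apply/setP => p; rewrite !inE; case: (is_config _); case: (is_config _); rewrite ?andbF ?andbT.
have card_diag := cardsID diag (finset.setX configs configs); rewrite cardsX in card_diag.
suff : #|finset.setX configs configs :&: diag| <= #|configs|.
  move: configs_many card_diag; move: #|configs| #|_ :&: _| #|_ :\: _| => N D I.
  by case=> [->|]; nia.
apply: leq_trans (leq_imset_card (fun X => (X, X)) configs).
apply/subset_leq_card/subsetP => -[X Y]; rewrite !inE /= => /andP[/andP[config_X _] /eqP <-].
by apply: imset_f; rewrite inE.
Qed.

Local Open Scope ring_scope.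

Definition row_weight (i0 i1 : nat) v : rat := ((maxn `|i0 - v.1.1| `|i1 - v.2.1|).+1%:R)^-1.

(* Up to a factor two, [weight X Y] bounds the inverse of the length of a solution. *)
Definition weight X Y := row_weight (X r0).1 (X r1).1 (Y r0, Y r1).

Lemma row_weight_ge0 i0 i1 v : 0 <= row_weight i0 i1 v.
Proof. by rewrite invr_ge0 ler0n. Qed.

Lemma sum_nearer_weight (i0 i1 : nat) : \sum_(v0 : vtx) \sum_(v1 : vtx)
  (`|i1 - v1.1| <= `|i0 - v0.1|)%:R / (`|i0 - v0.1|.+1)%:R <= (2 * ms * n)%:R :> rat.
Proof.
apply: (@le_trans _ _ (\sum_(v0 : vtx) (2 * ms)%:R)); last first.
  by rewrite sumr_const card_prod !card_ord -mulrnA.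
apply: ler_sum => v0 _; rewrite -mulr_suml -natr_sum.
rewrite ler_pdivrMr ?ltr0n // -natrM ler_nat.
by apply: leq_trans (card_close_vertices _ _) _; move: `|_ - _|%N => x; nia.
Qed.

(* Splitting according to which distance is larger makes the sum over the other
   vertex a count of at most [2 x + 1] rows. *)
Lemma sum_row_weight i0 i1 : \sum_v row_weight i0 i1 v <= (4 * ms * n)%:R.
Proof.
have split_sum := lerD (sum_nearer_weight i0 i1) (sum_nearer_weight i1 i0).
rewrite [X in _ + X <= _]exchange_big -natrD in split_sum.
rewrite (_ : 4 * ms * n = 2 * ms * n + 2 * ms * n)%N; last lia.
apply: le_trans split_sum; rewrite -big_split /=.
rewrite -(pair_bigA _ (fun v0 v1 : vtx => row_weight i0 i1 (v0, v1))) /=.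
apply: ler_sum => v0 _; rewrite -big_split /=; apply: ler_sum => v1 _; rewrite /row_weight /=.
move: `|i0 - _|%N `|i1 - _|%N => x y.
have inv_ge0 z : 0 <= (z.+1%:R)^-1 :> rat by rewrite invr_ge0 ler0n.
case: (leqP y x) => [le_yx|lt_xy]; first by rewrite mul1r lerDl mulr_ge0 ?ler0n.
by rewrite (ltnW lt_xy) mul0r add0r mul1r.
Qed.

Lemma sum_weight X :
  \sum_(Y in configs) weight X Y * (n * n.-1)%:R <= (4 * ms * n * #|configs|)%:R.
Proof.
rewrite -mulr_suml (partition_big (fun Y => (Y r0, Y r1)) xpredT) //= mulr_suml.
apply: (@le_trans _ _ (\sum_v #|configs|%:R * row_weight (X r0).1 (X r1).1 v)); last first.
  by rewrite -mulr_sumr natrM mulrC ler_wpM2r ?ler0n ?sum_row_weight.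
apply: ler_sum => v _; set w := row_weight _ _ v.
rewrite (eq_bigr (fun=> w)) => [|Y /andP[_ /eqP vE]]; last by rewrite /w -vE.
rewrite sumr_const -[w *+ _]mulr_natl mulrAC ler_wpM2r ?row_weight_ge0 //.
rewrite (_ : #|_| = #|configs_at v|)%N; last by apply: eq_card => Y; rewrite unfold_in !inE.
by rewrite -natrM ler_nat; case: (eqVneq v.1 v.2) => [/configs_at_diag->|/card_configs->].
Qed.

Lemma inv_makespan_le_weight X Y T : is_min_makespan X Y T -> X != Y ->
  (T%:R)^-1 <= 2%:R * weight X Y.
Proof.
case=> [[s [sol_s size_s]] _] ne_XY.
have := solution_row_distance r0 sol_s; have := solution_row_distance r1 sol_s.
rewrite size_s /weight /row_weight /=; move: `|_ - _|%N `|_ - _|%N => y x le_yT le_xT.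
have T_gt0 : (0 < T)%N.
  rewrite lt0n; apply: contraNneq ne_XY => T0.
  by case: s sol_s size_s => [[_ <-]|] //=; rewrite T0.
rewrite ler_pdivlMr ?ltr0n // mulrC ler_pdivrMr ?ltr0n // -natrM ler_nat.
by lia.
Qed.

Definition total_weight := \sum_(X in configs) \sum_(Y in configs) weight X Y.

Lemma total_weight_le : ml%:R * total_weight <= (8 * #|configs| * #|configs|)%:R.
Proof.
set N := #|configs|.
have weight_n : total_weight * (n * n.-1)%:R <= (4 * ms * n * N * N)%:R.
  rewrite mulr_suml; apply: (@le_trans _ _ (\sum_(X in configs) (4 * ms * n * N)%:R)).
    by apply: ler_sum => X _; rewrite mulr_suml; apply: sum_weight.
  by rewrite sumr_const -mulrnA.
have [n_gt1 pairs_gt0] : (1 < n)%N /\ 0 < (n * n.-1)%:R :> rat.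
  by rewrite ltr0n muln_gt0; nia.
rewrite -(ler_pM2r pairs_gt0) -mulrA; apply: le_trans (ler_wpM2l (ler0n _ ml) weight_n) _.
rewrite -!natrM ler_nat.
have -> : (ml * (4 * ms * n * N * N) = (4 * n * (N * N)) * n)%N by lia.
have -> : (8 * N * N * (n * n.-1) = (4 * n * (N * N)) * (2 * n.-1))%N by lia.
by rewrite leq_mul2l; apply/orP; right; lia.
Qed.

Lemma sum_instances_weight : \sum_(p in instances ml ms) weight p.1 p.2 <= total_weight.
Proof.
rewrite /total_weight pair_big [leRHS](bigID (fun p : config * config => p.1 != p.2)) /=.
rewrite (eq_bigl (fun p => (p.1 \in configs) && (p.2 \in configs) && (p.1 != p.2))); last first.
  by move=> p; rewrite !inE andbA.
by rewrite lerDl; apply: sumr_ge0 => p _; apply: row_weight_ge0.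
Qed.

Lemma average_ratio_le K (out opt : config -> config -> nat) :
  (forall X Y, is_config X -> is_config Y -> is_min_makespan X Y (opt X Y)) ->
  (forall X Y, is_config X -> is_config Y -> out X Y = ml * K)%N ->
  (\sum_(p in instances ml ms) ((out p.1 p.2)%:R / (opt p.1 p.2)%:R : rat))
    / (#|instances ml ms|)%:R <= (32 * K)%:R.
Proof.
move=> opt_min outE; have [->|nonempty] := posnP #|instances ml ms|.
  by rewrite invr0 mulr0 ler0n.
rewrite ler_pdivrMr ?ltr0n //.
apply: (@le_trans _ _ ((2 * K)%:R * (ml%:R * total_weight))).
  apply: (@le_trans _ _ (\sum_(p in instances ml ms) (2 * K)%:R * (ml%:R * weight p.1 p.2))).
    apply: ler_sum => p; rewrite inE => /and3P[config1 config2 ne_p]; rewrite outE //.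
    have := inv_makespan_le_weight (opt_min _ _ config1 config2) ne_p.
    move/(ler_wpM2l (ler0n _ (ml * K))) => /le_trans; apply.
    by rewrite !mulrA -!natrM (_ : ml * K * 2 = 2 * K * ml)%N //; lia.
  by rewrite -!mulr_sumr !ler_wpM2l ?ler0n ?sum_instances_weight.
apply: le_trans (ler_wpM2l (ler0n _ _) total_weight_le) _; rewrite -!natrM ler_nat.
have := card_instances; move: #|configs| #|instances ml ms| => N I.
rewrite (_ : 2 * K * (8 * N * N) = 16 * K * (N * N))%N; last lia.
rewrite (_ : 32 * K * I = 16 * K * (2 * I))%N; last lia.
by rewrite leq_mul2l orbC => ->.
Qed.

End Average.

Local Open Scope ring_scope.

Theorem theorem3 :
  exists (C : rat) (P : program) (c N0 : nat),
    (* P halts within c * |V|^3 steps on every instance and outputs a valid solution *)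
    (forall (ml ms : nat) (XI XG : config ml ms),
        (3 <= ml)%N -> (2 <= ms)%N -> (ms <= ml)%N ->
        is_config XI -> is_config XG ->
        halted P (final_state P c XI XG) /\
        exists s, encodes_solution (final_state P c XI XG).2 XI s /\
                  is_solution XI XG s) /\
    (* average approximation ratio over instances with XI <> XG is at most C *)
    (forall (ml ms : nat), (N0 <= ml)%N -> (3 <= ml)%N -> (2 <= ms)%N -> (ms <= ml)%N ->
      forall opt : config ml ms -> config ml ms -> nat,
        (forall XI XG : config ml ms, is_config XI -> is_config XG ->
           is_min_makespan XI XG (opt XI XG)) ->
        (\sum_(p in instances ml ms)
            ((out_makespan P c p.1 p.2)%:R / (opt p.1 p.2)%:R : rat))
          / (#|instances ml ms|)%:R <= C).
Proof.
exists (32 * rate)%:R, router, time_constant, 0%N; split.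
  move=> ml ms XI XG ml_ge3 ms_ge2 le_ms_ml config_XI config_XG.
  have [s [enc_s sol_s _]] := router_correct ml_ge3 ms_ge2 le_ms_ml config_XI config_XG.
  by split; [apply: router_halts | exists s].
move=> ml ms _ ml_ge3 ms_ge2 le_ms_ml opt opt_min.
have n_gt1 : (1 < ml * ms)%N by nia.
apply: (@average_ratio_le ml ms ml_ge3 ms_ge2 (Ordinal (ltnW n_gt1)) (Ordinal n_gt1)) => //.
move=> XI XG config_XI config_XG.
have [s [[makespan _] _ size_s]] := router_correct ml_ge3 ms_ge2 le_ms_ml config_XI config_XG.
by rewrite /out_makespan makespan.
Qed.
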